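(* Let $(X,\omega)$ be a boundaryless smooth effective symplectic orbifold with a real orbifold polarization $P$, and let $(L,\nabla)$ be a prequantum line bundle over $X$. No global quotient presentation is assumed. A Lagrangian leaf $\mathcal{L}\subset X$ of $P$ is Bohr--Sommerfeld if and only if the leafwise flat orbifold holonomy of $L|_{\mathcal{L}}$ is trivial for every orbifold loop in $\mathcal{L}$. In a single uniformizing chart $(V,G,\pi)$, if such a loop is represented by a path $\tilde\gamma$ in a lifted leaf $\tilde{\mathcal{L}}\subset V$ with $\tilde\gamma(1)=g\cdot\tilde\gamma(0)$ for a local group element $g\in G$ preserving $\tilde{\mathcal{L}}$, the triviality condition for this loop is $$\Phi_{g^{-1}}\circ\mathrm{Par}_{\tilde\gamma}=\mathrm{Id}\quad\text{on }(L_V)_{\tilde\gamma(0)}.$$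
   Context: Orbifold: a paracompact Hausdorff space $|X|$ with an atlas of uniformizing charts $(V,G,\pi)$, where $V$ is a connected open subset of Euclidean space, $G$ is a finite group acting smoothly and effectively on $V$, and $\pi:V\to|X|$ is $G$-invariant and induces a homeomorphism from $V/G$ onto an open set; charts are compatible via equivariant open embeddings. Orbifold forms and subbundles of $TX\otimes\mathbb{C}$ are families of $G$-invariant objects on charts compatible under chart embeddings. A symplectic orbifold carries a closed nondegenerate orbifold 2-form $\omega$; write $\dim X=2n$. A prequantum line bundle $(L,\nabla)$ is a Hermitian orbifold line bundle ($G$-equivariant Hermitian line bundles $L_V\to V$ compatibly glued) with a unitary orbifold connection ($G$-equivariant on each chart, compatible) with curvature $F_\nabla=-\frac{i}{\hbar}\omega$. Write $\Phi_g\colon (L_V)_x\to(L_V)_{g\cdot x}$ for the lifted action of $g\in G$ on $L_V$. An orbifold polarization $P$ is a rank-$n$ complex orbifold subbundle of $TX\otimes\mathbb{C}$ that is Lagrangian ($\omega|_P=0$) and involutive on each chart; it is real if $P=\overline P$, so $P=P_{\mathbb R}\otimes\mathbb{C}$ with $P_{\mathbb R}\subset TX$ integrating, on each chart, to a $G$-invariant foliation by Lagrangian submanifolds. A leaf $\mathcal{L}$ of $P$ is the maximal connected immersed orbifold obtained by gluing the local lifted leaves under chart embeddings and local group actions. Since $\omega|_{\mathcal{L}}=0$, $\nabla$ restricts to a flat connection on $L|_{\mathcal{L}}$; $\mathrm{Par}_{\tilde\gamma}$ denotes parallel transport along a path in a lifted leaf. Orbifold loop in $\mathcal{L}$: a finite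 sequence of paths in lifted leaves in charts, consecutive ones (and the last with the first) being joined by identifications given by chart embeddings or by local group elements carrying the endpoint of one path to the starting point of the next and carrying lifted leaf to lifted leaf. Its holonomy is the composition of the parallel transports with the induced identifications on fibers of $L$ (for a single-chart representative $(\tilde\gamma,g)$ with $\tilde\gamma(1)=g\cdot\tilde\gamma(0)$, the closing identification is $\Phi_{g^{-1}}$). Bohr--Sommerfeld leaf: $\mathcal{L}$ is Bohr--Sommerfeld if $L|_{\mathcal{L}}$ admits a non-zero covariantly constant orbifold section, i.e. compatible non-zero parallel sections $\tilde s$ on lifted leaf segments satisfying $\Phi_g(\tilde s(x))=\tilde s(g\cdot x)$ whenever $g$ preserves the lifted leaf. *)

(* Defs.v *)
From HB Require Import structures.
From mathcomp Require Import all_boot all_order all_algebra fingroup.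
From mathcomp Require Import complex.
From mathcomp Require Import all_classical all_reals topology normedtype derive.
From Stdlib Require Import Relation_Operators.

Set Implicit Arguments.
Unset Strict Implicit.
Unset Printing Implicit Defensive.

Import Order.TTheory GRing.Theory Num.Theory.
Import numFieldNormedType.Exports.

Local Open Scope classical_set_scope.
Local Open Scope ring_scope.
Local Open Scope complex_scope.

Section Smooth.
Context {R : realType}.

(* All iterated directional derivatives up to order k exist and are
   continuous on U; on an open subset of a finite-dimensional space this is
   the class C^k. *)
Fixpoint Ck {E F : normedModType R} (k : nat) (U : set E) (f : E -> F) : Prop :=
  (forall x, U x -> {for x, continuous f}) /\
  match k with
  | 0 => True
  | k'.+1 => forall v : E, (forall x, U x -> derivable f x v) /\
                           Ck k' U (fun x => 'D_v f x)
  end.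

Definition smooth_on {E F : normedModType R} (U : set E) (f : E -> F) : Prop :=
  forall k, Ck k U f.

(* Complex-valued functions of real variables are treated through their real
   and imaginary parts. *)
Definition Csmooth_on {E : normedModType R} (U : set E) (f : E -> R[i]) : Prop :=
  smooth_on U (fun x => complex.Re (f x)) /\
  smooth_on U (fun x => complex.Im (f x)).

Definition CD {E : normedModType R} (v : E) (f : E -> R[i]) (x : E) : R[i] :=
  ('D_v (fun y => complex.Re (f y)) x : R) +i*
  ('D_v (fun y => complex.Im (f y)) x : R).

Definition toC {m : nat} (u : 'rV[R]_m) : 'rV[R[i]]_m :=
  map_mx (fun a : R => a%:C) u.

Definition conjV {m : nat} (u : 'rV[R[i]]_m) : 'rV[R[i]]_m :=
  map_mx (fun z : R[i] => z^*) u.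

Definition DC {m p : nat} (f : 'rV[R]_m -> 'rV[R]_p) (x : 'rV[R]_m)
    (u : 'rV[R[i]]_m) : 'rV[R[i]]_p :=
  toC ('D_(map_mx (@complex.Re R) u) f x)
  + 'i *: toC ('D_(map_mx (@complex.Im R) u) f x).

Definition pairing {K : comPzRingType} {m : nat} (A : 'M[K]_m)
    (u v : 'rV[K]_m) : K := (u *m A *m v^T) 0 0.

End Smooth.

Definition paracompact (X : topologicalType) : Prop :=
  forall F : set (set X), F `<=` open -> \bigcup_(A in F) A = [set: X] ->
  exists G : set (set X),
    [/\ G `<=` open, \bigcup_(A in G) A = [set: X],
        (forall B, G B -> exists2 A, F A & B `<=` A) &
        forall x : X, exists2 N, nbhs x N & finite_set [set B | G B /\ B `&` N !=set0]].

Section Orbifold.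
Context {R : realType}.

Record chart (m : nat) (X : topologicalType) := Chart {
  cdom : set 'rV[R]_m;
  cgrp : finGroupType;
  cact : cgrp -> 'rV[R]_m -> 'rV[R]_m;
  cproj : 'rV[R]_m -> X;
  cdom_open : open cdom;
  cdom_connected : connected cdom;
  cact_dom : forall g x, cdom x -> cdom (cact g x);
  cact1 : forall x, cdom x -> cact 1%g x = x;
  cactM : forall g h x, cdom x -> cact (g * h)%g x = cact g (cact h x);
  cact_smooth : forall g, smooth_on cdom (cact g);
  cact_effective : forall g, (forall x, cdom x -> cact g x = x) -> g = 1%g;
  (* cproj induces a homeomorphism from V / G (with the quotient topology)
     onto an open subset of X *)
  cproj_open : open (cproj @` cdom);
  cproj_fib : forall x y, cdom x -> cdom y ->
    (cproj x = cproj y <-> exists g, y = cact g x);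
  cproj_quot : forall A : set X, A `<=` cproj @` cdom ->
    (open A <-> open (cdom `&` cproj @^-1` A)) }.

Section Embedding.
Context {m : nat} {X : topologicalType}.

Definition is_embedding (c d : chart m X) (f : 'rV[R]_m -> 'rV[R]_m) : Prop :=
  [/\ [/\ f @` cdom c `<=` cdom d, open (f @` cdom c), smooth_on (cdom c) f &
          exists2 f', smooth_on (f @` cdom c) f' &
                      forall x, cdom c x -> f' (f x) = x],
      (exists th : cgrp c -> cgrp d,
          (forall g h, th (g * h)%g = (th g * th h)%g) /\
          forall g x, cdom c x -> f (cact g x) = cact (th g) (f x)) &
      forall x, cdom c x -> cproj d (f x) = cproj c x].

Record embedding (c d : chart m X) := Embedding {
  emap :> 'rV[R]_m -> 'rV[R]_m;
  emapP : is_embedding c d emap }.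

End Embedding.

Record orbifold (m : nat) (X : topologicalType) := Orbifold {
  oidx : Type;
  och :> oidx -> chart m X;
  o_hausdorff : hausdorff_space X;
  o_paracompact : paracompact X;
  o_cover : forall p : X, exists i x, cdom (och i) x /\ cproj (och i) x = p;
  o_compat : forall i j x y, cdom (och i) x -> cdom (och j) y ->
    cproj (och i) x = cproj (och j) y ->
    exists k z, [/\ cdom (och k) z, cproj (och k) z = cproj (och i) x,
                    inhabited (embedding (och k) (och i)) &
                    inhabited (embedding (och k) (och j))] }.

Section Structures.
Context {m : nat} {X : topologicalType}.

(* In a chart the form is pairing (sform i x), on row vectors. *)
Record symplectic (O : orbifold m X) := Symplectic {
  sform :> oidx O -> 'rV[R]_m -> 'M[R]_m;
  s_smooth : forall i a b, smooth_on (cdom (O i)) (fun x => sform i x a b);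
  s_alt : forall i x, cdom (O i) x -> (sform i x)^T = - sform i x;
  s_nondeg : forall i x, cdom (O i) x -> sform i x \in unitmx;
  s_closed : forall i x, cdom (O i) x -> forall u v w : 'rV[R]_m,
    'D_u (fun y => pairing (sform i y) v w) x
    + 'D_v (fun y => pairing (sform i y) w u) x
    + 'D_w (fun y => pairing (sform i y) u v) x = 0;
  s_inv : forall i g x, cdom (O i) x -> forall u v,
    pairing (sform i (cact g x)) ('D_u (@cact _ _ (O i) g) x) ('D_v (@cact _ _ (O i) g) x)
    = pairing (sform i x) u v;
  s_emb : forall i j (l : embedding (O i) (O j)) x, cdom (O i) x -> forall u v,
    pairing (sform j (l x)) ('D_u l x) ('D_v l x) = pairing (sform i x) u v }.

Definition Csmooth_field (U : set 'rV[R]_m) (Y : 'rV[R]_m -> 'rV[R[i]]_m) : Prop :=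
  forall k, Csmooth_on U (fun x => Y x 0 k).

Definition Cbracket (Y Z : 'rV[R]_m -> 'rV[R[i]]_m) (x : 'rV[R]_m) : 'rV[R[i]]_m :=
  \row_k \sum_(j < m)
    (Y x 0 j * CD (delta_mx 0 j) (fun y => Z y 0 k) x
     - Z x 0 j * CD (delta_mx 0 j) (fun y => Y y 0 k) x).

Record polarization (n : nat) (O : orbifold m X) (w : symplectic O) := Polarization {
  pol :> oidx O -> 'rV[R]_m -> {vspace 'rV[R[i]]_m};
  pol_rank : forall i x, cdom (O i) x -> \dim (pol i x) = n;
  pol_smooth : forall i x, cdom (O i) x ->
    exists (U : set 'rV[R]_m) (Y : 'I_n -> 'rV[R]_m -> 'rV[R[i]]_m),
      [/\ open U, U x, U `<=` cdom (O i), (forall a, Csmooth_field U (Y a)) &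
          forall y, U y -> pol i y = <<[seq Y a y | a <- enum 'I_n]>>%VS];
  pol_inv : forall i g x, cdom (O i) x -> forall u,
    u \in pol i x <-> DC (@cact _ _ (O i) g) x u \in pol i (cact g x);
  pol_emb : forall i j (l : embedding (O i) (O j)) x, cdom (O i) x -> forall u,
    u \in pol i x <-> DC l x u \in pol j (l x);
  pol_lagrangian : forall i x, cdom (O i) x -> forall u v,
    u \in pol i x -> v \in pol i x ->
    pairing (map_mx (fun a : R => a%:C) (w i x)) u v = 0;
  pol_involutive : forall i (U : set 'rV[R]_m) Y Z,
    open U -> U `<=` cdom (O i) -> Csmooth_field U Y -> Csmooth_field U Z ->
    (forall x, U x -> Y x \in pol i x) -> (forall x, U x -> Z x \in pol i x) ->
    forall x, U x -> Cbracket Y Z x \in pol i x }.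

Definition real_polarization n (O : orbifold m X) (w : symplectic O)
    (P : polarization n w) : Prop :=
  forall i x, cdom (O i) x -> forall u, u \in P i x <-> conjV u \in P i x.

End Structures.

Section Leaves.
Context {m n : nat} {X : topologicalType} {O : orbifold m X} {w : symplectic O}.
Variable P : polarization n w.

Definition polR (i : oidx O) (x : 'rV[R]_m) : set 'rV[R]_m :=
  [set u | toC u \in P i x].

(* phi : W -> V is an injectively immersed connected n-dimensional integral
   manifold of P_R, i.e. a parametrized connected open piece of a leaf. *)
Definition plaque (i : oidx O) (W : set 'rV[R]_n) (phi : 'rV[R]_n -> 'rV[R]_m) : Prop :=
  [/\ [/\ open W, connected W & smooth_on W phi],
      phi @` W `<=` cdom (O i),
      (forall a b, W a -> W b -> phi a = phi b -> a = b),
      (forall a, W a -> forall h, 'D_h phi a = 0 -> h = 0) &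
      forall a, W a -> range (fun h => 'D_h phi a) = polR i (phi a)].

(* The leaf through x of the foliation of the chart domain integrating P_R:
   the points that a finite chain of plaques joins to x. *)
Inductive lifted_leaf (i : oidx O) (x : 'rV[R]_m) : set 'rV[R]_m :=
| lifted_leaf_refl : lifted_leaf i x x
| lifted_leaf_step W phi a b : plaque i W phi -> W a -> W b ->
    lifted_leaf i x (phi a) -> lifted_leaf i x (phi b).

(* Gluing of the lifted leaves.  It takes place in X, so that points of charts
   related by chart embeddings or local groups are identified. *)
Definition leaf_glue (p q : X) : Prop :=
  exists i x y, [/\ cdom (O i) x, lifted_leaf i x y,
                    cproj (O i) x = p & cproj (O i) y = q].

Definition is_leaf (Lf : set X) : Prop :=
  exists p, Lf = [set q | clos_refl_sym_trans X leaf_glue p q].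

Definition leaf_points (Lf : set X) (i : oidx O) : set 'rV[R]_m :=
  cdom (O i) `&` cproj (O i) @^-1` Lf.

Definition is_lifted_leaf (Lf : set X) (i : oidx O) (Lt : set 'rV[R]_m) : Prop :=
  exists x, leaf_points Lf i x /\ Lt = lifted_leaf i x.

(* gamma is piecewise smooth from a to b for the manifold structure of a leaf.
   Constant pieces are listed explicitly, so that the existence of a plaque
   through the point (Frobenius) is not needed for them. *)
Inductive leaf_curve (i : oidx O) (gamma : R -> 'rV[R]_m) : R -> R -> Prop :=
| leaf_curve_cst a b : a < b ->
    (forall t, a <= t <= b -> gamma t = gamma a) -> leaf_curve i gamma a b
| leaf_curve_plaque a b (I : set R) W phi (c : R -> 'rV[R]_n) : a < b ->
    plaque i W phi -> open I -> smooth_on I c ->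
    (forall t, a <= t <= b -> [/\ I t, W (c t) & gamma t = phi (c t)]) ->
    leaf_curve i gamma a b
| leaf_curve_cat a b d : leaf_curve i gamma a b -> leaf_curve i gamma b d ->
    leaf_curve i gamma a d.

(* Only the restriction of gamma to [0, 1] matters. *)
Definition leaf_path (i : oidx O) (Lt : set 'rV[R]_m) (gamma : R -> 'rV[R]_m) : Prop :=
  leaf_curve i gamma 0 1 /\ (forall t, 0 <= t <= 1 -> Lt (gamma t)).

End Leaves.

Section Bundles.
Context {m : nat}.

(* lb_fib x is only meaningful for x in V.  The frames lb_fr a are the local
   trivializations; they determine the smooth structure. *)
Record line_bundle (V : set 'rV[R]_m) := LineBundle {
  lb_fib :> 'rV[R]_m -> lmodType R[i];
  lb_idx : Type;
  lb_dom : lb_idx -> set 'rV[R]_m;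
  lb_fr : lb_idx -> forall x, lb_fib x;
  lb_dom_open : forall a, open (lb_dom a);
  lb_dom_sub : forall a, lb_dom a `<=` V;
  lb_cover : forall x, V x -> exists a, lb_dom a x;
  lb_frP : forall a x, lb_dom a x -> bijective (fun z : R[i] => z *: lb_fr a x);
  lb_trans : forall a b (f : 'rV[R]_m -> R[i]),
    (forall x, lb_dom a x -> lb_dom b x -> lb_fr b x = f x *: lb_fr a x) ->
    Csmooth_on (lb_dom a `&` lb_dom b) f }.

Definition smooth_section V (E : line_bundle V) (U : set 'rV[R]_m)
    (s : forall x, E x) : Prop :=
  forall a (f : 'rV[R]_m -> R[i]),
    (forall x, U x -> lb_dom a x -> s x = f x *: lb_fr a x) ->
    Csmooth_on (U `&` lb_dom a) f.

(* Local smooth sections over an open U are represented by total dependent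
   functions.  nab u s is the covariant derivative of s in the direction of the
   constant vector field u. *)
Record herm_conn V (E : line_bundle V) := HermConn {
  herm : forall x, E x -> E x -> R[i];
  nab : 'rV[R]_m -> (forall x, E x) -> forall x, E x;
  herm_lin : forall x, V x -> forall (a : R[i]) (u u' v : E x),
    herm (a *: u + u') v = a * herm u v + herm u' v;
  herm_sym : forall x, V x -> forall u v : E x, herm u v = (herm v u)^*;
  herm_pos : forall x, V x -> forall u : E x, u != 0 -> 0 < herm u u;
  herm_smooth : forall U s t, open U -> U `<=` V ->
    smooth_section U s -> smooth_section U t ->
    Csmooth_on U (fun x => herm (s x) (t x));
  nab_smooth : forall U u s, open U -> U `<=` V ->
    smooth_section U s -> smooth_section U (nab u s);
  nab_local : forall U u s t, open U -> U `<=` V ->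
    smooth_section U s -> (forall x, U x -> s x = t x) ->
    forall x, U x -> nab u s x = nab u t x;
  nab_dir : forall U (a : R) u v s, open U -> U `<=` V -> smooth_section U s ->
    forall x, U x -> nab (a *: u + v) s x = a%:C *: nab u s x + nab v s x;
  nab_add : forall U u s t, open U -> U `<=` V ->
    smooth_section U s -> smooth_section U t ->
    forall x, U x -> nab u (fun y => s y + t y) x = nab u s x + nab u t x;
  nab_leibniz : forall U u (f : 'rV[R]_m -> R[i]) s, open U -> U `<=` V ->
    Csmooth_on U f -> smooth_section U s ->
    forall x, U x -> nab u (fun y => f y *: s y) x = CD u f x *: s x + f x *: nab u s x;
  nab_unitary : forall U u s t, open U -> U `<=` V ->
    smooth_section U s -> smooth_section U t ->
    forall x, U x -> CD u (fun y => herm (s y) (t y)) x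
                     = herm (nab u s x) (t x) + herm (s x) (nab u t x) }.

(* The curvature is F; the bracket term is absent because u and v are constant
   vector fields. *)
Definition has_curvature V (E : line_bundle V) (H : herm_conn E)
    (F : 'rV[R]_m -> 'rV[R]_m -> 'rV[R]_m -> R[i]) : Prop :=
  forall U u v s, open U -> U `<=` V -> smooth_section U s ->
  forall x, U x ->
    nab H u (nab H v s) x - nab H v (nab H u s) x = F x u v *: s x.

(* F is an isomorphism over the open embedding f, preserving metric and
   connection. *)
Definition bundle_iso V V' (E : line_bundle V) (E' : line_bundle V')
    (H : herm_conn E) (H' : herm_conn E') (f : 'rV[R]_m -> 'rV[R]_m)
    (F : forall x, E x -> E' (f x)) : Prop :=
  (forall x, V x -> [/\ linear (F x), bijective (F x) &
                        forall u v, herm H' (F x u) (F x v) = herm H u v]) /\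
  forall (U : set 'rV[R]_m) (s : forall x, E x) (t : forall x, E' x),
    open U -> U `<=` V -> (forall x, U x -> F x (s x) = t (f x)) ->
    (smooth_section U s <-> smooth_section (f @` U) t) /\
    (smooth_section U s -> forall x u, U x ->
       F x (nab H u s x) = nab H' ('D_u f x) t (f x)).

Definition total_space V (E : line_bundle V) := {x : 'rV[R]_m & E x}.

Definition pt V (E : line_bundle V) x (v : E x) : total_space E := existT _ x v.

Definition on_total V V' (E : line_bundle V) (E' : line_bundle V')
    (f : 'rV[R]_m -> 'rV[R]_m) (F : forall x, E x -> E' (f x))
    (v : total_space E) : total_space E' :=
  pt (F (projT1 v) (projT2 v)).

Definition local_frame V (E : line_bundle V) (U : set 'rV[R]_m) (e : forall x, E x) : Prop :=
  [/\ open U, U `<=` V, smooth_section U e & forall x, U x -> e x != 0].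

(* sigma is a continuous section along gamma over [0, 1] whose covariant
   derivative, computed in local frames, vanishes outside a finite set (the
   break points of gamma). *)
Definition parallel_along V (E : line_bundle V) (H : herm_conn E)
    (gamma : R -> 'rV[R]_m) (sigma : forall t, E (gamma t)) : Prop :=
  exists2 B : set R, finite_set B &
  forall U e (f : R -> R[i]), local_frame U e ->
    (forall t, 0 <= t <= 1 -> U (gamma t) -> sigma t = f t *: e (gamma t)) ->
    (forall t, 0 <= t <= 1 -> U (gamma t) ->
       complex.Re (f r) @[r --> within `[0, 1] (nbhs t)] --> complex.Re (f t) /\
       complex.Im (f r) @[r --> within `[0, 1] (nbhs t)] --> complex.Im (f t)) /\
    (forall t, 0 < t < 1 -> ~ B t -> U (gamma t) ->
       [/\ derivable gamma t (1 : R), derivable (fun r => complex.Re (f r)) t (1 : R),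
           derivable (fun r => complex.Im (f r)) t (1 : R) &
           CD (1 : R) f t *: e (gamma t) + f t *: nab H ('D_(1 : R) gamma t) e (gamma t) = 0]).

Definition Par V (E : line_bundle V) (H : herm_conn E) (gamma : R -> 'rV[R]_m)
    (v : total_space E) : total_space E :=
  @pt V E (gamma 1) (xget 0 [set y : E (gamma 1) |
    exists sigma : forall t, E (gamma t),
      [/\ parallel_along H sigma, pt (sigma 0) = v & sigma 1 = y]]).

End Bundles.

Section Prequantum.
Context {m : nat} {X : topologicalType} {O : orbifold m X}.

Record prequantum (w : symplectic O) (hbar : R) := Prequantum {
  pq_bun :> forall i, line_bundle (cdom (O i));
  pq_conn : forall i, herm_conn (pq_bun i);
  pq_curv : forall i, has_curvature (pq_conn i)
    (fun x u v => - ('i / hbar%:C) * (pairing (w i x) u v)%:C);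
  pq_act : forall i (g : cgrp (O i)) x, pq_bun i x -> pq_bun i (cact g x);
  pq_emb : forall i j (l : embedding (O i) (O j)) x, pq_bun i x -> pq_bun j (l x);
  pq_act_iso : forall i g, bundle_iso (pq_conn i) (pq_conn i) (pq_act (i := i) g);
  pq_emb_iso : forall i j l, bundle_iso (pq_conn i) (pq_conn j) (@pq_emb i j l);
  pq_act1 : forall i v, cdom (O i) (projT1 v) ->
    on_total (pq_act (i := i) 1%g) v = v;
  pq_actM : forall i g h v, cdom (O i) (projT1 v) ->
    on_total (pq_act (i := i) (g * h)%g) v
    = on_total (pq_act (i := i) g) (on_total (pq_act (i := i) h) v);
  pq_emb_comp : forall i j k (l : embedding (O i) (O j)) (l' : embedding (O j) (O k))
      (l'' : embedding (O i) (O k)),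
    (forall x, cdom (O i) x -> l'' x = l' (l x)) ->
    forall v, cdom (O i) (projT1 v) ->
      on_total (pq_emb l'') v = on_total (pq_emb l') (on_total (pq_emb l) v);
  (* a group element is itself a self-embedding of its chart *)
  pq_emb_act : forall i g (l : embedding (O i) (O i)),
    (forall x, cdom (O i) x -> l x = cact g x) ->
    forall v, cdom (O i) (projT1 v) ->
      on_total (pq_emb l) v = on_total (pq_act (i := i) g) v }.

End Prequantum.

Arguments pq_act {m X O w hbar} p {i} g {x} _.
Arguments pq_emb {m X O w hbar} p {i j} l {x} _.

Section Holonomy.
Context {m n : nat} {X : topologicalType} {O : orbifold m X} {w : symplectic O}.
Context {hbar : R}.
Variables (L : prequantum w hbar) (P : polarization n w).

Definition Phi (i : oidx O) (g : cgrp (O i)) : total_space (L i) -> total_space (L i) :=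
  on_total (@pq_act _ _ _ _ _ L i g).

(* The pull-back of s along phi is smooth and covariantly constant for the
   pulled-back connection; everything is computed in local frames of L. *)
Definition parallel_on_plaque (i : oidx O) (W : set 'rV[R]_n)
    (phi : 'rV[R]_n -> 'rV[R]_m) (s : forall x, L i x) : Prop :=
  forall U e (f : 'rV[R]_n -> R[i]), local_frame (E := L i) U e ->
    (forall a, W a -> U (phi a) -> s (phi a) = f a *: e (phi a)) ->
    Csmooth_on (W `&` phi @^-1` U) f /\
    forall a, W a -> U (phi a) -> forall h,
      CD h f a *: e (phi a) + f a *: nab (pq_conn L i) ('D_h phi a) e (phi a) = 0.

Definition bohr_sommerfeld (Lf : set X) : Prop :=
  exists s : forall i x, L i x,
    [/\ exists i x, leaf_points Lf i x /\ s i x != 0,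
        forall i W phi, plaque P i W phi -> phi @` W `<=` leaf_points Lf i ->
          parallel_on_plaque W phi (s i),
        forall i (g : cgrp (O i)) x, leaf_points Lf i x ->
          pq_act L g (s i x) = s i (cact g x) &
        forall i j (l : embedding (O i) (O j)) x, leaf_points Lf i x ->
          pq_emb L l (s i x) = s j (l x)].

(* Identifications: a group element, a chart embedding, or a chart embedding
   used backwards. *)
Inductive join : oidx O -> oidx O -> Type :=
| join_grp i (g : cgrp (O i)) : join i i
| join_emb i j (l : embedding (O i) (O j)) : join i j
| join_back i j (l : embedding (O i) (O j)) : join j i.

Definition joins i j (tau : join i j) (p q : 'rV[R]_m) : Prop :=
  match tau with
  | join_grp i g =>
      cact g p = q /\ cact g @` lifted_leaf P i p `<=` lifted_leaf P i q
  | join_emb i j l =>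
      l p = q /\ l @` lifted_leaf P i p `<=` lifted_leaf P j q
  | join_back i j l =>
      l q = p /\ l @` lifted_leaf P i q `<=` lifted_leaf P j p
  end.

Definition join_fib i j (tau : join i j) : total_space (L i) -> total_space (L j) :=
  match tau with
  | join_grp i g => @Phi i g
  | join_emb i j l => on_total (@pq_emb _ _ _ _ _ L _ _ l)
  | join_back i j l => fun v =>
      xget (pt (0 : L i 0) : {x : 'rV[R]_m & L i x})
        [set u | cdom (O i) (projT1 u) /\ on_total (@pq_emb _ _ _ _ _ L _ _ l) u = v]
  end.

(* A finite non-empty sequence of paths in charts, each followed by an
   identification. *)
Inductive orb_path : oidx O -> oidx O -> Type :=
| orb_last i j (gamma : R -> 'rV[R]_m) (tau : join i j) : orb_path i j
| orb_cons i j k (gamma : R -> 'rV[R]_m) (tau : join i j) (c : orb_path j k) :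
    orb_path i k.

Definition start i j (c : orb_path i j) : 'rV[R]_m :=
  match c with
  | orb_last _ _ gamma _ => gamma 0
  | orb_cons _ _ _ gamma _ _ => gamma 0
  end.

Fixpoint orb_path_to (Lf : set X) i j (c : orb_path i j) (q : 'rV[R]_m) : Prop :=
  match c with
  | orb_last i j gamma tau =>
      [/\ leaf_points Lf i (gamma 0),
          leaf_path P i (lifted_leaf P i (gamma 0)) gamma &
          leaf_points Lf j q /\ joins tau (gamma 1) q]
  | orb_cons i j k gamma tau c' =>
      [/\ leaf_points Lf i (gamma 0),
          leaf_path P i (lifted_leaf P i (gamma 0)) gamma,
          joins tau (gamma 1) (start c') & orb_path_to Lf c' q]
  end.

Definition orbifold_loop (Lf : set X) i (c : orb_path i i) : Prop :=
  orb_path_to Lf c (start c).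

Fixpoint holonomy i j (c : orb_path i j) : total_space (L i) -> total_space (L j) :=
  match c with
  | orb_last i j gamma tau => fun v => join_fib tau (Par (pq_conn L i) gamma v)
  | orb_cons i j k gamma tau c' =>
      fun v => holonomy c' (join_fib tau (Par (pq_conn L i) gamma v))
  end.

Definition trivial_holonomy i (c : orb_path i i) : Prop :=
  forall v : total_space (L i), projT1 v = start c -> holonomy c v = v.

End Holonomy.

End Orbifold.

Arguments chart R m X : clear implicits.
Arguments orbifold R m X : clear implicits.
Arguments Phi {R m X O w hbar} L {i} g _.

(* Main.v *)
Require Import Defs.
From HB Require Import structures.
From mathcomp Require Import all_boot all_order all_algebra fingroup.
From mathcomp Require Import complex ring.
From mathcomp Require Import all_classical all_reals topology normedtype derive.
From mathcomp Require Import landau realfun sequences measure lebesgue_measure.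
From mathcomp Require Import lebesgue_integral ftc.
From mathcomp.analysis Require Import exp trigo.

(** A flat section of [L] over the leaf is its own parallel transport along every
    path in the leaf and is respected by all identifications, so it is fixed,
    and with it every vector of the fibre, by the holonomy of every loop.

    Conversely, fix a non-zero vector over one point of the leaf and transport it
    along orbifold paths; triviality of the holonomies makes the result
    independent of the path, and defines a section [s].  Curvature is not needed
    to see that [s] is flat: any two points of a plaque that are close are joined
    by a straight segment, so path independence forces [s] to solve the parallel
    transport equation along every short segment.  Its coefficient [f] in a local
    frame thus has directional derivatives [D_h f = - A_h f], with [A] the
    connection form pulled back to the plaque, and smoothness of [f] follows by
    bootstrapping.

    Parallel transport is made explicit only along short segments, where a
    nowhere vanishing solution is an exponential of an integral; the quotient of
    any parallel section by a nowhere vanishing one is constant, which gives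
    uniqueness along arbitrary piecewise smooth paths. *)

Set Implicit Arguments.
Unset Strict Implicit.
Unset Printing Implicit Defensive.

Import Order.TTheory GRing.Theory Num.Theory.
Import numFieldNormedType.Exports.
Local Open Scope classical_set_scope.
Local Open Scope ring_scope.
Local Open Scope complex_scope.

(** * Functions of class C^k *)

Section Calculus.
Context {R : realType}.

Section General.
Context {E F : normedModType R}.
Implicit Types (U V : set E) (f g : E -> F).

(** Two obstacles shape the proof. [Ck] speaks only of iterated directional derivatives, so
    linearity in the direction, Frechet differentiability and the chain rule have to be extracted
    from continuity of the first derivatives. And [Par] is a choice with default 0: along a given
    path it is linear and invertible only once a nowhere zero parallel section is known there.
    Existence along arbitrary paths is never proved. A flat section, when given, supplies the
    solution itself; in the converse direction the paths used are concatenations of constant paths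
    and short segments, where the solution is explicit. Hence points of the leaf are joined by
    chains of small moves, and each path carries a certificate ([good_path]) that its holonomy is an
    isomorphism of fibres. The constant 2 in bounds such as [|t| <= 2] leaves room around [[-1, 1]],
    so that all derivatives needed there are two-sided. *)

Lemma Ck_continuous k U f x : Ck k U f -> U x -> {for x, continuous f}.
Proof. by case: k => [|k] [H _]; apply: H. Qed.

Lemma CkW k U f : Ck k.+1 U f -> Ck k U f.
Proof.
elim: k f => [|k IH] f [cf df]; split => // v.
by case: (df v) => d1 d2; split => //; apply: IH.
Qed.

Lemma Ck_derivable k U f x v : Ck k.+1 U f -> U x -> derivable f x v.
Proof. by move=> [_ df]; apply: (df v).1. Qed.

Lemma Ck_derive k U f v : Ck k.+1 U f -> Ck k U (fun x => 'D_v f x).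
Proof. by move=> [_ df]; apply: (df v).2. Qed.

(** [Ck] asks for ambient continuity and ambient derivatives at the points of the set, so it is a
    pointwise condition and [V] may be any set. *)
Lemma Ck_local k U f :
  (forall x, U x -> exists2 V, V x & Ck k V f) -> Ck k U f.
Proof.
elim: k f => [|k IH] f H; split => //.
- by move=> x /H[V Vx /Ck_continuous]; exact.
- by move=> x /H[V Vx /Ck_continuous]; exact.
move=> v; split; first by move=> x /H[V Vx /Ck_derivable]; exact.
by apply: IH => x /H[V Vx /Ck_derive]; exists V.
Qed.

Lemma Ck_subset k U V f : V `<=` U -> Ck k U f -> Ck k V f.
Proof. by move=> VU Uf; apply: Ck_local => x /VU Ux; exists U. Qed.

Lemma open_eq_near U f g x : open U -> (forall y, U y -> f y = g y) -> U x ->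
  \forall y \near x, f y = g y.
Proof. by move=> oU fg Ux; apply: filterS fg _; apply: open_nbhs_nbhs. Qed.

Lemma eq_derive_on U f g v x : open U -> (forall y, U y -> f y = g y) -> U x ->
  'D_v f x = 'D_v g x.
Proof. by move=> oU fg Ux; apply: near_eq_derive; apply: open_eq_near Ux. Qed.

Lemma Ck_ext k U f g : open U -> (forall x, U x -> f x = g x) ->
  Ck k U f -> Ck k U g.
Proof.
move=> oU.
have contE f' g' : (forall x, U x -> f' x = g' x) ->
    (forall x, U x -> {for x, continuous f'}) ->
    forall x, U x -> {for x, continuous g'}.
  move=> fg cf x Ux; have h := cf x Ux.
  rewrite /prop_for /continuous_at -fg //; apply: cvg_trans h; apply: near_eq_cvg.
  by near do apply: esym; apply: open_eq_near Ux => // y /fg.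
elim: k f g => [|k IH] f g fg [cf df].
  by split => //; apply: contE cf.
split; first exact: contE cf.
move=> v; case: (df v) => d1 d2; split => [x Ux|].
  by apply: near_eq_derivable (d1 x Ux); apply: open_eq_near Ux.
by apply: IH d2 => x Ux; apply: eq_derive_on Ux.
Unshelve. all: by end_near. Qed.

Lemma Ck_cst k U (c : F) : Ck k U (fun=> c).
Proof.
elim: k c => [|k IH] c; first by split => // x _; exact: cst_continuous.
split => [x _|v]; first exact: cst_continuous.
split=> [x _|]; first exact: derivable_cst.
suff -> : (fun x => 'D_v (fun=> c) x) = (fun=> 0 : F) by [].
by apply/funext => x; rewrite derive_cst.
Qed.

Lemma CkD k U f g : open U -> Ck k U f -> Ck k U g -> Ck k U (fun x => f x + g x).
Proof.
move=> oU; elim: k f g => [|k IH] f g Cf Cg; (split; first by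
  move=> x Ux; apply: continuousD;
    [apply: Ck_continuous Cf Ux|apply: Ck_continuous Cg Ux]) => // v.
split=> [x Ux|].
  by apply: derivableD; [apply: Ck_derivable Cf Ux|apply: Ck_derivable Cg Ux].
apply: Ck_ext (IH _ _ (Ck_derive v Cf) (Ck_derive v Cg)) => // x Ux.
by rewrite -deriveD //; [apply: Ck_derivable Cf Ux|apply: Ck_derivable Cg Ux].
Qed.

Lemma CkN k U f : open U -> Ck k U f -> Ck k U (fun x => - f x).
Proof.
move=> oU; elim: k f => [|k IH] f Cf; (split; first by
  move=> x Ux; apply: continuousN; apply: Ck_continuous Cf Ux) => // v.
split=> [x Ux|]; first by apply: derivableN; apply: Ck_derivable Cf Ux.
apply: Ck_ext (IH _ (Ck_derive v Cf)) => // x Ux.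
by rewrite -deriveN //; apply: Ck_derivable Cf Ux.
Qed.

Lemma Ck_sum k U n (f : 'I_n -> E -> F) : open U -> (forall i, Ck k U (f i)) ->
  Ck k U (fun x => \sum_i f i x).
Proof.
move=> oU; elim: n f => [|n IH] f H.
  by apply: Ck_ext (Ck_cst k U 0) => // x _; rewrite big_ord0.
apply: Ck_ext (CkD oU (IH (fun i => f (widen_ord (leqnSn n) i)) _) (H ord_max)) => //.
by move=> x _; rewrite big_ord_recr.
Qed.

End General.

Section Scalar.
Context {E : normedModType R}.
Implicit Types (U V : set E) (f g : E -> R).

Lemma CkM k U f g : open U -> Ck k U f -> Ck k U g -> Ck k U (fun x => f x * g x).
Proof.
move=> oU; elim: k f g => [|k IH] f g Cf Cg; (split; first by
  move=> x Ux; apply: continuousM;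
    [apply: Ck_continuous Cf Ux|apply: Ck_continuous Cg Ux]) => // v.
split=> [x Ux|].
  by apply: derivableM; [apply: Ck_derivable Cf Ux|apply: Ck_derivable Cg Ux].
apply: Ck_ext (CkD oU (IH _ _ (CkW Cf) (Ck_derive v Cg))
                      (IH _ _ (CkW Cg) (Ck_derive v Cf))) => // x Ux.
by rewrite deriveM //; [apply: Ck_derivable Cf Ux|apply: Ck_derivable Cg Ux].
Qed.

Lemma CkV k U f : open U -> (forall x, U x -> f x != 0) -> Ck k U f ->
  Ck k U (fun x => (f x)^-1).
Proof.
move=> oU f0; elim: k f f0 => [|k IH] f f0 Cf; (split; first by
  move=> x Ux; apply: (@continuousV R E f x);
    [apply: f0|apply: Ck_continuous Cf Ux]) => // v.
split=> [x Ux|].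
  by apply: derivableV; [apply: f0|apply: Ck_derivable Cf Ux].
have C' := IH _ f0 (CkW Cf).
apply: Ck_ext (CkN oU (CkM oU (CkM oU C' C') (Ck_derive v Cf))) => // x Ux.
rewrite deriveV; [|exact: f0|exact: Ck_derivable Cf Ux].
by rewrite scaleNr -expr2 exprVn.
Qed.

Lemma continuous_rV n (f : E -> 'rV[R]_n) x :
  (forall j, {for x, continuous (fun y => f y 0 j)}) -> {for x, continuous f}.
Proof.
move=> H; apply/cvgrPdist_le => /= e e0.
near=> y.
rewrite /Num.Def.normr/= mx_normrE (bigmax_le _ (ltW e0))//= => -[i j] _.
rewrite !mxE/= ord1; move: j; near: y; apply: filter_forall => /= j.
exact: ((cvgrPdist_le _ _).1 (H j)).
Unshelve. all: by end_near. Qed.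

Lemma Ck_rV k U n (f : E -> 'rV[R]_n) : open U ->
  Ck k U f <-> forall j, Ck k U (fun x => f x 0 j).
Proof.
move=> oU; elim: k f => [|k IH] f; split.
- case=> cf _ j; split => // x Ux.
  exact: (continuous_comp (cf x Ux) (@coord_continuous _ _ _ _ _ _)).
- by move=> H; split => // x Ux; apply: continuous_rV => j; apply: (H j).1.
- move=> Cf j; split=> [x Ux|v].
    exact: (continuous_comp (Ck_continuous Cf Ux) (@coord_continuous _ _ _ _ _ _)).
  split=> [x Ux|].
    by have /derivable_mxP := @Ck_derivable _ _ _ _ _ _ v Cf Ux; apply.
  have /IH/(_ j) := Ck_derive v Cf; apply: Ck_ext => // x Ux.
  by rewrite derive_mx ?mxE//; apply: Ck_derivable Cf Ux.
- move=> H; split => [x Ux|v].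
    by apply: continuous_rV => j; apply: Ck_continuous (H j) Ux.
  have df x : U x -> derivable f x v.
    by move=> Ux; apply/derivable_mxP => i j; rewrite ord1; apply: Ck_derivable (H j) Ux.
  split=> //; apply/IH => j; apply: Ck_ext (Ck_derive v (H j)) => // x Ux.
  by rewrite derive_mx ?mxE//; apply: df.
Qed.

End Scalar.

Section Lines.
Context {E F : normedModType R}.

Lemma derivable_line (f : E -> F) (x v : E) (t : R) :
  derivable f (x + t *: v) v <-> derivable (fun s : R => f (x + s *: v)) t 1.
Proof.
rewrite /derivable; set g1 := fun h => h^-1 *: _; set g2 := fun h => h^-1 *: _.
suff -> : g1 = g2 by [].
rewrite funeqE /g1 /g2 => h /=.
by rewrite [_%:A]mulr1 scalerDl [h *: v + _]addrC -addrA [t *: v + _]addrC.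
Qed.

Lemma derive_line (f : E -> F) (x v : E) (t : R) :
  'D_v f (x + t *: v) = 'D_1 (fun s : R => f (x + s *: v)) t.
Proof.
rewrite /derive; set g1 := fun h => h^-1 *: _; set g2 := fun h => h^-1 *: _.
suff -> : g1 = g2 by [].
rewrite funeqE /g1 /g2 => h /=.
by rewrite [_%:A]mulr1 scalerDl [h *: v + _]addrC -addrA [t *: v + _]addrC.
Qed.

(** On a single line derivability is differentiability, so homogeneity in the direction follows from
    linearity of the one-variable differential ['d g 0]. *)
Lemma derive_direction (f : E -> F) (x v : E) (a : R) :
  derivable f x v -> is_derive x (a *: v) f (a *: 'D_v f x).
Proof.
pose g s := f (x + s *: v) => dv.
have dg : differentiable g 0.
  by apply/derivable1_diffP/(iffLR (derivable_line _ _ _ _)); rewrite scale0r addr0.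
have -> : 'D_v f x = 'd g 0 1.
  by rewrite -deriveE // -derive_line scale0r addr0.
rewrite -linearZ /= [_%:A]mulr1 -deriveE //.
have /derivableP[d1 d2] : derivable g 0 a by apply: diff_derivable.
have eqF : (fun h : R => h^-1 *: ((f \o shift x) (h *: (a *: v)) - f x)) =
           (fun h : R => h^-1 *: ((g \o shift 0) (h *: a) - g 0)).
  apply/funext => h /=.
  by rewrite /g scale0r !addr0 scalerA [_ + x]addrC.
by split; rewrite /derivable /derive eqF.
Qed.

End Lines.

Section Differentiability.
Context {E : normedModType R}.
Implicit Types (U : set E) (f : E -> R).

(** The step [h] may be negative, since it will tend to 0 from both sides; the point [c] is
    therefore located only by [|c| <= |h|]. *)
Lemma MVT_line f (x v : E) (h : R) :
  (forall t : R, `|t| <= `|h| -> derivable f (x + t *: v) v) ->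
  exists2 c, `|c| <= `|h| & f (x + h *: v) - f x = 'D_v f (x + c *: v) * h.
Proof.
pose g s := f (x + s *: v) => dv.
have g0 : f x = g 0 by rewrite /g scale0r addr0.
have dg (t : R) : `|t| <= `|h| -> is_derive t (1 : R) g ('D_v f (x + t *: v)).
  by move=> /dv dt; rewrite derive_line; apply/derivableP/(iffLR (derivable_line _ _ _ _)).
have cg (a b : R) : (forall t, t \in `[a, b] -> `|t| <= `|h|) ->
    {within `[a, b], continuous g}.
  move=> ab; apply: derivable_within_continuous => t /ab /dg.
  by case.
rewrite g0 -/(g h).
have [h0|h0] := leP 0 h.
  have lt t : t \in `[0, h] -> `|t| <= `|h|.
    by rewrite in_itv/= => /andP[t0 th]; rewrite !ger0_norm.
  have [|c cI eqc] := @MVT_segment R g (fun t => 'D_v f (x + t *: v)) 0 h h0 _ (cg _ _ lt).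
    by move=> t /subset_itv_oo_cc /lt /dg.
  by exists c; [exact: lt|rewrite eqc subr0].
have lt t : t \in `[h, 0] -> `|t| <= `|h|.
  by rewrite in_itv/= => /andP[th t0]; rewrite !ler0_norm ?lerN2 // ltW.
have [|c cI eqc] := @MVT_segment R g (fun t => 'D_v f (x + t *: v)) h 0 (ltW h0) _ (cg _ _ lt).
  by move=> t /subset_itv_oo_cc /lt /dg.
by exists c; [exact: lt|rewrite -[LHS]opprB eqc sub0r mulrN opprK].
Qed.

(** The increment along [h *: (u + v)] is split at [x + h *: u]; the mean value theorem on each leg
    gives derivatives at nearby points, which continuity brings back to [x]. *)
Lemma C1_deriveD U f x (u v : E) : open U -> Ck 1 U f -> U x ->
  'D_(u + v) f x = 'D_u f x + 'D_v f x.
Proof.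
move=> oU Cf Ux; apply: cvg_lim => //; apply/cvgrPdist_le => e e0.
have cD w : {for x, continuous (fun y => 'D_w f y)}.
  exact: (Ck_continuous (Ck_derive w Cf) Ux).
have e2 : 0 < e / 2 by rewrite divr_gt0.
have [d d0 H] : exists2 d, 0 < d & forall y, ball x d y -> [/\ U y,
    `|'D_u f x - 'D_u f y| <= e / 2 & `|'D_v f x - 'D_v f y| <= e / 2].
  have : \forall y \near x, [/\ U y,
    `|'D_u f x - 'D_u f y| <= e / 2 & `|'D_v f x - 'D_v f y| <= e / 2].
    have N w : \forall y \near x, `|'D_w f x - 'D_w f y| <= e / 2.
      exact: (iffLR (cvgrPdist_le _ _) (cD w) (e / 2) e2).
    have NU : \forall y \near x, U y by apply: open_nbhs_nbhs.
    by apply: filterS3 NU (N u) (N v) => y; split.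
  by move=> /nbhs_ballP[d /= d0 H]; exists d.
(* [|h| * M] bounds every [a *: u + b *: v] with [|a|] and [|b|] at most [|h|]; the added 1 keeps
   [M] positive when [u] and [v] vanish. *)
pose M := `|u| + `|v| + 1.
have M0 : 0 < M by rewrite /M ltr_wpDl // addr_ge0.
have small (a b h : R) : `|a| <= `|h| -> `|b| <= `|h| -> `|h| < d / M ->
    ball x d (x + (a *: u + b *: v)).
  move=> ah bh hd; rewrite -ball_normE /ball_/= opprD addNKr normrN.
  apply: (le_lt_trans (ler_normD _ _)); rewrite !normrZ.
  apply: (@le_lt_trans _ _ (`|h| * M)).
    rewrite /M !mulrDr mulr1 -[leLHS]addr0 !lerD //.
    - by rewrite ler_wpM2r.
    - by rewrite ler_wpM2r.
  by rewrite -ltr_pdivlMr.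
near=> h.
have hd : `|h| < d / M by near: h; apply: dnbhs0_lt; rewrite divr_gt0.
have h0 : h != 0 by near: h; exact: nbhs_dnbhs_neq.
have [c1 c1h E1] : exists2 c, `|c| <= `|h| &
    f (x + h *: u) - f x = 'D_u f (x + c *: u) * h.
  apply: MVT_line => t th.
  apply: (Ck_derivable Cf); have := small t 0 h th _ hd.
  by rewrite scale0r addr0 => /(_ _)/H[]//; rewrite normr0.
have [c2 c2h E2] : exists2 c, `|c| <= `|h| &
    f (x + h *: u + h *: v) - f (x + h *: u) = 'D_v f (x + h *: u + c *: v) * h.
  apply: MVT_line => t th; rewrite -addrA.
  by apply: (Ck_derivable Cf); have := small h t h (lexx _) th hd => /H[].
have -> : (f \o shift x) (h *: (u + v)) - f x =
    ('D_u f (x + c1 *: u) + 'D_v f (x + h *: u + c2 *: v)) * h.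
  rewrite mulrDl -E1 -E2 [RHS]addrC subrKA /=.
  by congr (f _ - _); rewrite scalerDr addrC addrA.
rewrite [_ *: _]mulrC mulfK // opprD addrACA.
apply: (le_trans (ler_normD _ _)); rewrite (splitr e) lerD //.
- have := small c1 0 h c1h _ hd.
  by rewrite scale0r addr0 => /(_ _)/H[]//; rewrite normr0.
- by rewrite -addrA; have /H[] := small h c2 h (lexx _) c2h hd.
Unshelve. all: by end_near. Qed.

End Differentiability.

End Calculus.

(** * From directional derivatives to differentials and the chain rule *)

Section FrechetDerivative.
Context {R : realType}.

Section RowVectors.
Context {m : nat}.
Local Notation E := 'rV[R]_m.
Implicit Types (U : set E) (f : E -> R).

Lemma C1_derive_sum U f x (v : E) : open U -> Ck 1 U f -> U x ->
  'D_v f x = \sum_j v 0 j * 'D_(delta_mx 0 j) f x.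
Proof.
move=> oU Cf Ux; rewrite {1}(row_sum_delta v).
rewrite (@big_morph _ _ (fun w => 'D_w f x) 0 +%R) /=.
- apply: eq_bigr => j _.
  by have /(derive_direction (v 0 j))[_ ->] := Ck_derivable Cf Ux (v := delta_mx 0 j).
- by move=> u w; apply: C1_deriveD oU Cf Ux.
- by rewrite derive0.
Qed.

(** The sum over partial derivatives makes ['D_h f x] linear and continuous in [h]; the mean value
    theorem along [h] turns the remainder into differences of partial derivatives at nearby
    points. *)
Lemma C1_differentiable U f x : open U -> Ck 1 U f -> U x -> differentiable f x.
Proof.
move=> oU Cf Ux.
pose d (h : E) := (h *m (\col_j 'D_(delta_mx 0 j) f x)) 0 0 : R.
have lind : linear d by move=> a u v; rewrite /d mulmxDl -scalemxAl !mxE.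
pose dM := GRing.isLinear.Build _ _ _ _ _ lind.
pose df : {linear E -> R} := HB.pack d dM.
have dE h : df h = 'D_h f x.
  by rewrite (C1_derive_sum _ oU Cf Ux) /= /d mxE; apply: eq_bigr => j _; rewrite !mxE.
have cdf : continuous df.
  suff -> : (df : E -> R) = fun h => \sum_j h 0 j * 'D_(delta_mx 0 j) f x.
    have S : Ck 0 [set: E] (fun h : E => \sum_j h 0 j * 'D_(delta_mx 0 j) f x).
      apply: Ck_sum => [|j]; first exact: openT.
      apply: CkM; [exact: openT| |exact: Ck_cst].
      by split=> // h _; exact: coord_continuous.
    by move=> h; apply: (Ck_continuous S).
  by apply/funext => h; rewrite dE (C1_derive_sum _ oU Cf Ux).
have o : f \o shift x = (cst (f x) + df : E -> R^o) +o_ (0 : E) (@id E).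
  apply/eqaddoP => e e0.
  have cD j : {for x, continuous (fun y => 'D_(delta_mx 0 j) f y)}.
    exact: (Ck_continuous (Ck_derive _ Cf) Ux).
  (* The remainder is a sum of [m] terms, each at most [|h| * e']; dividing by [m + 1] also covers
     [m = 0]. *)
  pose e' := e / (m%:R + 1).
  have e'0 : 0 < e' by rewrite divr_gt0 // ltr_wpDl.
  have : \forall y \near x, U y /\ forall j,
      `|'D_(delta_mx 0 j) f x - 'D_(delta_mx 0 j) f y| <= e'.
    near=> y; split; first by near: y; exact: open_nbhs_nbhs.
    near: y; apply: filter_forall => j.
    by move/cvgrPdist_le: (cD j); exact.
  move=> /nbhs_ballP[r /= r0 H].
  have small : \forall h \near (0 : E), `|h| < r.
    apply/nbhs_ballP; exists r => //= h; rewrite -ball_normE /ball_/=.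
    by rewrite sub0r normrN.
  near=> h.
  have hr (c : R) : `|c| <= 1 -> ball x r (x + c *: h).
    move=> c1; rewrite -ball_normE /ball_/= opprD addNKr normrN normrZ.
    apply: (@le_lt_trans _ _ `|h|); first by rewrite ler_piMl.
    by near: h.
  have [c c1 Ec] : exists2 c : R, `|c| <= `|1 : R| &
      f (x + 1 *: h) - f x = 'D_h f (x + c *: h) * 1.
    apply: MVT_line => t; rewrite normr1 => t1.
    by apply: (Ck_derivable Cf); have /H[] := hr t t1.
  rewrite normr1 in c1; have [Uc Hc] := H _ (hr c c1).
  have -> : (f \o shift x - (cst (f x) + df)) h =
     \sum_j h 0 j * ('D_(delta_mx 0 j) f (x + c *: h) - 'D_(delta_mx 0 j) f x).
    rewrite -![(_ + _ : _ -> _) _]/(_ + _) -![(- _ : _ -> _) _]/(- _).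
    rewrite -![(_ + _ : _ -> _) _]/(_ + _) /=.
    rewrite opprD addrA addrC.
    rewrite (_ : d h = 'D_h f x); last exact: dE.
    have -> : h + x = x + 1 *: h by rewrite scale1r addrC.
    rewrite Ec mulr1 (C1_derive_sum _ oU Cf Uc) (C1_derive_sum _ oU Cf Ux).
    rewrite addrC -sumrB; apply: eq_bigr => j _.
    by rewrite mulrBr.
  apply: (le_trans (ler_norm_sum _ _ _)).
  apply: (@le_trans _ _ (\sum_(j < m) `|h| * e')).
    apply: ler_sum => j _; rewrite normrM ler_pM //.
      by rewrite [leRHS]/Num.Def.normr/= mx_normrE; exact: (le_bigmax _ _ (ord0, j)).
    by rewrite distrC.
  rewrite sumr_const card_ord -mulrnAr mulrC ler_wpM2r //.
  rewrite /e' -mulr_natr -mulrA ler_piMr ?(ltW e0) //.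
  by rewrite mulrC ler_pdivrMr ?ltr_wpDl // mul1r lerDl.
have dfE : 'd f x = df :> (E -> R) by apply: diff_unique.
by apply/diff_locallyP; rewrite dfE.
Unshelve. all: by end_near. Qed.

(** [g] is controlled only along [v], so it is replaced by its restriction [k] to that line, a
    function of one real variable, to which the chain rule for differentials applies. *)
Lemma is_derive_comp (D : normedModType R) (f : E -> R) (g : D -> E) x v :
  derivable g x v -> differentiable f (g x) ->
  is_derive x v (f \o g) ('D_('D_v g x) f (g x)).
Proof.
move=> dg df.
pose k s := g (x + s *: v).
have k0 : k 0 = g x by rewrite /k scale0r addr0.
have dk : differentiable k 0.
  by apply/derivable1_diffP/(iffLR (derivable_line _ _ _ _)); rewrite scale0r addr0.
have dfk : differentiable f (k 0) by rewrite k0.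
have dc : differentiable (f \o k) 0 by apply: differentiable_comp.
have D1 : derivable (f \o g) x v.
  have := @derivable_line R D (R : normedModType R) (f \o g) x v 0.
  rewrite scale0r addr0 => -[_]; apply.
  exact/derivable1_diffP.
have D2 : 'D_v g x = 'd k 0 1 by rewrite -deriveE // -derive_line scale0r addr0.
split => //.
have := @derive_line R D (R : normedModType R) (f \o g) x v 0; rewrite scale0r addr0 => ->.
have -> : (fun s : R => (f \o g) (x + s *: v)) = f \o k by [].
by rewrite deriveE // diff_comp // D2 -k0 [RHS]deriveE.
Qed.

Lemma Ck_comp (D : normedModType R) k U (V : set D) (f : E -> R) (g : D -> E) :
  open U -> open V -> (forall x, V x -> U (g x)) ->
  Ck k U f -> Ck k V g -> Ck k V (fun x => f (g x)).
Proof.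
move=> oU oV VU; elim: k f g VU => [|k IH] f g VU Cf Cg.
  split=> // x Vx.
  exact: (continuous_comp (Ck_continuous Cg Vx) (Ck_continuous Cf (VU x Vx))).
have C1f : Ck 1 U f.
  by split=> [x Ux|v]; [exact: Ck_continuous Cf Ux|
    split=> [x Ux|]; [exact: Ck_derivable Cf Ux|
    split=> // x Ux; exact: Ck_continuous (Ck_derive v Cf) Ux]].
have ch x v : V x -> is_derive x v (f \o g) ('D_('D_v g x) f (g x)).
  move=> Vx; apply: is_derive_comp; first exact: Ck_derivable Cg Vx.
  exact: C1_differentiable oU C1f (VU x Vx).
split=> [x Vx|v].
  exact: (continuous_comp (Ck_continuous Cg Vx) (Ck_continuous Cf (VU x Vx))).
split=> [x Vx|]; first by case: (ch x v Vx).
have CD := (Ck_rV k (fun x => 'D_v g x) oV).1 (Ck_derive v Cg).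
(* The chain rule in coordinates: products of two C^k factors, the second by the induction
   hypothesis applied to the partial derivatives of [f]. *)
have S : Ck k V (fun x => \sum_j 'D_v g x 0 j * 'D_(delta_mx 0 j) f (g x)).
  apply: Ck_sum => // j; apply: CkM => //.
  exact: IH VU (Ck_derive _ Cf) (CkW Cg).
apply: Ck_ext S => // x Vx.
case: (ch x v Vx) => _ ->.
by rewrite (C1_derive_sum _ oU C1f (VU x Vx)).
Qed.

End RowVectors.
End FrechetDerivative.

Section ODE.
Context {R : realType}.

(** Integration starts at -2 and the value at 0 is subtracted afterwards, so that 0 is an interior
    point and the derivative there is two-sided. *)
Lemma antiderivative (g : R -> R) :
  (forall t, `|t| <= 2 -> {for t, continuous g}) ->
  exists2 G : R -> R, G 0 = 0 & forall t : R, `|t| < 2 -> is_derive t (1 : R) G (g t).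
Proof.
move=> cg; pose mu := (@lebesgue_measure R).
pose F y := \int[mu]_(t in [set` `[-2, y]]) (g t).
have ig : mu.-integrable `[-2, 2] (EFin \o g).
  apply: continuous_compact_integrable; first exact: segment_compact.
  apply: continuous_in_subspaceT => t; rewrite inE/= in_itv/= => tI.
  by apply: cg; rewrite ler_norml.
exists (fun y => F y - F 0); first by rewrite subrr.
move=> t; rewrite ltr_norml => /andP[t1 t2].
have [|dF FE] := @continuous_FTC1_closed R g (-2) t 2 t2 ig t1.
  by apply: cg; rewrite ler_norml !ltW.
have dF' : is_derive t (1 : R) F (g t) by split; [exact: dF|rewrite -derive1E; exact: FE].
rewrite -[g t]subr0.
exact: (is_deriveB dF' (is_derive_cst (F 0) t (1 : R))).
Qed.

End ODE.

(** * Complex-valued functions of real variables *)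

Section ComplexParts.
Context {R : realType}.
Implicit Types a b : R[i].

Lemma complex_eq a b :
  complex.Re a = complex.Re b -> complex.Im a = complex.Im b -> a = b.
Proof. by case: a b => [? ?] [? ?] /= -> ->. Qed.

Lemma cReM a b : complex.Re (a * b) =
  complex.Re a * complex.Re b - complex.Im a * complex.Im b.
Proof. by case: a b => [? ?] [? ?]. Qed.

Lemma cImM a b : complex.Im (a * b) =
  complex.Re a * complex.Im b + complex.Im a * complex.Re b.
Proof. by case: a b => [? ?] [? ?]. Qed.

Lemma cReD a b : complex.Re (a + b) = complex.Re a + complex.Re b.
Proof. by case: a b => [? ?] [? ?]. Qed.

Lemma cImD a b : complex.Im (a + b) = complex.Im a + complex.Im b.
Proof. by case: a b => [? ?] [? ?]. Qed.

Lemma cReN a : complex.Re (- a) = - complex.Re a.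
Proof. by case: a. Qed.

Lemma cImN a : complex.Im (- a) = - complex.Im a.
Proof. by case: a. Qed.

Definition sqnormc a := complex.Re a * complex.Re a + complex.Im a * complex.Im a.

Lemma sqnormc_neq0 a : a != 0 -> sqnormc a != 0.
Proof.
case: a => x y; rewrite eq_complex /= negb_and /sqnormc /= -!expr2.
by rewrite paddr_eq0 ?sqr_ge0 // !sqrf_eq0 negb_and.
Qed.

Lemma cReV a : complex.Re a^-1 = complex.Re a * (sqnormc a)^-1.
Proof. by case: a. Qed.

Lemma cImV a : complex.Im a^-1 = - complex.Im a * (sqnormc a)^-1.
Proof. by case: a => ? ?; rewrite mulNr. Qed.

Lemma cRe_sum n (f : 'I_n -> R[i]) :
  complex.Re (\sum_i f i) = \sum_i complex.Re (f i).
Proof. exact: (big_morph _ cReD erefl). Qed.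

Lemma cIm_sum n (f : 'I_n -> R[i]) :
  complex.Im (\sum_i f i) = \sum_i complex.Im (f i).
Proof. exact: (big_morph _ cImD erefl). Qed.

End ComplexParts.

Section RealRules.
Context {R : realType} {E : normedModType R}.
Implicit Types (f g : E -> R) (x v : E) (a b : R).

Lemma is_derive_add f g x v a b : is_derive x v f a -> is_derive x v g b ->
  is_derive x v (fun y => f y + g y) (a + b).
Proof. exact: is_deriveD. Qed.

Lemma is_derive_opp f x v a : is_derive x v f a -> is_derive x v (fun y => - f y) (- a).
Proof. exact: is_deriveN. Qed.

Lemma is_derive_mul f g x v a b : is_derive x v f a -> is_derive x v g b ->
  is_derive x v (fun y => f y * g y) (a * g x + f x * b).
Proof.
move=> df dg; rewrite addrC [a * _]mulrC.
exact: (is_deriveM df dg).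
Qed.

Lemma is_derive_inv f x v a : f x != 0 -> is_derive x v f a ->
  is_derive x v (fun y => (f y)^-1) (- a / (f x * f x)).
Proof.
move=> fx [df da]; split; first exact: derivableV.
by rewrite deriveV // da scaleNr mulNr -expr2 [a / _]mulrC.
Qed.

Lemma is_derive_chain (f : R -> R) g x v a b :
  is_derive x v g b -> is_derive (g x) (1 : R) f a ->
  is_derive x v (fun y => f (g y)) (a * b).
Proof.
move=> [dg <-] [df <-].
pose k s := g (x + s *: v).
have k0 : k 0 = g x by rewrite /k scale0r addr0.
have dk : derivable k 0 (1 : R).
  by apply/(iffLR (derivable_line _ _ _ _)); rewrite scale0r addr0.
have dk' : derivable f (k 0) (1 : R) by rewrite k0.
have dc : differentiable (f \o k) 0.
  exact: (differentiable_comp (iffLR (derivable1_diffP _ _) dk)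
                              (iffLR (derivable1_diffP _ _) dk')).
have D1 : derivable (f \o g) x v.
  have := @derivable_line R E (R : normedModType R) (f \o g) x v 0.
  rewrite scale0r addr0 => -[_]; apply.
  exact/derivable1_diffP.
split => //.
have := @derive_line R E (R : normedModType R) (f \o g) x v 0; rewrite scale0r addr0 => ->.
have -> : (fun s : R => (f \o g) (x + s *: v)) = f \o k by [].
transitivity (derive1 (f \o k) 0); first by rewrite derive1E.
rewrite (derive1_comp dk dk') k0 !derive1E; congr (_ * _).
by rewrite -derive_line scale0r addr0.
Qed.

End RealRules.

Section ComplexDerivative.
Context {R : realType} {E : normedModType R}.
Implicit Types (f g : E -> R[i]) (x v : E) (a b : R[i]).

(** [CD] has a value even where no derivative exists; this predicate couples the value with
    derivability of both parts. *)
Definition is_CD x v f a :=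
  is_derive x v (fun y => complex.Re (f y)) (complex.Re a) /\
  is_derive x v (fun y => complex.Im (f y)) (complex.Im a).

Lemma is_CD_val x v f a : is_CD x v f a -> CD v f x = a.
Proof. by case=> -[_ r] [_ i]; apply: complex_eq. Qed.

Lemma is_CDP x v f : derivable (fun y => complex.Re (f y)) x v ->
  derivable (fun y => complex.Im (f y)) x v -> is_CD x v f (CD v f x).
Proof. by move=> r i; split; apply: derivableP. Qed.

Lemma is_CD_near x v f g a : (\near x, f x = g x) -> is_CD x v f a -> is_CD x v g a.
Proof.
move=> fg [r i]; split.
  by apply: near_eq_is_derive r; apply: filterS fg => y /= ->.
by apply: near_eq_is_derive i; apply: filterS fg => y /= ->.
Qed.

Lemma is_CD_cst x v a : is_CD x v (fun=> a) 0.
Proof. by split; apply: is_derive_cst. Qed.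

Lemma is_CDM x v f g a b : is_CD x v f a -> is_CD x v g b ->
  is_CD x v (fun y => f y * g y) (a * g x + f x * b).
Proof.
move=> [fr fi] [gr gi]; split.
  rewrite (_ : (fun y => _) = fun y => complex.Re (f y) * complex.Re (g y) +
     - (complex.Im (f y) * complex.Im (g y))); last by apply/funext => y; rewrite cReM.
  apply: is_derive_eq (is_derive_add (is_derive_mul fr gr)
    (is_derive_opp (is_derive_mul fi gi))) _.
  by rewrite !(cReD, cReM); ring.
rewrite (_ : (fun y => _) = fun y => complex.Re (f y) * complex.Im (g y) +
     (complex.Im (f y) * complex.Re (g y))); last by apply/funext => y; rewrite cImM.
apply: is_derive_eq (is_derive_add (is_derive_mul fr gi) (is_derive_mul fi gr)) _.
by rewrite !(cImD, cImM); ring.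
Qed.

Lemma is_CDV x v f a : f x != 0 -> is_CD x v f a ->
  is_CD x v (fun y => (f y)^-1) (- a / (f x * f x)).
Proof.
move=> fx [r i]; have n0 := sqnormc_neq0 fx.
have dn := is_derive_add (is_derive_mul r r) (is_derive_mul i i).
have dnV := is_derive_inv (f := fun y => sqnormc (f y)) n0 dn.
have fx2 : f x * f x != 0 by rewrite mulf_neq0.
(* Once this square norm is factored, all denominators are powers of [sqnormc (f x)], so [field]
   needs only [n0]. *)
have nE : sqnormc (f x * f x) = sqnormc (f x) * sqnormc (f x).
  by rewrite /sqnormc cReM cImM; ring.
split.
  rewrite (_ : (fun y => _) = fun y => complex.Re (f y) * (sqnormc (f y))^-1);
    last by apply/funext => y; rewrite cReV.
  apply: is_derive_eq (is_derive_mul r dnV) _.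
  rewrite cReM cReV cImV nE cReN cImN cReM cImM; move: n0; rewrite /sqnormc => n0.
  by field.
rewrite (_ : (fun y => _) = fun y => (- complex.Im (f y)) * (sqnormc (f y))^-1);
  last by apply/funext => y; rewrite cImV.
apply: is_derive_eq (is_derive_mul (is_derive_opp i) dnV) _.
rewrite cImM cReV cImV nE cReN cImN cReM cImM; move: n0; rewrite /sqnormc => n0.
by field.
Qed.

End ComplexDerivative.

Section ComplexSmooth.
Context {R : realType} {E : normedModType R}.
Implicit Types (U V : set E) (f g : E -> R[i]).

Definition CCk k U f :=
  Ck k U (fun x => complex.Re (f x)) /\ Ck k U (fun x => complex.Im (f x)).

Lemma Csmooth_onP U f : Csmooth_on U f <-> forall k, CCk k U f.
Proof.
by split=> [[r i] k|H]; [split|split=> k; have [] := H k].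
Qed.

Lemma CCk_local k U f :
  (forall x, U x -> exists2 V, V x & CCk k V f) -> CCk k U f.
Proof. by move=> H; split; apply: Ck_local => x /H[V Vx []]; exists V. Qed.

Lemma CCk_subset k U V f : V `<=` U -> CCk k U f -> CCk k V f.
Proof. by move=> VU [r i]; split; apply: (Ck_subset VU). Qed.

Lemma CCk_ext k U f g : open U -> (forall x, U x -> f x = g x) ->
  CCk k U f -> CCk k U g.
Proof.
move=> oU fg [r i]; split.
  by apply: Ck_ext r => // x /fg ->.
by apply: Ck_ext i => // x /fg ->.
Qed.

Lemma CCkN k U f : open U -> CCk k U f -> CCk k U (fun x => - f x).
Proof.
move=> oU [fr fi]; split.
  by apply: Ck_ext (CkN oU fr) => // x _; rewrite cReN.
by apply: Ck_ext (CkN oU fi) => // x _; rewrite cImN.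
Qed.

Lemma CCkM k U f g : open U -> CCk k U f -> CCk k U g -> CCk k U (fun x => f x * g x).
Proof.
move=> oU [fr fi] [gr gi]; split.
  by apply: Ck_ext (CkD oU (CkM oU fr gr) (CkN oU (CkM oU fi gi))) => // x _; rewrite cReM.
by apply: Ck_ext (CkD oU (CkM oU fr gi) (CkM oU fi gr)) => // x _; rewrite cImM.
Qed.

Lemma CCkV k U f : open U -> (forall x, U x -> f x != 0) -> CCk k U f ->
  CCk k U (fun x => (f x)^-1).
Proof.
move=> oU f0 [fr fi].
have n : Ck k U (fun x => (sqnormc (f x))^-1).
  apply: (CkV (f := fun x => sqnormc (f x))) => // [x Ux|].
    by apply: sqnormc_neq0; apply: f0.
  by apply: (CkD oU); apply: CkM.
split.
  by apply: Ck_ext (CkM oU fr n) => // x _; rewrite cReV.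
by apply: Ck_ext (CkM oU (CkN oU fi) n) => // x _; rewrite cImV.
Qed.

Lemma CCk_sum k U n (f : 'I_n -> E -> R[i]) : open U -> (forall i, CCk k U (f i)) ->
  CCk k U (fun x => \sum_i f i x).
Proof.
move=> oU H; split.
  apply: Ck_ext (Ck_sum oU (fun i => (H i).1)) => // x _; by rewrite cRe_sum.
apply: Ck_ext (Ck_sum oU (fun i => (H i).2)) => // x _; by rewrite cIm_sum.
Qed.

Lemma CCk_real k U (f : E -> R) : Ck k U f -> CCk k U (fun x => (f x)%:C).
Proof. by move=> Cf; split=> //=; apply: Ck_cst. Qed.

(** One round of the bootstrap: it is applied with [A] the right-hand side of a linear differential
    equation, which contains [f] and is therefore as smooth as [f]. *)
Lemma CCkS k U f (A : E -> E -> R[i]) : open U -> CCk k U f ->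
  (forall x v, U x -> is_CD x v f (A v x)) -> (forall v, CCk k U (A v)) ->
  CCk k.+1 U f.
Proof.
move=> oU Cf fA CA; split; split.
- by move=> x Ux; apply: Ck_continuous Cf.1 Ux.
- move=> v; split=> [x Ux|]; first by have [[]] := fA x v Ux.
  apply: Ck_ext (CA v).1 => // x Ux; symmetry.
  by have [[]] := fA x v Ux.
- by move=> x Ux; apply: Ck_continuous Cf.2 Ux.
- move=> v; split=> [x Ux|]; first by have [_ []] := fA x v Ux.
  apply: Ck_ext (CA v).2 => // x Ux; symmetry.
  by have [_ []] := fA x v Ux.
Qed.

End ComplexSmooth.

Section ComplexComposition.
Context {R : realType} {m : nat}.
Implicit Types (U : set 'rV[R]_m) (f : 'rV[R]_m -> R[i]).

Lemma CCk_comp (D : normedModType R) k U (V : set D) f (g : D -> 'rV[R]_m) :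
  open U -> open V -> (forall x, V x -> U (g x)) ->
  CCk k U f -> Ck k V g -> CCk k V (fun x => f (g x)).
Proof.
move=> oU oV VU [fr fi] Cg; split.
  exact: (Ck_comp oU oV VU fr Cg).
exact: (Ck_comp oU oV VU fi Cg).
Qed.

Lemma is_CD_comp (D : normedModType R) U f (g : D -> 'rV[R]_m) x v :
  open U -> CCk 1 U f -> U (g x) -> derivable g x v ->
  is_CD x v (fun y => f (g y)) (CD ('D_v g x) f (g x)).
Proof.
move=> oU [fr fi] Ux dg; split.
  exact: (is_derive_comp dg (C1_differentiable oU fr Ux)).
exact: (is_derive_comp dg (C1_differentiable oU fi Ux)).
Qed.

Lemma is_derive_comp_rV (D : normedModType R) p U (f : 'rV[R]_m -> 'rV[R]_p)
    (g : D -> 'rV[R]_m) x v :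
  open U -> Ck 1 U f -> U (g x) -> derivable g x v ->
  is_derive x v (fun y => f (g y)) ('D_('D_v g x) f (g x)).
Proof.
move=> oU Cf Ux dg.
have H j := is_derive_comp dg (C1_differentiable oU ((Ck_rV 1 f oU).1 Cf j) Ux).
have d1 : derivable (fun y => f (g y)) x v.
  by apply/derivable_mxP => i j; rewrite ord1; have [] := H j.
split; first exact: d1.
apply/rowP => j; rewrite (derive_mx d1) mxE; have [_ ->] := H j.
have df := @Ck_derivable _ _ _ _ _ _ _ ('D_v g x) Cf Ux.
by rewrite (derive_mx df) mxE.
Qed.

End ComplexComposition.

Section Exponential.
Context {R : realType}.
Implicit Types (p q : R).

Definition cexp p q : R[i] := (expR p * cos q) +i* (expR p * sin q).

Lemma cexp0 : cexp 0 0 = 1.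
Proof. by rewrite /cexp expR0 cos0 sin0 mulr0 mulr1. Qed.

Lemma cexp_neq0 p q : cexp p q != 0.
Proof.
apply/eqP => -[/eqP c0 /eqP s0].
have ep : expR p != 0 by rewrite gt_eqF // expR_gt0.
move: c0 s0; rewrite !mulf_eq0 !(negbTE ep) /= => /eqP c0 /eqP s0.
by have := cos2Dsin2 q; rewrite c0 s0 expr0n addr0 => /eqP; rewrite eq_sym oner_eq0.
Qed.

(** When [P] and [Q] are antiderivatives of the two parts of a coefficient, this exponential solves
    the linear equation with that coefficient. *)
Lemma is_CD_cexp (P Q : R -> R) (t : R) (a : R[i]) :
  is_derive t (1 : R) P (complex.Re a) -> is_derive t (1 : R) Q (complex.Im a) ->
  is_CD t (1 : R) (fun s => cexp (P s) (Q s)) (a * cexp (P t) (Q t)).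
Proof.
move=> dP dQ.
have dE := is_derive_chain dP (is_derive_expR (P t)).
have dC := is_derive_chain dQ (is_derive_cos (Q t)).
have dS := is_derive_chain dQ (is_derive_sin (Q t)).
split=> /=.
  by apply: is_derive_eq (is_derive_mul dE dC) _; rewrite cReM /=; ring.
by apply: is_derive_eq (is_derive_mul dE dS) _; rewrite cImM /=; ring.
Qed.

End Exponential.

(** * Frames and connection forms *)

Section Fibers.
Context {R : realType} {m : nat} {V : set 'rV[R]_m} {E : line_bundle V}.
Implicit Types (x : 'rV[R]_m) (z : R[i]).

(** The two fibres are identified by a proof of [x = x]; proof irrelevance turns it into [erefl],
    and the cast disappears. *)
Lemma pt_inj x (v v' : E x) : pt v = pt v' -> v = v'.
Proof.
move=> h; have := projT2_eq h.
by rewrite /= (Prop_irrelevance (projT1_eq h) erefl).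
Qed.

Lemma ptP (v : total_space E) x : projT1 v = x -> exists u : E x, v = pt u.
Proof. by case: v => y u /= <-; exists u. Qed.

Lemma scale_frame_inj (W : lmodType R[i]) (e : W) z z' : e != 0 -> z *: e = z' *: e -> z = z'.
Proof.
move=> e0 /eqP; rewrite -subr_eq0 -scalerBl scaler_eq0 (negbTE e0) orbF.
by rewrite subr_eq0 => /eqP.
Qed.

Lemma frame_neq0 a x : lb_dom a x -> lb_fr (l := E) a x != 0.
Proof.
move=> ax; apply/eqP => e0; have /bij_inj inj := lb_frP ax.
have /eqP : (1 : R[i]) = 0 by apply: inj; rewrite /= e0 !scaler0.
by rewrite oner_eq0.
Qed.

Lemma fiber_coord x (e y : E x) : V x -> e != 0 -> exists z, y = z *: e.
Proof.
move=> /(lb_cover E)[a ax] e0; have [g _ gK] := lb_frP ax.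
have ge0 : g e != 0.
  by apply: contraNneq e0 => g0; rewrite -(gK e) /= g0 scale0r.
by exists (g y / g e); rewrite -{2}(gK e) /= scalerA mulfVK // gK.
Qed.

(** Total, so that coefficients along curves and plaques are plain functions; it is meaningful only
    over [V] and for [e != 0]. *)
Definition fib_coef x (e y : E x) : R[i] := xget 0 [set z | y = z *: e].

Lemma fib_coefP x (e y : E x) : V x -> e != 0 -> y = fib_coef e y *: e.
Proof.
move=> Vx e0; have [z yz] := fiber_coord y Vx e0.
exact: (@xgetI _ 0 [set z | y = z *: e] z yz).
Qed.

Lemma fib_coefE x (e : E x) z : V x -> e != 0 -> fib_coef e (z *: e) = z.
Proof. by move=> Vx e0; apply: (scale_frame_inj e0); rewrite -fib_coefP. Qed.

Lemma frame_local a : local_frame (lb_dom a) (lb_fr (l := E) a).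
Proof.
split; [exact: lb_dom_open|exact: lb_dom_sub| |by move=> x; exact: frame_neq0].
move=> b f H; rewrite setIC; apply: lb_trans => x bx ax; exact: H.
Qed.

Lemma ex_local_frame x : V x -> exists U (e : forall y, E y), local_frame U e /\ U x.
Proof.
move=> /(lb_cover E)[a ax]; exists (lb_dom a), (lb_fr a); split=> //.
exact: frame_local.
Qed.

Lemma smooth_coef U (s : forall x, E x) a k : open U -> U `<=` V -> smooth_section U s ->
  CCk k (U `&` lb_dom a) (fun x => fib_coef (lb_fr (l := E) a x) (s x)).
Proof.
move=> oU UV sm; apply: (iffLR (Csmooth_onP _ _)) k; apply: sm => x Ux ax.
by apply: fib_coefP; [exact: UV|exact: frame_neq0].
Qed.

(** Smoothness of sections is tested only against the trivializations [lb_fr]. In one of these, [f]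
    is the quotient of the coefficients of [s] and [e], and the latter does not vanish. *)
Lemma smooth_ratio U (e s : forall x, E x) (f : 'rV[R]_m -> R[i]) k :
  local_frame U e -> smooth_section U s -> (forall x, U x -> s x = f x *: e x) ->
  CCk k U f.
Proof.
move=> [oU UV se e0] ss sf; apply: CCk_local => x Ux.
have [a ax] := lb_cover E (UV x Ux).
have oUa : open (U `&` lb_dom (l := E) a) by apply: openI => //; exact: lb_dom_open.
exists (U `&` lb_dom (l := E) a) => //.
have Ce := smooth_coef a k oU UV se; have Cs := smooth_coef a k oU UV ss.
have c0 y : (U `&` lb_dom (l := E) a) y -> fib_coef (lb_fr a y) (e y) != 0.
  case=> Uy ay; have ec := fib_coefP (e y) (UV y Uy) (frame_neq0 ay).
  by apply: contraNneq (e0 y Uy) => c0; rewrite ec c0 scale0r.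
apply: CCk_ext (CCkM oUa Cs (CCkV oUa c0 Ce)) => // y Uay.
have [Uy ay] := Uay; have Vy := UV y Uy; have fr0 := frame_neq0 ay.
apply: (canLR (mulfK (c0 y Uay))); apply: (scale_frame_inj fr0).
by rewrite -scalerA -!fib_coefP // sf.
Qed.

(** Restriction is not immediate, because the definition quantifies over coefficients on the set at
    hand: one given on [U'] has to be compared with [fib_coef], which is smooth over [U]. *)
Lemma smooth_section_sub U U' (s : forall x, E x) : open U -> open U' -> U `<=` V ->
  U' `<=` U -> smooth_section U s -> smooth_section U' s.
Proof.
move=> oU oU' UV U'U ss a f sf; apply/Csmooth_onP => k.
have oU'a : open (U' `&` lb_dom (l := E) a) by apply: openI => //; exact: lb_dom_open.
have C : CCk k (U' `&` lb_dom (l := E) a) (fun x => fib_coef (lb_fr (l := E) a x) (s x)).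
  by apply: CCk_subset (smooth_coef a k oU UV ss) => x [/U'U].
apply: CCk_ext C => // x [U'x ax].
by rewrite sf // fib_coefE //; [apply/UV/U'U|exact: frame_neq0].
Qed.

End Fibers.

Section Connection.
Context {R : realType} {m : nat} {V : set 'rV[R]_m} {E : line_bundle V}.
Variable H : herm_conn E.
Implicit Types (x u : 'rV[R]_m) (z : R[i]).

(** The connection 1-form of the frame [e], evaluated on [u] at [x]. *)
Definition conn_form (e : forall x, E x) u x : R[i] := fib_coef (e x) (nab H u e x).

Lemma conn_formP U e u x : local_frame U e -> U x ->
  nab H u e x = conn_form e u x *: e x.
Proof. by move=> [_ UV _ e0] Ux; apply: fib_coefP; [exact: UV|exact: e0]. Qed.

Lemma conn_form_smooth U e u k : local_frame U e -> CCk k U (conn_form e u).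
Proof.
move=> fe; have [oU UV se e0] := fe.
have ss : smooth_section U (nab H u e) by apply: (nab_smooth (h := H)) UV se.
have eq x : U x -> nab H u e x = conn_form e u x *: e x by move=> Ux; apply: conn_formP fe Ux.
exact: (smooth_ratio k fe ss eq).
Qed.

Lemma conn_form0 U e x : local_frame U e -> U x -> conn_form e 0 x = 0.
Proof.
move=> [oU UV se e0] Ux.
have := nab_dir H 1 0 0 oU UV se Ux; rewrite scaler0 addr0 scale1r => /eqP.
rewrite -subr_eq0 opprD addrA subrr sub0r oppr_eq0 => /eqP n0.
by rewrite /conn_form n0 -(scale0r (e x)) fib_coefE //; [exact: UV|exact: e0].
Qed.

Lemma conn_form_linear U e (a : R) u v x : local_frame U e -> U x ->
  conn_form e (a *: u + v) x = a%:C * conn_form e u x + conn_form e v x.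
Proof.
move=> fe Ux; have [oU UV se e0] := fe; apply: (scale_frame_inj (e0 x Ux)).
rewrite -(conn_formP _ fe Ux) (nab_dir H a u v oU UV se Ux) !(conn_formP _ fe Ux).
by rewrite scalerDl scalerA.
Qed.

Lemma conn_form_sum U e u x : local_frame U e -> U x ->
  conn_form e u x = \sum_j (u 0 j)%:C * conn_form e (delta_mx 0 j) x.
Proof.
move=> fe Ux; rewrite {1}(row_sum_delta u).
elim/big_rec2 : _ => [|j y v _ <-]; first exact: conn_form0 Ux.
exact: conn_form_linear fe Ux.
Qed.

(** The gauge transformation law, from the Leibniz rule for [e = h *: e'], written without an
    inverse of [h]. *)
Lemma frame_change U e U' e' (h : 'rV[R]_m -> R[i]) u x :
  local_frame U e -> local_frame U' e' ->
  (forall y, (U `&` U') y -> e y = h y *: e' y) -> (U `&` U') x ->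
  CD u h x + h x * conn_form e' u x = conn_form e u x * h x.
Proof.
move=> fe fe' eh Ux; have [oU UV se e0] := fe; have [oU' U'V se' e0'] := fe'.
have oI : open (U `&` U') by apply: openI.
have IV : U `&` U' `<=` V by move=> y [/UV].
have sI : smooth_section (U `&` U') e by apply: (smooth_section_sub oU) => // y [].
have sI' : smooth_section (U `&` U') e' by apply: (smooth_section_sub oU') => // y [].
have fI' : local_frame (U `&` U') e' by split=> // y [_ /e0'].
have Ch : Csmooth_on (U `&` U') h.
  by apply/Csmooth_onP => k; apply: smooth_ratio fI' sI eh.
have L := nab_local H u oI IV sI eh Ux.
rewrite (nab_leibniz H u oI IV Ch sI' Ux) (conn_formP _ fe Ux.1)
  (conn_formP _ fe' Ux.2) (eh x Ux) !scalerA -scalerDl in L.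
by rewrite (scale_frame_inj (e0' x Ux.2) L).
Qed.

End Connection.

(** * Uniqueness of parallel transport *)

Section OffFinite.
Context {R : realType}.

Lemma cvg_within_sub (T : topologicalType) (f : R -> T) (A B : set R) (t : R) (l : T) :
  A `<=` B -> f r @[r --> within B (nbhs t)] --> l ->
  f r @[r --> within A (nbhs t)] --> l.
Proof. by move=> AB; apply: cvg_trans; apply: cvg_app; apply: within_subset. Qed.

Definition ccvg (T : Type) (F : set_system T) (f : T -> R[i]) (a : R[i]) :=
  complex.Re (f r) @[r --> F] --> complex.Re a /\
  complex.Im (f r) @[r --> F] --> complex.Im a.

Lemma ccvg_near (T : Type) (F : set_system T) (f g : T -> R[i]) a : Filter F ->
  (\forall r \near F, f r = g r) -> ccvg F f a -> ccvg F g a.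
Proof.
move=> FF fg [r i]; split.
  by apply: cvg_trans r; apply: near_eq_cvg; apply: filterS fg => r ->.
by apply: cvg_trans i; apply: near_eq_cvg; apply: filterS fg => r' ->.
Qed.

Lemma ccvg_cst (T : Type) (F : set_system T) a : Filter F -> ccvg F (fun=> a) a.
Proof. by move=> FF; split; apply: cvg_cst. Qed.

Lemma ccvgM (T : Type) (F : set_system T) (f g : T -> R[i]) a b : Filter F ->
  ccvg F f a -> ccvg F g b -> ccvg F (fun r => f r * g r) (a * b).
Proof.
move=> FF [fr fi] [gr gi]; split.
  rewrite cReM; under eq_fun do rewrite cReM.
  by apply: cvgB; apply: cvgM.
rewrite cImM; under eq_fun do rewrite cImM.
by apply: cvgD; apply: cvgM.
Qed.

Lemma ccvgV (T : Type) (F : set_system T) (f : T -> R[i]) a : Filter F -> a != 0 ->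
  ccvg F f a -> ccvg F (fun r => (f r)^-1) a^-1.
Proof.
move=> FF a0 [fr fi].
have nV : (sqnormc (f r))^-1 @[r --> F] --> (sqnormc a)^-1.
  by apply: cvgV; [exact: sqnormc_neq0|apply: cvgD; apply: cvgM].
split.
  by rewrite cReV; under eq_fun do rewrite cReV; apply: cvgM.
by rewrite cImV; under eq_fun do rewrite cImV; apply: cvgM => //; apply: cvgN.
Qed.

(** Induction on the list of exceptional points: one inside the interval splits it in two, one
    outside is dropped. Continuity up to the end points makes the values match at the split. *)
Lemma cst_off_finite (s : seq R) (f : R -> R) (a b : R) : a <= b ->
  (forall t : R, a <= t <= b -> f r @[r --> within `[a, b] (nbhs t)] --> f t) ->
  (forall t : R, a < t < b -> t \notin s -> is_derive t (1 : R) f 0) ->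
  f b = f a.
Proof.
elim: s a b => [|c s IH] a b ab cf df.
  have d0 x : x \in `]a, b[ -> is_derive x (1 : R) f 0.
    by rewrite in_itv/= => xab; apply: df.
  have cab : {within `[a, b], continuous f}.
    by apply/subspace_continuousP => x /=; rewrite in_itv/= => xab; exact: cf.
  have [c _] := MVT_segment ab d0 cab.
  by rewrite mul0r => /eqP; rewrite subr_eq0 => /eqP.
have [/andP[ac cb]|ncab] := boolP (a < c < b); last first.
  apply: IH => // t tab ts; apply: df => //; rewrite inE negb_or ts andbT.
  by apply: contraNneq ncab => <-.
have sub1 : `[a, c] `<=` `[a, b].
  by apply: subset_itvl; rewrite bnd_simp ltW.
have sub2 : `[c, b] `<=` `[a, b].
  by apply: subset_itvr; rewrite bnd_simp ltW.
transitivity (f c); last first.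
  apply: IH; first exact: ltW.
    move=> t /andP[at_ tc]; apply: cvg_within_sub sub1 _; apply: cf.
    by rewrite at_ (le_trans tc (ltW cb)).
  move=> t /andP[at_ tc] ts; apply: df; first by rewrite at_ (lt_trans tc cb).
  by rewrite inE negb_or ts andbT lt_eqF.
apply: IH; first exact: ltW.
  move=> t /andP[ct tb]; apply: cvg_within_sub sub2 _; apply: cf.
  by rewrite tb (le_trans (ltW ac) ct).
move=> t /andP[ct tb] ts; apply: df; first by rewrite tb (lt_trans ac ct).
by rewrite inE negb_or ts andbT gt_eqF.
Qed.

End OffFinite.

Section Transport.
Context {R : realType} {m : nat} {V : set 'rV[R]_m} {E : line_bundle V}.
Variable H : herm_conn E.
Variable gamma : R -> 'rV[R]_m.
Hypothesis gV : forall t : R, 0 <= t <= 1 -> V (gamma t).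
Hypothesis gC : forall t : R, 0 <= t <= 1 ->
  gamma r @[r --> within `[0, 1] (nbhs t)] --> gamma t.
Implicit Types (sigma : forall t, E (gamma t)) (z : R[i]).

Lemma near_within_curve (U : set 'rV[R]_m) (t : R) : open U -> 0 <= t <= 1 -> U (gamma t) ->
  \forall r \near within `[0, 1] (nbhs t), 0 <= r <= 1 /\ U (gamma r).
Proof.
move=> oU tI Ut.
have : \forall r \near within `[0, 1] (nbhs t), U (gamma r).
  by apply: (gC tI); apply: open_nbhs_nbhs.
rewrite !near_withinE; apply: filterS => r h rI; split; last exact: h.
by move: rI; rewrite /= in_itv.
Qed.

Lemma near_curve (U : set 'rV[R]_m) (t : R) : open U -> 0 < t < 1 -> U (gamma t) ->
  \forall r \near t, 0 <= r <= 1 /\ U (gamma r).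
Proof.
move=> oU /andP[t0 t1] Ut.
have tI : 0 <= t <= 1 by rewrite !ltW.
have := near_within_curve oU tI Ut; rewrite near_withinE => N.
have N' : \forall r \near t, `]0, 1[%classic r.
  by apply: open_nbhs_nbhs; split; [exact: interval_open|rewrite /= in_itv/= t0 t1].
apply: filterS2 N N' => r h r01; apply: h.
exact: subset_itv_oo_cc r01.
Qed.

Section Coefficients.
Variables (U : set 'rV[R]_m) (e : forall x, E x) (sigma : forall t, E (gamma t)).
Hypothesis fe : local_frame U e.

Definition curve_coef (t : R) : R[i] := fib_coef (e (gamma t)) (sigma t).

Lemma curve_coefP (t : R) : 0 <= t <= 1 -> U (gamma t) ->
  sigma t = curve_coef t *: e (gamma t).
Proof.
by move=> tI Ut; have [_ _ _ e0] := fe; apply: fib_coefP; [exact: gV|exact: e0].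
Qed.

End Coefficients.

(** For the canonical coefficient the vector equation becomes the scalar one f' = -A f, with A the
    connection form on the velocity of the curve. *)
Lemma parallel_coef sigma : parallel_along H sigma -> exists2 B : set R, finite_set B &
  forall U e, local_frame U e ->
    let f := curve_coef e sigma in
    (forall t : R, 0 <= t <= 1 -> U (gamma t) ->
       ccvg (within `[0, 1] (nbhs t)) f (f t)) /\
    (forall t : R, 0 < t < 1 -> ~ B t -> U (gamma t) ->
       derivable gamma t (1 : R) /\
       is_CD t (1 : R) f (- (conn_form H e ('D_(1 : R) gamma t) (gamma t) * f t))).
Proof.
move=> [B fB K]; exists B => // U e fe f; have [oU UV se e0] := fe.
have [c d] := K U e f fe (curve_coefP sigma fe).
split=> // t tI Bt Ut; have [dg dr di ode] := d t tI Bt Ut.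
split; first exact: dg.
suff <- : CD (1 : R) f t = - (conn_form H e ('D_(1 : R) gamma t) (gamma t) * f t).
  exact: (is_CDP dr di).
move: ode; rewrite (conn_formP H _ fe Ut) scalerA -scalerDl -(scale0r (e (gamma t))).
by move=> /(scale_frame_inj (e0 _ Ut)) /eqP; rewrite addr_eq0 mulrC => /eqP.
Qed.

(** [parallel_along] admits every [f] that represents [sigma] over [U]. Such an [f] agrees with the
    canonical coefficient near each relevant time, so limits and derivatives transfer. *)
Lemma parallel_intro sigma (B : set R) : finite_set B ->
  (forall U e, local_frame U e ->
    let f := curve_coef e sigma in
    (forall t : R, 0 <= t <= 1 -> U (gamma t) ->
       ccvg (within `[0, 1] (nbhs t)) f (f t)) /\
    (forall t : R, 0 < t < 1 -> ~ B t -> U (gamma t) ->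
       derivable gamma t (1 : R) /\
       is_CD t (1 : R) f (- (conn_form H e ('D_(1 : R) gamma t) (gamma t) * f t)))) ->
  parallel_along H sigma.
Proof.
move=> fB K; exists B => // U e f fe ef; have [oU UV se e0] := fe.
have [c d] := K U e fe.
have eqf (t : R) : 0 <= t <= 1 -> U (gamma t) -> curve_coef e sigma t = f t.
  by move=> tI Ut; rewrite /curve_coef ef // fib_coefE //; [exact: gV|exact: e0].
split=> [t tI Ut|t tI Bt Ut].
  have N := near_within_curve oU tI Ut.
  have cf := c t tI Ut; rewrite (eqf t tI Ut) in cf.
  apply: ccvg_near cf.
  by apply: filterS N => r [rI Ur]; rewrite eqf.
have N := near_curve oU tI Ut.
have [dg D] := d t tI Bt Ut.
have tI' : 0 <= t <= 1 by case/andP: tI => *; rewrite !ltW.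
have D' : is_CD t (1 : R) f (- (conn_form H e ('D_(1 : R) gamma t) (gamma t) * f t)).
  rewrite -(eqf t tI' Ut); apply: is_CD_near D.
  by apply: filterS N => r [rI Ur]; rewrite eqf.
have [[dr _] [di _]] := D'.
split; [exact: dg|exact: dr|exact: di|].
rewrite (is_CD_val D') (conn_formP H _ fe Ut) scalerA -scalerDl.
by rewrite [f t * _]mulrC addNr scale0r.
Qed.

Lemma parallel_scale sigma z : parallel_along H sigma ->
  parallel_along H (fun t => z *: sigma t).
Proof.
move=> /parallel_coef[B fB K]; apply: (parallel_intro fB) => U e fe f.
have [oU UV se e0] := fe; have [c d] := K U e fe.
set f0 := curve_coef e sigma in c d *.
have eqf (t : R) : 0 <= t <= 1 -> U (gamma t) -> z * f0 t = f t.
  move=> tI Ut; rewrite /f /curve_coef [X in z *: X](curve_coefP sigma fe tI Ut).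
  by rewrite scalerA fib_coefE //; [exact: gV|exact: e0].
split=> [t tI Ut|t tI Bt Ut].
  have N := near_within_curve oU tI Ut.
  rewrite -eqf //; apply: ccvg_near (ccvgM _ (ccvg_cst z _) (c t tI Ut)).
  by apply: filterS N => r [rI Ur]; rewrite eqf.
have N := near_curve oU tI Ut.
have [dg D] := d t tI Bt Ut; split=> //.
have tI' : 0 <= t <= 1 by case/andP: tI => *; rewrite !ltW.
have := is_CDM (is_CD_cst t (1 : R) z) D; rewrite mul0r add0r mulrN mulrCA eqf //.
by apply: is_CD_near; apply: filterS N => r [rI Ur]; rewrite eqf.
Qed.

Lemma parallel_unique sigma1 sigma2 z :
  (forall t : R, 0 <= t <= 1 -> sigma1 t != 0) ->
  parallel_along H sigma1 -> parallel_along H sigma2 ->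
  sigma2 0 = z *: sigma1 0 -> sigma2 1 = z *: sigma1 1.
Proof.
move=> s0 /parallel_coef[B1 fB1 K1] /parallel_coef[B2 fB2 K2] E0.
(* Each equation is known only off the break points of its own section, so both sets are
   excluded. *)
have /finite_seqP[s sE] : finite_set (B1 `|` B2) by rewrite finite_setU.
pose g t := fib_coef (sigma1 t) (sigma2 t).
have gE (t : R) : 0 <= t <= 1 -> sigma2 t = g t *: sigma1 t.
  by move=> tI; apply: fib_coefP; [exact: gV|exact: s0].
have I0 : 0 <= (0 : R) <= 1 by rewrite lexx ler01.
have I1 : 0 <= (1 : R) <= 1 by rewrite lexx ler01.
have loc (t : R) : 0 <= t <= 1 -> exists U (e : forall x, E x), local_frame U e /\ U (gamma t).
  by move=> tI; have [U [e ?]] := ex_local_frame (E := E) (gV tI); exists U, e.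
have gf U (e : forall x, E x) (t : R) : local_frame U e -> 0 <= t <= 1 -> U (gamma t) ->
    curve_coef e sigma1 t != 0 /\
    curve_coef e sigma2 t * (curve_coef e sigma1 t)^-1 = g t.
  move=> fe tI Ut; have [oU UV se e0] := fe.
  have f0 : curve_coef e sigma1 t != 0.
    by have := s0 t tI; apply: contraNneq => c0; rewrite (curve_coefP sigma1 fe tI Ut) c0 scale0r.
  split=> //; apply: (canLR (mulfK f0)); apply: (scale_frame_inj (e0 _ Ut)).
  by rewrite -scalerA -!(curve_coefP _ fe tI Ut) gE.
have cg (t : R) : 0 <= t <= 1 -> ccvg (within `[0, 1] (nbhs t)) g (g t).
  move=> tI; have [U [e [fe Ut]]] := loc t tI; have [oU _ _ _] := fe.
  have N := near_within_curve oU tI Ut.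
  have [c1 _] := K1 U e fe; have [c2 _] := K2 U e fe.
  have [f10 gt] := gf U e t fe tI Ut; rewrite -gt.
  apply: ccvg_near (ccvgM _ (c2 t tI Ut) (ccvgV _ f10 (c1 t tI Ut))).
  by apply: filterS N => r [rI Ur]; have [_ <-] := gf U e r fe rI Ur.
have dg (t : R) : 0 < t < 1 -> t \notin s -> is_CD t (1 : R) g 0.
  move=> tI ts.
  have [nB1 nB2] : ~ B1 t /\ ~ B2 t.
    have nB : ~ (B1 `|` B2) t by rewrite sE /=; apply/negP.
    by split=> Bt; apply: nB; [left|right].
  have tI' : 0 <= t <= 1 by case/andP: tI => *; rewrite !ltW.
  have [U [e [fe Ut]]] := loc t tI'; have [oU _ _ _] := fe.
  have N := near_curve oU tI Ut.
  have [_ d1] := K1 U e fe; have [_ d2] := K2 U e fe.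
  have [_ D1] := d1 t tI nB1 Ut; have [_ D2] := d2 t tI nB2 Ut.
  have [f10 _] := gf U e t fe tI' Ut.
  have D := is_CDM D2 (is_CDV f10 D1).
  have D0 : is_CD t (1 : R)
      (fun r => curve_coef e sigma2 r * (curve_coef e sigma1 r)^-1) 0.
    (* The two terms of the quotient rule, [-A f2 / f1] and [f2 A f1 / f1 ^ 2], cancel. *)
    by move: D; congr (is_CD _ _ _ _); field.
  apply: is_CD_near D0.
  by apply: filterS N => r [rI Ur]; have [_] := gf U e r fe rI Ur.
have g1 : g 1 = g 0.
  apply: complex_eq.
    apply: (@cst_off_finite R s (fun t => complex.Re (g t)) 0 1 ler01) => t tI.
      by have [] := cg t tI.
    by move=> ts; have [] := dg t tI ts.
  apply: (@cst_off_finite R s (fun t => complex.Im (g t)) 0 1 ler01) => t tI.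
    by have [] := cg t tI.
  by move=> ts; have [] := dg t tI ts.
rewrite gE // g1; congr (_ *: _).
by apply: (scale_frame_inj (s0 0 I0)); rewrite -gE.
Qed.

(** [Par] chooses among the end values of parallel sections with the given start. [sigma2] shows
    that there is one; comparison with the nowhere zero [sigma1] shows that there is only one. *)
Lemma Par_parallel sigma1 sigma2 : (forall t : R, 0 <= t <= 1 -> sigma1 t != 0) ->
  parallel_along H sigma1 -> parallel_along H sigma2 ->
  Par H gamma (pt (sigma2 0)) = pt (sigma2 1).
Proof.
move=> s0 p1 p2; rewrite /Par; set S := [set y | _].
have I0 : 0 <= (0 : R) <= 1 by rewrite lexx ler01.
have S2 : S (sigma2 1) by exists sigma2.
have [sigma [p /pt_inj E0 <-]] : S (xget 0 S) by apply: xgetI S2.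
congr (pt _); set z := fib_coef (sigma1 0) (sigma2 0).
have zE : sigma2 0 = z *: sigma1 0 by apply: fib_coefP; [exact: gV|exact: s0].
by rewrite (parallel_unique s0 p1 p2 zE); apply: parallel_unique p1 p _ => //; rewrite E0.
Qed.

End Transport.

(** * Parallel transport along short segments *)

Section FrameParallel.
Context {R : realType} {m : nat} {V : set 'rV[R]_m} {E : line_bundle V}.
Variable H : herm_conn E.

Lemma ccvg_within (F : set_system R) (A : set R) (f : R -> R[i]) a : Filter F ->
  ccvg F f a -> ccvg (within A F) f a.
Proof.
move=> FF [r i]; split.
  by apply: cvg_trans r; apply: cvg_app; apply: cvg_within.
by apply: cvg_trans i; apply: cvg_app; apply: cvg_within.
Qed.

Lemma is_CD_ccvg (f : R -> R[i]) (t : R) a : is_CD t (1 : R) f a -> ccvg (nbhs t) f (f t).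
Proof.
move=> [[r _] [i _]]; split.
  exact: (differentiable_continuous (iffLR (derivable1_diffP _ _) r)).
exact: (differentiable_continuous (iffLR (derivable1_diffP _ _) i)).
Qed.

(** The equation is given in one frame, whereas [parallel_along] quantifies over all. In a frame
    [e'] with [e = h *: e'] the coefficient is [F * h], and [frame_change] absorbs the derivative of
    [h] into the new connection form. *)
Lemma frame_parallel (gamma : R -> 'rV[R]_m) U (e : forall x, E x) (F : R -> R[i]) :
  local_frame U e ->
  (forall t : R, 0 <= t <= 1 -> [/\ U (gamma t), derivable gamma t (1 : R) &
     is_CD t (1 : R) F (- (conn_form H e ('D_(1 : R) gamma t) (gamma t) * F t))]) ->
  parallel_along H (fun t => F t *: e (gamma t)).
Proof.
move=> fe K; have [oU UV se e0] := fe.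
have gV (t : R) : 0 <= t <= 1 -> V (gamma t) by move=> /K[/UV].
have gC (t : R) : 0 <= t <= 1 ->
    gamma r @[r --> within `[0, 1] (nbhs t)] --> gamma t.
  move=> /K[_ d _]; apply: cvg_trans; first by apply: cvg_app; apply: cvg_within.
  exact: (differentiable_continuous (iffLR (derivable1_diffP _ _) d)).
apply: (parallel_intro gV gC (finite_set0 _)) => U' e' fe' f.
have [oU' UV' se' e0'] := fe'.
pose h y := fib_coef (e' y) (e y).
have hE y : (U `&` U') y -> e y = h y *: e' y.
  by move=> [Uy Uy']; apply: fib_coefP; [exact: UV|exact: e0'].
have oI : open (U `&` U') by apply: openI.
have Ch : CCk 1 (U `&` U') h.
  have sI : smooth_section (U `&` U') e by apply: (smooth_section_sub oU) => // y [].
  have fI : local_frame (U `&` U') e'.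
    split=> //; [by move=> y [/UV]| |by move=> y [_ /e0']].
    by apply: (smooth_section_sub oU') => // y [].
  exact: (smooth_ratio 1 fI sI hE).
have feq (t : R) : 0 <= t <= 1 -> U' (gamma t) -> F t * h (gamma t) = f t.
  move=> tI U't; have [Ut _ _] := K t tI.
  by rewrite /f /curve_coef hE // scalerA fib_coefE //; [exact: UV|exact: e0'].
have D (t : R) : 0 <= t <= 1 -> U' (gamma t) -> is_CD t (1 : R) (fun r => F r * h (gamma r))
    (- (conn_form H e' ('D_(1 : R) gamma t) (gamma t) * f t)).
  move=> tI U't; have [Ut dg DF] := K t tI.
  have := is_CDM DF (is_CD_comp oI Ch (conj Ut U't) dg).
  have fc := frame_change H ('D_(1 : R) gamma t) fe fe' hE (conj Ut U't).
  congr is_CD; rewrite -feq //.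
  have -> : CD ('D_(1 : R) gamma t) h (gamma t) = conn_form H e ('D_(1 : R) gamma t) (gamma t)
      * h (gamma t) - h (gamma t) * conn_form H e' ('D_(1 : R) gamma t) (gamma t).
    by rewrite -fc addrK.
  by ring.
split=> [t tI U't|t tI _ U't].
  have N := near_within_curve gC oU' tI U't.
  rewrite -feq //.
  have C := ccvg_within `[0, 1] (nbhs_filter t) (is_CD_ccvg (D t tI U't)).
  apply: ccvg_near C.
  by apply: filterS N => r [rI Ur]; rewrite feq.
have tI' : 0 <= t <= 1 by case/andP: tI => *; rewrite !ltW.
have N := near_curve gC oU' tI U't.
have [_ dg _] := K t tI'; split=> //.
apply: is_CD_near (D t tI' U't).
by apply: filterS N => r [rI Ur]; rewrite feq.
Qed.

Lemma frame_Par_parallel (gamma : R -> 'rV[R]_m) U (e : forall x, E x) (F : R -> R[i])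
    (sigma : forall t, E (gamma t)) :
  local_frame U e ->
  (forall t : R, 0 <= t <= 1 -> [/\ U (gamma t), derivable gamma t (1 : R), F t != 0 &
     is_CD t (1 : R) F (- (conn_form H e ('D_(1 : R) gamma t) (gamma t) * F t))]) ->
  parallel_along H sigma -> Par H gamma (pt (sigma 0)) = pt (sigma 1).
Proof.
move=> fe K p2; have [oU UV se e0] := fe.
have gV (t : R) : 0 <= t <= 1 -> V (gamma t) by move=> /K[/UV].
have gC (t : R) : 0 <= t <= 1 ->
    gamma r @[r --> within `[0, 1] (nbhs t)] --> gamma t.
  move=> /K[_ d _ _]; apply: cvg_trans; first by apply: cvg_app; apply: cvg_within.
  exact: (differentiable_continuous (iffLR (derivable1_diffP _ _) d)).
have par : parallel_along H (fun t => F t *: e (gamma t)).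
  by apply: (@frame_parallel gamma U e F fe) => t tI; have [] := K t tI.
apply: (Par_parallel gV gC _ par p2) => t tI.
by have [Ut _ F0 _] := K t tI; rewrite scaler_eq0 negb_or F0 e0.
Qed.

Lemma frame_Par (gamma : R -> 'rV[R]_m) U (e : forall x, E x) (F : R -> R[i]) z :
  local_frame U e ->
  (forall t : R, 0 <= t <= 1 -> [/\ U (gamma t), derivable gamma t (1 : R), F t != 0 &
     is_CD t (1 : R) F (- (conn_form H e ('D_(1 : R) gamma t) (gamma t) * F t))]) ->
  Par H gamma (pt (z *: (F 0 *: e (gamma 0)))) = pt (z *: (F 1 *: e (gamma 1))).
Proof.
move=> fe K; rewrite !scalerA.
apply: (frame_Par_parallel (sigma := fun t => (z * F t) *: e (gamma t)) fe K).
apply: (@frame_parallel gamma U e (fun t => z * F t) fe) => t tI.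
have [Ut dg _ DF] := K t tI; split; [exact: Ut|exact: dg|].
have := is_CDM (is_CD_cst t (1 : R) z) DF.
by congr is_CD; ring.
Qed.

End FrameParallel.

Section Segments.
Context {R : realType} {m n : nat} {V : set 'rV[R]_m} {E : line_bundle V}.
Variable H : herm_conn E.
Variables (W : set 'rV[R]_n) (phi : 'rV[R]_n -> 'rV[R]_m).
Hypothesis oW : open W.
Hypothesis sphi : smooth_on W phi.
Variables (U : set 'rV[R]_m) (e : forall x, E x).
Hypothesis fe : local_frame U e.
Implicit Types (a h : 'rV[R]_n).

Definition pull_form h a : R[i] := conn_form H e ('D_h phi a) (phi a).

Let D := W `&` phi @^-1` U.

Lemma open_frame_preimage : open (W `&` phi @^-1` U).
Proof.
have [oU _ _ _] := fe; rewrite openE => x [Wx Ux].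
apply: filterI; first by apply: open_nbhs_nbhs.
by apply: (Ck_continuous (sphi 0) Wx); apply: open_nbhs_nbhs.
Qed.

(** The direction ['D_h phi a] moves with [a], while [conn_form_smooth] concerns constant
    directions; expanding in the standard basis separates the two dependences. *)
Lemma pull_form_smooth k h : CCk k D (pull_form h).
Proof.
have oD := open_frame_preimage; have [oU _ _ _] := fe.
have DW : D `<=` W by move=> x [].
have Cphi k' : Ck k' D phi by apply: Ck_subset DW (sphi k').
have S : CCk k D (fun x => \sum_j ('D_h phi x 0 j)%:C *
    conn_form H e (delta_mx 0 j) (phi x)).
  apply: CCk_sum => // j; apply: CCkM => //.
    by apply: CCk_real; apply: (iffLR (Ck_rV k _ oD)); apply: Ck_derive (Cphi k.+1).
  apply: (CCk_comp oU oD _ (conn_form_smooth H _ k fe) (Cphi k)).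
  by move=> x [].
apply: (CCk_ext oD _ S) => x [Wx Ux].
by rewrite /pull_form (conn_form_sum H _ fe Ux).
Qed.

Lemma derive_sum_rV h a : W a -> 'D_h phi a = \sum_j h 0 j *: 'D_(delta_mx 0 j) phi a.
Proof.
move=> Wa; have C1 := sphi 1.
apply/rowP => i; rewrite summxE.
have dh v : derivable phi a v by apply: Ck_derivable C1 Wa.
rewrite (derive_mx (dh h)) mxE.
rewrite (C1_derive_sum h oW (iffLR (Ck_rV 1 phi oW) C1 i) Wa).
by apply: eq_bigr => j _; rewrite (derive_mx (dh _)) !mxE.
Qed.

Lemma pull_form_sum h a : D a -> pull_form h a = \sum_j (h 0 j)%:C * pull_form (delta_mx 0 j) a.
Proof.
move=> [Wa Ua]; rewrite /pull_form (derive_sum_rV h Wa).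
elim/big_rec2 : _ => [|j y v _ <-]; first exact: conn_form0 fe Ua.
exact: conn_form_linear fe Ua.
Qed.

Lemma pull_formZ (c : R) h a : D a -> pull_form (c *: h) a = c%:C * pull_form h a.
Proof.
move=> Da; rewrite !(pull_form_sum _ Da) mulr_sumr; apply: eq_bigr => j _.
by rewrite mxE rmorphM mulrA.
Qed.

Lemma segment_is_derive h a (t : R) : W (a + t *: h) ->
  is_derive t (1 : R) (fun s : R => phi (a + s *: h)) ('D_h phi (a + t *: h)).
Proof.
move=> Wt; have C1 := sphi 1; rewrite derive_line; apply: derivableP.
by apply/(iffLR (derivable_line _ _ _ _)); apply: Ck_derivable C1 Wt.
Qed.

Lemma segment_equation h a (F : R -> R[i]) :
  (forall t : R, 0 <= t <= 1 -> [/\ D (a + t *: h), F t != 0 &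
     is_CD t (1 : R) F (- (pull_form h (a + t *: h) * F t))]) ->
  let gamma := fun t : R => phi (a + t *: h) in
  forall t : R, 0 <= t <= 1 ->
    [/\ U (gamma t), derivable gamma t (1 : R), F t != 0 &
     is_CD t (1 : R) F (- (conn_form H e ('D_(1 : R) gamma t) (gamma t) * F t))].
Proof.
move=> K gamma t tI; have [[Wt Ut] F0 DF] := K t tI.
have [d dE] := segment_is_derive Wt.
by split; [exact: Ut|exact: d|exact: F0|rewrite dE; exact: DF].
Qed.

Lemma segment_Par h a (F : R -> R[i]) z :
  (forall t : R, 0 <= t <= 1 -> [/\ D (a + t *: h), F t != 0 &
     is_CD t (1 : R) F (- (pull_form h (a + t *: h) * F t))]) ->
  Par H (fun t : R => phi (a + t *: h)) (pt (z *: (F 0 *: e (phi a))))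
    = pt (z *: (F 1 *: e (phi (a + h)))).
Proof.
move=> /segment_equation/(frame_Par z fe) /=.
by rewrite scale0r addr0 scale1r.
Qed.

Lemma segment_solution h a : (forall t : R, `|t| <= 2 -> D (a + t *: h)) ->
  exists P Q : R -> R, [/\ P 0 = 0, Q 0 = 0 &
    forall t : R, `|t| < 2 ->
      is_derive t (1 : R) P (complex.Re (- pull_form h (a + t *: h))) /\
      is_derive t (1 : R) Q (complex.Im (- pull_form h (a + t *: h)))].
Proof.
move=> seg; have [Cr Ci] := CCkN open_frame_preimage (pull_form_smooth 0 h).
have line (t : R) : {for t, continuous (fun s : R => a + s *: h)}.
  apply: continuousD; first exact: cst_continuous.
  exact: scalel_continuous.
have [P P0 dP] := @antiderivative R (fun t => complex.Re (- pull_form h (a + t *: h)))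
  (fun t tI => continuous_comp (line t) (Ck_continuous Cr (seg t tI))).
have [Q Q0 dQ] := @antiderivative R (fun t => complex.Im (- pull_form h (a + t *: h)))
  (fun t tI => continuous_comp (line t) (Ck_continuous Ci (seg t tI))).
by exists P, Q; split=> // t t2; split; [exact: dP|exact: dQ].
Qed.

Lemma is_CD_rescale (F : R -> R[i]) (c t : R) b : is_CD (c * t) (1 : R) F b ->
  is_CD t (1 : R) (fun s => F (c * s)) (c%:C * b).
Proof.
have dc : is_derive t (1 : R) (fun s : R => c * s) c.
  have := is_derive_mul (is_derive_cst c t (1 : R)) (is_derive_id t (1 : R)).
  by rewrite mul0r add0r mulr1.
move=> [r i]; split.
  apply: is_derive_eq (is_derive_chain dc r) _.
  by rewrite cReM /= mul0r subr0 mulrC.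
apply: is_derive_eq (is_derive_chain dc i) _.
by rewrite cImM /= mul0r addr0 mulrC.
Qed.

(** One pair [P], [Q] serves all end points [a + c *: h] with [|c| <= 1], by running the same
    exponential at speed [c]. This is what later permits differentiation in [c]. *)
Lemma exp_equation h a (P Q : R -> R) (c : R) : `|c| <= 1 ->
  (forall t : R, `|t| <= 2 -> D (a + t *: h)) ->
  (forall t : R, `|t| < 2 ->
      is_derive t (1 : R) P (complex.Re (- pull_form h (a + t *: h))) /\
      is_derive t (1 : R) Q (complex.Im (- pull_form h (a + t *: h)))) ->
  let F := fun t => cexp (P (c * t)) (Q (c * t)) in
  forall t : R, 0 <= t <= 1 -> [/\ D (a + t *: (c *: h)), F t != 0 &
     is_CD t (1 : R) F (- (pull_form (c *: h) (a + t *: (c *: h)) * F t))].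
Proof.
move=> c1 seg dPQ F t tI.
have lt2 : `|c * t| < 2.
  case/andP: tI => t0 t1; rewrite normrM (ger0_norm t0).
  by apply: (@le_lt_trans _ _ 1); [rewrite mulr_ile1|rewrite ltr1n].
have tE : a + t *: (c *: h) = a + (c * t) *: h by rewrite scalerA mulrC.
rewrite tE; split; [exact/seg/ltW|exact: cexp_neq0|].
have [dP dQ] := dPQ _ lt2.
have := is_CD_rescale (is_CD_cexp dP dQ).
by congr is_CD; rewrite pull_formZ ?mulNr ?mulrN ?mulrA //; exact/seg/ltW.
Qed.

Lemma segment_Par_exp h a (P Q : R -> R) (c : R) z : `|c| <= 1 ->
  (forall t : R, `|t| <= 2 -> D (a + t *: h)) -> P 0 = 0 -> Q 0 = 0 ->
  (forall t : R, `|t| < 2 ->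
      is_derive t (1 : R) P (complex.Re (- pull_form h (a + t *: h))) /\
      is_derive t (1 : R) Q (complex.Im (- pull_form h (a + t *: h)))) ->
  Par H (fun t : R => phi (a + t *: (c *: h))) (pt (z *: e (phi a)))
    = pt (z *: (cexp (P c) (Q c) *: e (phi (a + c *: h)))).
Proof.
move=> c1 seg P0 Q0 dPQ.
have := segment_Par z (exp_equation c1 seg dPQ).
by rewrite mulr0 mulr1 P0 Q0 cexp0 scale1r.
Qed.

End Segments.

Section LineCD.
Context {R : realType} {E : normedModType R}.

Lemma is_CD_line (f : E -> R[i]) (a v : E) b :
  is_CD 0 (1 : R) (fun s : R => f (a + s *: v)) b -> is_CD a v f b.
Proof.
have line (g : E -> R) (l : R) : is_derive (0 : R) (1 : R) (fun s : R => g (a + s *: v)) l ->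
    is_derive a v g l.
  move=> [d dE].
  have E0 : a + (0 : R) *: v = a by rewrite scale0r addr0.
  have d' := iffRL (@derivable_line _ _ _ g a v 0) d; rewrite E0 in d'.
  have := @derive_line _ _ _ g a v 0; rewrite E0 dE => dE'.
  by split.
by move=> [r i]; split; apply: line.
Qed.

Lemma is_CD_direction (f : E -> R[i]) (a v : E) (k : R) b :
  is_CD a v f b -> is_CD a (k *: v) f (k%:C * b).
Proof.
move=> [[dr rE] [di iE]]; split.
  by rewrite cReM /= mul0r subr0 -rE; exact: derive_direction dr.
by rewrite cImM /= mul0r addr0 -iE; exact: derive_direction di.
Qed.

End LineCD.

Section NearSegment.
Context {R : realType} {n : nat}.

Lemma near_segment (D : set 'rV[R]_n) a : open D -> D a ->
  \forall b \near a, (forall t : R, `|t| <= 2 -> D (a + t *: (b - a))) /\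
    (forall t : R, `|t| <= 2 -> D (b + t *: (a - b))).
Proof.
move=> oD Da; have /nbhs_ballP[r /= r0 rD] : nbhs a D by apply: open_nbhs_nbhs.
(* The backward segment is the forward one at parameter [1 - t], of modulus at most 3 when
   [|t| <= 2]; hence a third of the radius. *)
apply/nbhs_ballP; exists (r / 3) => /=; first by rewrite divr_gt0.
move=> b; rewrite -ball_normE /ball_ /= => ab.
have key (t : R) : `|t| <= 3 -> D (a + t *: (b - a)).
  move=> t3; apply: rD; rewrite -ball_normE /ball_ /= opprD addNKr normrN normrZ.
  rewrite distrC; apply: (@le_lt_trans _ _ (3 * `|a - b|)).
    by rewrite ler_wpM2r.
  by rewrite mulrC -ltr_pdivlMr.
split=> t t2; first by apply: key; rewrite (le_trans t2) // ler_nat.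
have -> : b + t *: (a - b) = a + (1 - t) *: (b - a).
  by rewrite scalerBl scale1r addrA subrKC -scalerN opprB.
apply: key; apply: (le_trans (ler_normB _ _)); rewrite normr1.
by rewrite -[3]/((1 + 2)%:R) natrD lerD2l.
Qed.

End NearSegment.

Lemma unit_MVT {R : realType} (g G : R -> R) :
  (forall t : R, 0 <= t <= 1 -> is_derive t (1 : R) G (g t)) ->
  exists2 t : R, 0 <= t <= 1 & G 1 - G 0 = g t.
Proof.
move=> dG.
have dG' (t : R) : t \in `]0, 1[ -> is_derive t (1 : R) G (g t).
  by rewrite in_itv/= => /andP[t0 t1]; apply: dG; rewrite !ltW.
have cG : {within `[0, 1], continuous G}.
  apply: derivable_within_continuous => t; rewrite in_itv/= => tI.
  by have [] := dG t tI.
have [t tI ->] := MVT_segment ler01 dG' cG.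
by exists t; [move: tI; rewrite in_itv|rewrite subr0 mulr1].
Qed.

(** * Regularity of a coefficient that is transported along short segments *)

Section ExpTransport.
Context {R : realType} {m n : nat} {V : set 'rV[R]_m} {E : line_bundle V}.
Variable H : herm_conn E.
Variables (W : set 'rV[R]_n) (phi : 'rV[R]_n -> 'rV[R]_m).
Hypothesis oW : open W.
Hypothesis sphi : smooth_on W phi.
Variables (U : set 'rV[R]_m) (e : forall x, E x).
Hypothesis fe : local_frame U e.
Implicit Types (a h : 'rV[R]_n).

Local Notation D := (W `&` phi @^-1` U).
Local Notation A := (pull_form H phi e).

Variable f : 'rV[R]_n -> R[i].
(** Path independence in coordinates: the value of [f] at the end of a short segment is the
    transported one. All regularity of [f] is derived from this identity. *)
Hypothesis f_transport : forall a h (P Q : R -> R) (c : R), `|c| <= 1 ->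
  (forall t : R, `|t| <= 2 -> D (a + t *: h)) -> P 0 = 0 -> Q 0 = 0 ->
  (forall t : R, `|t| < 2 ->
      is_derive t (1 : R) P (complex.Re (- A h (a + t *: h))) /\
      is_derive t (1 : R) Q (complex.Im (- A h (a + t *: h)))) ->
  f (a + c *: h) = f a * cexp (P c) (Q c).

Let oD : open D. Proof. exact: open_frame_preimage oW sphi _ _ fe. Qed.

Lemma transport_is_CD a h : D a -> is_CD a h f (- (A h a * f a)).
Proof.
move=> Da; have /nbhs_ballP[r /= r0 rD] : nbhs a D by apply: open_nbhs_nbhs.
have h1 : 0 < `|h| + 1 by rewrite ltr_wpDl.
(* The direction is shrunk to [k *: h] so that the doubled segment stays in the ball; homogeneity
   undoes the factor at the end. *)
have [k k0 kr] : exists2 k : R, 0 < k & 2 * (k * `|h|) < r.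
  exists (r / (2 * (`|h| + 1))); first by rewrite divr_gt0 // mulr_gt0.
  have -> : 2 * (r / (2 * (`|h| + 1)) * `|h|) = r * (`|h| / (`|h| + 1)).
    by field; rewrite gt_eqF.
  by rewrite gtr_pMr // ltr_pdivrMr // mul1r ltrDl.
have seg (t : R) : `|t| <= 2 -> D (a + t *: (k *: h)).
  move=> t2; apply: rD; rewrite -ball_normE /ball_ /= opprD addNKr normrN !normrZ.
  rewrite (gtr0_norm k0); apply: le_lt_trans kr.
  by rewrite ler_wpM2r // mulr_ge0 // ltW.
have [P [Q [P0 Q0 dPQ]]] := segment_solution H oW sphi fe seg.
have [dP dQ] : is_derive (0 : R) (1 : R) P (complex.Re (- A (k *: h) a)) /\
    is_derive (0 : R) (1 : R) Q (complex.Im (- A (k *: h) a)).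
  by have := dPQ 0; rewrite normr0 scale0r addr0; apply.
have C := is_CDM (is_CD_cst (0 : R) (1 : R) (f a)) (is_CD_cexp dP dQ).
rewrite P0 Q0 cexp0 mul0r add0r mulr1 in C.
have L : is_CD a (k *: h) f (f a * - A (k *: h) a).
  apply: is_CD_line; apply: is_CD_near C.
  have N : \forall c \near (0 : R), `|c| < 1 by apply: nbhs0_lt.
  by apply: filterS N => c c1; rewrite (f_transport (ltW c1) seg P0 Q0 dPQ).
have := is_CD_direction k^-1 L; rewrite scalerA mulVf ?gt_eqF // scale1r.
congr is_CD; rewrite (pull_formZ H oW sphi fe k h Da).
rewrite mulrCA mulrN mulrA -rmorphM mulVf ?gt_eqF // rmorph1 mul1r.
by rewrite mulrN mulrC.
Qed.

(** Derivatives in all directions do not make [f] continuous; for that the connection form is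
    bounded uniformly over nearby points and linearly in [h]. *)
Lemma pull_form_bound a : D a -> exists2 M : R, 0 <= M &
  \forall b \near a, forall h, `|complex.Re (A h b)| <= M * `|h| /\
                               `|complex.Im (A h b)| <= M * `|h|.
Proof.
move=> Da.
pose N j : R := 1 + `|complex.Re (A (delta_mx 0 j) a)| + `|complex.Im (A (delta_mx 0 j) a)|.
have N0 j : 0 <= N j by rewrite !addr_ge0.
exists (\sum_j N j); first by apply: sumr_ge0.
have near_j j : \forall b \near a, `|complex.Re (A (delta_mx 0 j) b)| <= N j /\
    `|complex.Im (A (delta_mx 0 j) b)| <= N j.
  have [Cr Ci] := pull_form_smooth H oW sphi fe 0 (delta_mx 0 j).
  have near1 (g : 'rV[R]_n -> R) : {for a, continuous g} ->
      \forall b \near a, `|g b| <= 1 + `|g a|.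
    move=> cg; have : \forall b \near a, `|g a - g b| <= 1.
      by move/cvgrPdist_le: cg; exact.
    apply: filterS => b gb.
    by rewrite -[g b](subKr (g a)) (le_trans (ler_normB _ _)) // addrC lerD2r.
  apply: filterS2 (near1 _ (Ck_continuous Cr Da)) (near1 _ (Ck_continuous Ci Da)).
  move=> b b1 b2; split; apply: (le_trans (_ : _ <= _)); [exact: b1| |exact: b2|];
  rewrite /N ?lerDl // addrAC lerDl //.
have near_all : \forall b \near a, forall j, `|complex.Re (A (delta_mx 0 j) b)| <= N j /\
    `|complex.Im (A (delta_mx 0 j) b)| <= N j.
  exact: filter_forall near_j.
have ND : \forall b \near a, D b by apply: open_nbhs_nbhs.
apply: filterS2 near_all ND => b bN Db h.
rewrite (pull_form_sum H oW sphi fe h Db) cRe_sum cIm_sum !mulr_suml.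
have coord j : `|h 0 j| <= `|h|.
  by rewrite [leRHS]/Num.Def.normr/= mx_normrE; exact: (le_bigmax _ _ (ord0, j)).
split; apply: (le_trans (ler_norm_sum _ _ _)); apply: ler_sum => j _;
  rewrite ?cReM ?cImM /= mul0r ?subr0 ?addr0 normrM mulrC ler_pM //;
  by have [] := bN j.
Qed.

(** Both exponents vanish at 0, and along the segment from [a] to [b] their derivatives are at most
    [M * |b - a|]; the mean value theorem bounds them at 1. *)
Lemma transport_bound a : D a -> exists2 M : R, 0 <= M &
  \forall b \near a, exists p q : R, [/\ `|p| <= M * `|b - a|, `|q| <= M * `|b - a| &
    f b = f a * cexp p q].
Proof.
move=> Da; have [M M0 NM] := pull_form_bound Da.
exists M => //; have /nbhs_ballP[r /= r0 rM] := NM.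
have Nr : \forall b \near a, ball a r b by exact: nbhsx_ballx.
apply: filterS2 Nr (near_segment oD Da) => b rb [seg _].
have [P [Q [P0 Q0 dPQ]]] := segment_solution H oW sphi fe seg.
have c1 : `|1 : R| <= 1 by rewrite normr1.
have := f_transport c1 seg P0 Q0 dPQ; rewrite scale1r subrKC => fb.
have lt2 (t : R) : 0 <= t <= 1 -> `|t| < 2.
  by case/andP=> t0 t1; rewrite ger0_norm // (le_lt_trans t1) // ltr1n.
have bnd (t : R) : 0 <= t <= 1 -> ball a r (a + t *: (b - a)).
  case/andP=> t0 t1; move: rb; rewrite -!ball_normE /ball_ /= opprD addNKr normrN normrZ.
  by rewrite distrC; apply: le_lt_trans; rewrite ger0_norm // ler_piMl.
exists (P 1), (Q 1); split=> //.
  have [t tI Pt] := unit_MVT (fun t tI => (dPQ t (lt2 t tI)).1).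
  rewrite -[P 1]subr0 -P0 Pt cReN normrN; exact: (rM _ (bnd t tI) (b - a)).1.
have [t tI Qt] := unit_MVT (fun t tI => (dPQ t (lt2 t tI)).2).
rewrite -[Q 1]subr0 -Q0 Qt cImN normrN; exact: (rM _ (bnd t tI) (b - a)).2.
Qed.

Lemma transport_Ck0 : CCk 0 D f.
Proof.
have C a : D a -> ccvg (nbhs a) f (f a).
  move=> Da; have [M M0 N] := transport_bound Da.
  (* The exponents are chosen as functions of [b], with value [(0, 0)] where none satisfy the
     estimate, so that their limits at [a] make sense. *)
  have [pq pqE] : {pq : 'rV[R]_n -> R * R & \forall b \near a,
     [/\ `|(pq b).1| <= M * `|b - a|, `|(pq b).2| <= M * `|b - a| &
      f b = f a * cexp (pq b).1 (pq b).2]}.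
    have ex b : exists pq : R * R, (exists p q : R,
      [/\ `|p| <= M * `|b - a|, `|q| <= M * `|b - a| & f b = f a * cexp p q]) ->
      [/\ `|pq.1| <= M * `|b - a|, `|pq.2| <= M * `|b - a| & f b = f a * cexp pq.1 pq.2].
      have [[p [q K]]|nK] := pselect (exists p q : R,
        [/\ `|p| <= M * `|b - a|, `|q| <= M * `|b - a| & f b = f a * cexp p q]).
        by exists (p, q).
      by exists (0, 0).
    have [pq pqE] := choice ex; exists pq.
    by apply: filterS N => b /pqE.
  have small (g : 'rV[R]_n -> R) : (\forall b \near a, `|g b| <= M * `|b - a|) ->
      g b @[b --> a] --> (0 : R).
    move=> gM; apply: (iffRL (@cvgrPdist_le _ _ _ (nbhs a) (nbhs_filter a) g 0)) => eps eps0.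
    have Na : \forall b \near a, ball a (eps / (M + 1)) b.
      by apply: nbhsx_ballx; rewrite divr_gt0 // ltr_wpDl.
    suff : \forall b \near a, `|0 - g b| <= eps by [].
    apply: filterS2 gM Na => b gb; rewrite -ball_normE /ball_ /= sub0r normrN => ab.
    rewrite (le_trans gb) // distrC (le_trans (ler_wpM2l M0 (ltW ab))) //.
    have M1 : 0 < M + 1 by rewrite ltr_wpDl.
    by rewrite mulrCA ler_piMr ?(ltW eps0) // ler_pdivrMr // mul1r lerDl.
  have p0 : (pq b).1 @[b --> a] --> (0 : R).
    by apply: small; apply: filterS pqE => b [].
  have q0 : (pq b).2 @[b --> a] --> (0 : R).
    by apply: small; apply: filterS pqE => b [].
  have e0 := cvg_comp _ _ p0 (@continuous_expR R 0).
  have cos_0 := cvg_comp _ _ q0 (@continuous_cos R 0).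
  have sin_0 := cvg_comp _ _ q0 (@continuous_sin R 0).
  have Cexp : ccvg (nbhs a) (fun b => cexp (pq b).1 (pq b).2) (cexp 0 0).
    by split; apply: cvgM.
  have Fa := nbhs_filter a.
  have := ccvgM Fa (ccvg_cst (f a) Fa) Cexp; rewrite cexp0 mulr1.
  apply: ccvg_near.
  by apply: filterS pqE => b [].
by split; split=> // a Da; have [] := C a Da.
Qed.

Lemma transport_smooth k : CCk k D f.
Proof.
elim: k => [|k IH]; first exact: transport_Ck0.
apply: (CCkS (A := fun h a => - (A h a * f a)) oD IH).
  by move=> a h Da; exact: transport_is_CD.
move=> h; apply: (CCkN oD); apply: (CCkM oD) => //.
exact: (pull_form_smooth H oW sphi fe k h).
Qed.

End ExpTransport.

(** * Geometry of the leaf *)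

Section ConnectedChain.
Context {R : realType} {n : nat}.

(** The points reachable from [a] form an open subset of [W], and so do the others, because the
    local relation holds in both directions; this replaces symmetry of [T]. *)
Lemma connected_chain (W : set 'rV[R]_n) (T : 'rV[R]_n -> 'rV[R]_n -> Prop) :
  connected W -> (forall a b c, T a b -> T b c -> T a c) ->
  (forall a, W a -> \forall b \near a, [/\ W b, T a b & T b a]) ->
  forall a b, W a -> W b -> T a b.
Proof.
move=> cW tr loc a b Wa Wb.
pose B := [set c | W c /\ T a c].
have oB : open B.
  rewrite openE => c [Wc Tc]; apply: filterS (loc c Wc) => d [Wd cd _].
  by split=> //; apply: tr cd.
have oWB : open (W `\` B).
  rewrite openE => c [Wc nBc]; apply: filterS (loc c Wc) => d [Wd cd dc].
  by split=> // -[_ ad]; apply: nBc; split=> //; apply: tr dc.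
suff BW : B = W by have [] : B b by rewrite BW.
have sub c : B c -> W c by case.
apply: cW.
- exists a; split=> //; have [_ aa _] := nbhs_singleton (loc a Wa); exact: aa.
- by exists B => //; rewrite eqEsubset; split=> c => [Bc|[]//]; split=> //; exact: sub.
- exists (~` (W `\` B)); first by rewrite closedC.
  rewrite eqEsubset; split=> c => [Bc|[Wc nWB]].
    by split; [exact: sub|case].
  by apply: contrapT => nB; apply: nWB.
Qed.

End ConnectedChain.

Section DiffeoPlaque.
Context {R : realType} {m n : nat} {X : topologicalType} {O : orbifold R m X}
  {w : symplectic O}.
Variable P : polarization n w.

Lemma DC_toC p (f : 'rV[R]_m -> 'rV[R]_p) x (u : 'rV[R]_m) :
  DC f x (toC u) = toC ('D_u f x).
Proof.
have ReE : map_mx (@complex.Re R) (toC u) = u.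
  by apply/rowP => j; rewrite !mxE.
have ImE : map_mx (@complex.Im R) (toC u) = 0.
  by apply/rowP => j; rewrite !mxE.
rewrite /DC ReE ImE derive0; apply/rowP => j.
by rewrite !mxE rmorph0 mulr0 addr0.
Qed.

Lemma derive_diffeo (V1 V2 : set 'rV[R]_m) (f f' : 'rV[R]_m -> 'rV[R]_m) x u :
  open V1 -> open V2 -> smooth_on V1 f -> smooth_on V2 f' ->
  (forall y, V1 y -> V2 (f y)) -> (forall y, V1 y -> f' (f y) = y) -> V1 x ->
  'D_('D_u f x) f' (f x) = u.
Proof.
move=> oV1 oV2 sf sf' fV fK Vx.
have df : derivable f x u by apply: Ck_derivable (sf 1) Vx.
have [_ <-] := is_derive_comp_rV oV2 (sf' 1) (fV x Vx) df.
by rewrite (@eq_derive_on _ _ _ V1 _ id) // derive_id.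
Qed.

Lemma smooth_comp (k p q : nat) (V1 : set 'rV[R]_p) (V2 : set 'rV[R]_q)
    (g : 'rV[R]_p -> 'rV[R]_q) (f : 'rV[R]_q -> 'rV[R]_m) :
  open V1 -> open V2 -> (forall a, V1 a -> V2 (g a)) ->
  smooth_on V1 g -> smooth_on V2 f -> Ck k V1 (fun a => f (g a)).
Proof.
move=> oV1 oV2 gV sg sf; apply/(Ck_rV k _ oV1) => j.
exact: (Ck_comp oV2 oV1 gV (iffLR (Ck_rV k f oV2) (sf k) j) (sg k)).
Qed.

(** Common to local group elements and chart embeddings: both are diffeomorphisms onto open sets
    whose differentials respect [P]. *)
Lemma plaque_diffeo i j (V2 : set 'rV[R]_m) (f f' : 'rV[R]_m -> 'rV[R]_m) W phi :
  open V2 -> smooth_on (cdom (O i)) f -> smooth_on V2 f' -> V2 `<=` cdom (O j) ->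
  (forall y, cdom (O i) y -> V2 (f y)) -> (forall y, V2 y -> cdom (O i) (f' y)) ->
  (forall y, cdom (O i) y -> f' (f y) = y) -> (forall y, V2 y -> f (f' y) = y) ->
  (forall x u, cdom (O i) x -> u \in P i x <-> DC f x u \in P j (f x)) ->
  plaque P i W phi -> plaque P j W (fun a => f (phi a)).
Proof.
move=> oV2 sf sf' V2j fV fV' fK fK' fP [[oW cW sphi] dphi iphi imm rng].
have oi : open (cdom (O i)) by exact: cdom_open.
have Wi a : W a -> cdom (O i) (phi a) by move=> Wa; apply: dphi; exists a.
have D h a : W a -> 'D_h (fun a => f (phi a)) a = 'D_('D_h phi a) f (phi a).
  move=> Wa; have dh : derivable phi a h by apply: Ck_derivable (sphi 1) Wa.
  by have [_ ->] := is_derive_comp_rV oi (sf 1) (Wi a Wa) dh.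
split.
- by split=> // k; apply: smooth_comp sphi sf.
- by move=> _ [a Wa <-]; apply/V2j/fV/Wi.
- move=> a b Wa Wb ab; apply: iphi => //.
  by rewrite -(fK _ (Wi a Wa)) -(fK _ (Wi b Wb)) ab.
- move=> a Wa h; rewrite D // => D0; apply: (imm a Wa).
  rewrite -(derive_diffeo ('D_h phi a) oi oV2 sf sf' fV fK (Wi a Wa)).
  by rewrite D0 derive0.
- move=> a Wa; rewrite eqEsubset; split=> [_ [h _ <-]|v].
    rewrite D //= /polR /= -DC_toC; apply/(fP _ _ (Wi a Wa)).
    by have : polR P i (phi a) ('D_h phi a) by rewrite -(rng a Wa); exists h.
  rewrite /polR /= => Pv.
  have y2 : V2 (f (phi a)) by apply/fV/Wi.
  (* The differential of the inverse map pulls [v] back to a vector tangent to the original plaque,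
     which gives the inclusion of [polR] in the range. *)
  pose u := 'D_v f' (f (phi a)).
  have uv : 'D_u f (phi a) = v.
    have := derive_diffeo v oV2 oi sf' sf fV' fK' y2.
    by rewrite (fK _ (Wi a Wa)).
  have : polR P i (phi a) u.
    by rewrite /polR /=; apply/(fP _ _ (Wi a Wa)); rewrite DC_toC uv.
  rewrite -(rng a Wa) => -[h _ hu]; exists h; first by [].
  by rewrite (D h a Wa) hu uv.
Qed.

Lemma plaque_act i (g : cgrp (O i)) W phi : plaque P i W phi ->
  plaque P i W (fun a => cact g (phi a)).
Proof.
apply: (@plaque_diffeo i i (cdom (O i)) (cact g) (cact g^-1%g)) => //.
- exact: cdom_open.
- exact: cact_smooth.
- exact: cact_smooth.
- by move=> y; apply: cact_dom.
- by move=> y; apply: cact_dom.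
- by move=> y Vy; rewrite -cactM // mulVg cact1.
- by move=> y Vy; rewrite -cactM // mulgV cact1.
- by move=> x u Vx; apply: pol_inv.
Qed.

Lemma embedding_dom i j (l : embedding (O i) (O j)) x :
  cdom (O i) x -> cdom (O j) (l x).
Proof. by move=> Vx; case: (emapP l) => -[sub _ _ _] _ _; apply: sub; exists x. Qed.

Lemma embedding_inj i j (l : embedding (O i) (O j)) x y :
  cdom (O i) x -> cdom (O i) y -> l x = l y -> x = y.
Proof.
move=> Vx Vy lxy; case: (emapP l) => -[_ _ _ [f' _ fK]] _ _.
by rewrite -(fK x Vx) -(fK y Vy) lxy.
Qed.

Lemma plaque_emb i j (l : embedding (O i) (O j)) W phi : plaque P i W phi ->
  plaque P j W (fun a => l (phi a)).
Proof.
case: (emapP l) => -[sub opl sl [f' sf' fK]] _ _.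
apply: (@plaque_diffeo i j (l @` cdom (O i)) l f') => //.
- by move=> _ [x Vx <-]; rewrite fK.
- by move=> _ [x Vx <-]; rewrite fK.
- by move=> x u Vx; apply: pol_emb.
Qed.

Lemma plaque_dom i W phi a : plaque P i W phi -> W a -> cdom (O i) (phi a).
Proof. by move=> [_ sub _ _ _] Wa; apply: sub; exists a. Qed.

Lemma lifted_leaf_dom i x y : cdom (O i) x -> lifted_leaf P i x y -> cdom (O i) y.
Proof. by move=> Vx; elim=> // W phi a b p Wa Wb _ _; apply: plaque_dom p Wb. Qed.

Lemma lifted_leaf_trans i x y z :
  lifted_leaf P i x y -> lifted_leaf P i y z -> lifted_leaf P i x z.
Proof.
move=> xy; elim=> // W phi a b p Wa Wb _ IH.
exact: lifted_leaf_step p Wa Wb IH.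
Qed.

Lemma lifted_leaf_sym i x y : lifted_leaf P i x y -> lifted_leaf P i y x.
Proof.
elim=> [|W phi a b p Wa Wb _ IH]; first exact: lifted_leaf_refl.
apply: lifted_leaf_trans IH.
exact: lifted_leaf_step p Wb Wa (lifted_leaf_refl _ _ _).
Qed.

Lemma lifted_leaf_act i (g : cgrp (O i)) x y :
  lifted_leaf P i x y -> lifted_leaf P i (cact g x) (cact g y).
Proof.
elim=> [|W phi a b p Wa Wb _ IH]; first exact: lifted_leaf_refl.
exact: (lifted_leaf_step (plaque_act g p) Wa Wb IH).
Qed.

Lemma lifted_leaf_emb i j (l : embedding (O i) (O j)) x y :
  lifted_leaf P i x y -> lifted_leaf P j (l x) (l y).
Proof.
elim=> [|W phi a b p Wa Wb _ IH]; first exact: lifted_leaf_refl.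
exact: (lifted_leaf_step (plaque_emb l p) Wa Wb IH).
Qed.

Section Leaf.
Variables (Lf : set X) (Lf_leaf : is_leaf P Lf).

Lemma leaf_glue_closed p q : Lf p -> leaf_glue P p q -> Lf q.
Proof.
have [p0 ->] := Lf_leaf => /= op pq.
by apply: Relation_Operators.rst_trans op _; apply: Relation_Operators.rst_step.
Qed.

Lemma leaf_points_lifted i x y : leaf_points Lf i x -> lifted_leaf P i x y ->
  leaf_points Lf i y.
Proof.
move=> [Vx Lx] xy; split; first exact: lifted_leaf_dom xy.
by apply: leaf_glue_closed Lx _; exists i, x, y; split.
Qed.

Lemma leaf_points_plaque i W phi a b : plaque P i W phi -> W a -> W b ->
  leaf_points Lf i (phi a) -> leaf_points Lf i (phi b).
Proof.
move=> p Wa Wb; move/leaf_points_lifted; apply.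
exact: lifted_leaf_step p Wa Wb (lifted_leaf_refl _ _ _).
Qed.

Lemma leaf_points_act i (g : cgrp (O i)) x :
  leaf_points Lf i x -> leaf_points Lf i (cact g x).
Proof.
move=> [Vx Lx]; split; first exact: cact_dom.
rewrite /preimage /= -(iffRL (cproj_fib Vx (cact_dom g Vx))) //.
by exists g.
Qed.

Lemma leaf_points_emb i j (l : embedding (O i) (O j)) x :
  leaf_points Lf i x -> leaf_points Lf j (l x).
Proof.
move=> [Vx Lx]; split; first exact: embedding_dom.
by case: (emapP l) => _ _ pl; rewrite /preimage /= pl.
Qed.

(* Connectedness of the leaf as an orbifold, in the form of an induction
   principle over elementary moves. *)
Lemma leaf_connected
    (C : forall (i : oidx O), 'rV[R]_m -> forall j : oidx O, 'rV[R]_m -> Prop) :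
  (forall i x j y k z, C i x j y -> C j y k z -> C i x k z) ->
  (forall i (g : cgrp (O i)) x, leaf_points Lf i x -> C i x i (cact g x)) ->
  (forall i j (l : embedding (O i) (O j)) x, leaf_points Lf i x ->
     C i x j (l x) /\ C j (l x) i x) ->
  (forall i W phi a, plaque P i W phi -> phi @` W `<=` leaf_points Lf i -> W a ->
     \forall b \near a, [/\ W b, C i (phi a) i (phi b) & C i (phi b) i (phi a)]) ->
  forall i x j y, leaf_points Lf i x -> leaf_points Lf j y -> C i x j y.
Proof.
move=> tr Cg Ce Cp.
have Crefl i x : leaf_points Lf i x -> C i x i x.
  by move=> Lx; have := Cg i 1%g x Lx; rewrite cact1 //; case: Lx.
(* Two lifts of one point of [X] need not be related by an embedding. Both charts receive one from a
   third chart, and local group elements move the images to the given lifts. *)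
have same i x j y : leaf_points Lf i x -> leaf_points Lf j y ->
    cproj (O i) x = cproj (O j) y -> C i x j y.
  move=> Lx Ly xy; have [Vx _] := Lx; have [Vy _] := Ly.
  have [k [z [Vz zx [l] [l']]]] := o_compat Vx Vy xy.
  have pl : cproj (O i) (l z) = cproj (O k) z by case: (emapP l) => _ _ ->.
  have pl' : cproj (O j) (l' z) = cproj (O k) z by case: (emapP l') => _ _ ->.
  have Lz : leaf_points Lf k z by split=> //; rewrite /preimage /= zx; case: Lx.
  have [g gx] : exists g : cgrp (O i), l z = cact g x.
    by apply: (iffLR (cproj_fib Vx (embedding_dom l Vz))); rewrite pl zx.
  have [g' gy] : exists g : cgrp (O j), y = cact g (l' z).
    by apply: (iffLR (cproj_fib (embedding_dom l' Vz) Vy)); rewrite pl' zx.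
  apply: (tr i x i (l z)); first by rewrite gx; apply: Cg.
  apply: (tr i (l z) k z); first by have [] := Ce k i l z Lz.
  apply: (tr k z j (l' z)); first by have [] := Ce k j l' z Lz.
  by rewrite gy; apply: Cg; apply: leaf_points_emb.
have leaf i x y : leaf_points Lf i x -> lifted_leaf P i x y -> C i x i y /\ C i y i x.
  move=> Lx; elim=> [|W phi a b p Wa Wb xa [IH1 IH2]]; first by split; apply: Crefl.
  have sub : phi @` W `<=` leaf_points Lf i.
    move=> _ [c Wc <-]; apply: (leaf_points_plaque p Wa Wc).
    exact: leaf_points_lifted xa.
  have [[_ cW _] _ _ _ _] := p.
  have ch := connected_chain cW (fun a b c => tr i (phi a) i (phi b) i (phi c))
    (fun a Wa => Cp i W phi a p sub Wa).
  by split; [apply: tr IH1 _|apply: tr IH2]; apply: ch.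
(* Membership in the leaf is carried along, and all lifts of both end points are treated at once in
   both directions, so that the symmetric case closes. In the transitive case [o_cover] lifts the
   middle point. *)
have main p q : Relation_Operators.clos_refl_sym_trans X (leaf_glue P) p q ->
    Lf p -> Lf q /\ forall i x j y, cdom (O i) x -> cproj (O i) x = p ->
      cdom (O j) y -> cproj (O j) y = q -> C i x j y /\ C j y i x.
  elim=> {p q} [p q pq|p|p q pq IH|p q r pq IH1 qr IH2] Lp.
  - have Lq : Lf q by apply: leaf_glue_closed pq.
    split=> // i x j y Vx xp Vy yq.
    have Lx : leaf_points Lf i x by split=> //; rewrite /preimage /= xp.
    have Ly : leaf_points Lf j y by split=> //; rewrite /preimage /= yq.
    have [k [x' [y' [Vx' xy' x'p y'q]]]] := pq.
    have Lx' : leaf_points Lf k x' by split=> //; rewrite /preimage /= x'p.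
    have Ly' := leaf_points_lifted Lx' xy'.
    have [C1 C2] := leaf k x' y' Lx' xy'.
    split.
      apply: (tr i x k x'); first by apply: same; rewrite // xp x'p.
      by apply: (tr k x' k y') => //; apply: same; rewrite // yq y'q.
    apply: (tr j y k y'); first by apply: same; rewrite // yq y'q.
    by apply: (tr k y' k x') => //; apply: same; rewrite // xp x'p.
  - split=> // i x j y Vx xp Vy yp.
    have Lx : leaf_points Lf i x by split=> //; rewrite /preimage /= xp.
    have Ly : leaf_points Lf j y by split=> //; rewrite /preimage /= yp.
    by split; apply: same; rewrite // xp yp.
  - have Lq : Lf p.
      have [p0 E] := Lf_leaf; move: Lp; rewrite E /= => oq.
      by apply: Relation_Operators.rst_trans oq _; apply: Relation_Operators.rst_sym.
    have [_ K] := IH Lq; split=> // i x j y Vx xq Vy yp.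
    by have [] := K j y i x Vy yp Vx xq; split.
  - have [Lq K1] := IH1 Lp; have [Lr K2] := IH2 Lq; split=> // i x j y Vx xp Vy yr.
    have [k [z [Vz zq]]] := o_cover O q.
    have [a1 a2] := K1 i x k z Vx xp Vz zq; have [b1 b2] := K2 k z j y Vz zq Vy yr.
    by split; [apply: tr b1|apply: tr a2].
move=> i x j y Lx Ly; have [Vx Lpx] := Lx; have [Vy Lpy] := Ly.
have [] := main (cproj (O i) x) (cproj (O j) y) _ Lpx; last first.
  by move=> _ K; have [] := K i x j y Vx erefl Vy erefl.
have [p0 E] := Lf_leaf; move: Lpx Lpy; rewrite E /= => ox oy.
by apply: Relation_Operators.rst_trans oy; apply: Relation_Operators.rst_sym.
Qed.

End Leaf.

End DiffeoPlaque.

(** * Orbifold paths *)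

Section Lines.
Context {R : realType} {n : nat}.

Lemma Ck_id k (U : set R) : Ck k U (@id R).
Proof.
case: k => [|k]; (split; first by move=> x _; exact: cvg_id) => // v.
split=> [x _|]; first exact: derivable_id.
suff -> : (fun x : R => 'D_v (@id R) x) = fun=> v by exact: Ck_cst.
by apply/funext => x; exact: derive_id.
Qed.

Lemma smooth_line (a h : 'rV[R]_n) : smooth_on setT (fun t : R => a + t *: h).
Proof.
move=> k; apply: (CkD openT (Ck_cst k setT a)).
apply: (iffRL (Ck_rV k _ openT)) => j.
apply: (Ck_ext openT _ (CkM openT (Ck_id k setT) (Ck_cst k setT (h 0 j)))) => t _.
by rewrite mxE.
Qed.

End Lines.

Section LinearFibre.
Context {R : realType} {U V : lmodType R[i]} (F : U -> V).

Lemma fibre_linear0 : linear F -> F 0 = 0.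
Proof.
move=> lF; have := lF 1 0 0; rewrite !scale1r addr0 => /eqP.
by rewrite -subr_eq0 opprD addrA subrr sub0r oppr_eq0 => /eqP.
Qed.

Lemma fibre_linearZ z u : linear F -> F (z *: u) = z *: F u.
Proof. by move=> lF; have := lF z u 0; rewrite !addr0 fibre_linear0 // addr0. Qed.

Lemma fibre_neq0 u : linear F -> injective F -> u != 0 -> F u != 0.
Proof. by move=> lF iF; apply: contraNneq => Fu; apply/eqP/iF; rewrite Fu fibre_linear0. Qed.

End LinearFibre.

Section Carries.
Context {R : realType} {m : nat}.

(** [T] maps the line over [x] isomorphically onto the line over [y], expressed on generators. Maps
    of total spaces are used because the end points of consecutive pieces match only up to provable
    equality. *)
Definition carries (V V' : set 'rV[R]_m) (E : line_bundle V) (E' : line_bundle V')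
    (T : total_space E -> total_space E') x y (u : E x) (u' : E' y) :=
  [/\ u != 0, u' != 0 & forall z, T (pt (z *: u)) = pt (z *: u')].

Lemma carries_comp (V1 V2 V3 : set 'rV[R]_m) (E1 : line_bundle V1)
    (E2 : line_bundle V2) (E3 : line_bundle V3)
    (T : total_space E1 -> total_space E2) (T' : total_space E2 -> total_space E3)
    x y z (u : E1 x) (u' v : E2 y) (v' : E3 z) : V2 y ->
  carries T u u' -> carries T' v v' ->
  exists v'', carries (fun t => T' (T t)) u (v'' : E3 z).
Proof.
move=> Vy [u0 u'0 Tu] [v0 v'0 Tv].
have E := fib_coefP u' Vy v0; set k := fib_coef v u' in E.
have k0 : k != 0 by apply: contraNneq u'0 => k0; rewrite E k0 scale0r.
exists (k *: v'); split=> //; first by rewrite scaler_eq0 negb_or k0.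
by move=> c; rewrite Tu E scalerA Tv scalerA.
Qed.

End Carries.

Section Prequantum.
Context {R : realType} {m n : nat} {X : topologicalType} {O : orbifold R m X}
  {w : symplectic O} {hbar : R}.
Variables (L : prequantum w hbar) (P : polarization n w).

Lemma pq_act_linear i (g : cgrp (O i)) x : cdom (O i) x ->
  linear (@pq_act _ _ _ _ _ _ L i g x) /\ injective (@pq_act _ _ _ _ _ _ L i g x).
Proof. by move=> Vx; have [l /bij_inj inj _] := (pq_act_iso L g).1 x Vx. Qed.

Lemma pq_emb_linear i j (l : embedding (O i) (O j)) x : cdom (O i) x ->
  linear (@pq_emb _ _ _ _ _ _ L i j l x) /\ injective (@pq_emb _ _ _ _ _ _ L i j l x).
Proof. by move=> Vx; have [li /bij_inj inj _] := (pq_emb_iso L l).1 x Vx. Qed.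

Lemma Phi_pt i (g : cgrp (O i)) x (u : L i x) z : cdom (O i) x ->
  Phi L g (pt (z *: u)) = pt (z *: pq_act g u).
Proof.
move=> Vx; have [l _] := pq_act_linear g Vx.
by rewrite /Phi /on_total /= fibre_linearZ.
Qed.

Lemma Phi1 i (v : total_space (L i)) : cdom (O i) (projT1 v) -> Phi L 1%g v = v.
Proof. exact: pq_act1. Qed.

Lemma emb_pt i j (l : embedding (O i) (O j)) x (u : L i x) z : cdom (O i) x ->
  on_total (@pq_emb _ _ _ _ _ _ L i j l) (pt (z *: u)) = pt (z *: pq_emb l u).
Proof.
move=> Vx; have [li _] := pq_emb_linear l Vx.
by rewrite /on_total /= fibre_linearZ.
Qed.

(** The backward identification is a chosen preimage; it is the expected one because the embedding
    is injective on its chart and on each fibre. *)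
Lemma back_pt i j (l : embedding (O i) (O j)) x (u : L i x) : cdom (O i) x ->
  join_fib (join_back l) (pt (pq_emb l u)) = pt u.
Proof.
move=> Vx; rewrite /join_fib; set S := [set u' | _].
have Su : S (pt u) by [].
have : S (xget (pt (0 : L i 0) : {x : 'rV[R]_m & L i x}) S) by apply: xgetI Su.
case: (xget _ _) => y v [/= Vy E].
have yx : y = x.
  by apply: (embedding_inj (l := l)) => //; apply: (congr1 (@projT1 _ _) E).
subst y; congr (existT _ _ _).
by have [_] := pq_emb_linear l Vx; apply; apply: pt_inj E.
Qed.

(** The connection form vanishes in the direction 0, so the constant coefficient 1 solves the
    transport equation. *)
Lemma Par_cst i x (v : L i x) : cdom (O i) x ->
  Par (pq_conn L i) (fun=> x) (pt v) = pt v.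
Proof.
move=> Vx; have [U [e [fe Ux]]] := ex_local_frame (E := L i) Vx.
have [_ _ _ e0] := fe.
have E := fib_coefP v Vx (e0 x Ux); set z := fib_coef _ _ in E.
have := @frame_Par _ _ _ _ (pq_conn L i) (fun=> x) U e (fun=> 1) z fe.
rewrite scale1r -E; apply => t tI.
split; [exact: Ux|exact: derivable_cst|exact: oner_neq0|].
rewrite derive_cst (conn_form0 _ fe Ux) mul0r oppr0; exact: is_CD_cst.
Qed.

Fixpoint orb_cat (i j k : oidx O) (c : orb_path i j) : orb_path j k -> orb_path i k :=
  match c in orb_path i j return orb_path j k -> orb_path i k with
  | orb_last i j gamma tau => fun d => orb_cons gamma tau d
  | orb_cons i j k' gamma tau c' => fun d => orb_cons gamma tau (orb_cat c' d)
  end.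

Lemma start_cat (i j k : oidx O) (c : orb_path i j) (d : orb_path j k) :
  start (orb_cat c d) = start c.
Proof. by case: c d. Qed.

Lemma holonomy_cat (i j k : oidx O) (c : orb_path i j) (d : orb_path j k) v :
  holonomy (L := L) (orb_cat c d) v = holonomy (L := L) d (holonomy (L := L) c v).
Proof. by elim: c d v => //= {}i {}j k' gamma tau c IH d v; rewrite IH. Qed.

Section Leaf.
Variables (Lf : set X) (Lf_leaf : is_leaf P Lf).

Lemma orb_path_to_cat (i j k : oidx O) (c : orb_path i j) (d : orb_path j k) q :
  orb_path_to P Lf c (start d) -> orb_path_to P Lf d q ->
  orb_path_to P Lf (orb_cat c d) q.
Proof.
elim: c d => /= [{}i {}j gamma tau d [L0 lp [_ J]] dq|{}i {}j k' gamma tau c IH d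
  [L0 lp J cd] dq]; first by split.
by split=> //; [rewrite start_cat|apply: IH].
Qed.

Lemma orb_path_to_end (i j : oidx O) (c : orb_path i j) q :
  orb_path_to P Lf c q -> leaf_points Lf j q.
Proof. by elim: c => /= [? ? ? ? [_ _ []]|? ? ? ? ? ? IH [_ _ _ /IH]]. Qed.

Lemma orb_path_to_start (i j : oidx O) (c : orb_path i j) q :
  orb_path_to P Lf c q -> leaf_points Lf i (start c).
Proof. by case: c => /= [? ? ? ? []|? ? ? ? ? ? []]. Qed.

(** The last clause is not automatic, as [Par] falls back to 0 where no parallel section exists. It
    makes the holonomy injective on the fibre, so that return paths can be cancelled. *)
Definition good_path (i : oidx O) x (j : oidx O) y (c : orb_path i j) :=
  [/\ start c = x, orb_path_to P Lf c y &
      exists (u : L i x) (u' : L j y), carries (holonomy (L := L) c) u u'].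

Lemma good_path_cat (i j k : oidx O) x y z (c : orb_path i j) (d : orb_path j k) :
  good_path x y c -> good_path y z d -> good_path x z (orb_cat c d).
Proof.
move=> [sx cy [u [u' cu]]] [sy dz [v [v' dv]]].
have Vy : cdom (O j) y by have [] := orb_path_to_end cy.
split; [by rewrite start_cat|by apply: orb_path_to_cat => //; rewrite sy|].
have [v'' [u0 v0 H]] := carries_comp Vy cu dv.
by exists u, v''; split=> // t; rewrite holonomy_cat.
Qed.

Lemma leaf_path_cst i x : leaf_points Lf i x ->
  leaf_path P i (lifted_leaf P i x) (fun=> x).
Proof.
move=> Lx; split=> [|t _]; last exact: lifted_leaf_refl.
by apply: leaf_curve_cst; first exact: ltr01.
Qed.

(** In an [orb_path] every identification follows a path; here a constant one. *)
Lemma good_act i (g : cgrp (O i)) x : leaf_points Lf i x ->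
  good_path x (cact g x) (orb_last (fun=> x) (join_grp g)).
Proof.
move=> Lx; have [Vx _] := Lx; split=> //=.
  split=> //; first exact: leaf_path_cst.
  split; first exact: leaf_points_act.
  by split=> // _ [y xy <-]; apply: lifted_leaf_act.
have [U [e [[_ _ _ e0] Ux]]] := ex_local_frame (E := L i) Vx.
have [lg ig] := pq_act_linear g Vx.
exists (e x), (pq_act g (e x)); split=> [||z]; first exact: e0.
- by apply: fibre_neq0 => //; exact: e0.
- by rewrite /= Par_cst // Phi_pt.
Qed.

Lemma good_emb i j (l : embedding (O i) (O j)) x : leaf_points Lf i x ->
  good_path x (l x) (orb_last (fun=> x) (join_emb l)).
Proof.
move=> Lx; have [Vx _] := Lx; split=> //=.
  split=> //; first exact: leaf_path_cst.
  split; first exact: leaf_points_emb.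
  by split=> // _ [y xy <-]; apply: lifted_leaf_emb.
have [U [e [[_ _ _ e0] Ux]]] := ex_local_frame (E := L i) Vx.
have [lg ig] := pq_emb_linear l Vx.
exists (e x), (pq_emb l (e x)); split=> [||z]; first exact: e0.
- by apply: fibre_neq0 => //; exact: e0.
- by rewrite /= Par_cst // emb_pt.
Qed.

Lemma good_back i j (l : embedding (O i) (O j)) x : leaf_points Lf i x ->
  good_path (l x) x (orb_last (fun=> l x) (join_back l)).
Proof.
move=> Lx; have [Vx _] := Lx; split=> //=.
  have Llx : leaf_points Lf j (l x) by apply: leaf_points_emb.
  split=> //; first exact: leaf_path_cst.
  split=> //.
  by split=> // _ [y xy <-]; apply: lifted_leaf_emb.
have [U [e [[_ _ _ e0] Ux]]] := ex_local_frame (E := L i) Vx.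
have [lg ig] := pq_emb_linear l Vx.
exists (pq_emb l (e x)), (e x); split=> [||z]; last first.
- rewrite /= Par_cst -?fibre_linearZ //; first exact: back_pt.
  exact: embedding_dom.
- exact: e0.
- by apply: fibre_neq0 => //; exact: e0.
Qed.

Lemma segment_leaf_path i W phi a h : plaque P i W phi ->
  (forall t : R, 0 <= t <= 1 -> W (a + t *: h)) -> leaf_points Lf i (phi a) ->
  leaf_path P i (lifted_leaf P i (phi a)) (fun t : R => phi (a + t *: h)).
Proof.
move=> p seg La.
have Wa : W a by have := seg 0; rewrite scale0r addr0 lexx ler01; apply.
split=> [|t tI]; last first.
  exact: lifted_leaf_step p Wa (seg t tI) (lifted_leaf_refl _ _ _).
apply: (leaf_curve_plaque (I := setT) (c := fun t : R => a + t *: h) ltr01 p openT) => [k|t tI].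
  exact: smooth_line.
by split=> //; exact: seg.
Qed.

(** Every path is followed by an identification, so the segment is closed by the unit of the local
    group. The second conclusion keeps the holonomy explicit, which is what yields [f_transport]. *)
Lemma good_segment i W phi U (e : forall x, L i x) a h (P' Q' : R -> R) (c : R) :
  plaque P i W phi -> phi @` W `<=` leaf_points Lf i -> local_frame U e ->
  `|c| <= 1 -> (forall t : R, `|t| <= 2 -> (W `&` phi @^-1` U) (a + t *: h)) ->
  P' 0 = 0 -> Q' 0 = 0 ->
  (forall t : R, `|t| < 2 ->
     is_derive t (1 : R) P' (complex.Re (- pull_form (pq_conn L i) phi e h (a + t *: h))) /\
     is_derive t (1 : R) Q' (complex.Im (- pull_form (pq_conn L i) phi e h (a + t *: h)))) ->
  let d := orb_last (fun t : R => phi (a + t *: (c *: h))) (join_grp (1%g : cgrp (O i))) in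
  good_path (phi a) (phi (a + c *: h)) d /\
  forall z, holonomy (L := L) d (pt (z *: e (phi a))) =
    pt (z *: (cexp (P' c) (Q' c) *: e (phi (a + c *: h)))).
Proof.
move=> p sub fe c1 seg P0 Q0 dPQ d.
have [[oW _ sphi] _ _ _ _] := p.
have seg1 (t : R) : 0 <= t <= 1 -> (W `&` phi @^-1` U) (a + t *: (c *: h)).
  move=> /andP[t0 t1]; rewrite scalerA; apply: seg; rewrite normrM (ger0_norm t0).
  by apply: (@le_trans _ _ 1); [rewrite mulr_ile1|rewrite ler1n].
have seg1W (t : R) : 0 <= t <= 1 -> W (a + t *: (c *: h)) by move=> /seg1[].
have [Wa Ua] : (W `&` phi @^-1` U) a.
  by have := seg1 0; rewrite scale0r addr0 lexx ler01; apply.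
have [Wb Ub] : (W `&` phi @^-1` U) (a + c *: h).
  by have := seg1 1; rewrite scale1r lexx ler01; apply.
have La : leaf_points Lf i (phi a) by apply: sub; exists a.
have Lb : leaf_points Lf i (phi (a + c *: h)) by apply: sub; exists (a + c *: h).
have hol z : holonomy (L := L) d (pt (z *: e (phi a))) =
    pt (z *: (cexp (P' c) (Q' c) *: e (phi (a + c *: h)))).
  rewrite /= (segment_Par_exp (h := h) oW sphi fe z c1 seg P0 Q0 dPQ) Phi1 //=.
  by have [] := Lb.
split=> //; have [_ _ _ e0] := fe; split=> /=.
- by rewrite scale0r addr0.
- rewrite scale0r addr0 scale1r; split=> //.
    exact: (segment_leaf_path p seg1W La).
  split=> //; split; first by rewrite cact1 //; case: Lb.
  move=> _ [y xy <-]; rewrite cact1 //.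
  by apply: lifted_leaf_dom xy; case: Lb.
- exists (e (phi a)), (cexp (P' c) (Q' c) *: e (phi (a + c *: h))); split=> //.
    exact: e0.
  by rewrite scaler_eq0 negb_or cexp_neq0 e0.
Qed.

End Leaf.

End Prequantum.

(** * Flat sections and trivial holonomy *)

Section WithinCat.
Context {R : realType}.

Lemma cvg_within_cat (T : topologicalType) (f : R -> T) (a b d t : R) (l : T) :
  a < b -> b < d ->
  (t <= b -> f r @[r --> within `[a, b] (nbhs t)] --> l) ->
  (b <= t -> f r @[r --> within `[b, d] (nbhs t)] --> l) ->
  f r @[r --> within `[a, d] (nbhs t)] --> l.
Proof.
move=> ab bd fab fbd N lN.
suff : \forall r \near within `[a, d] (nbhs t), N (f r) by [].
rewrite near_withinE.
have near_ab : t <= b -> \forall r \near t, `[a, b]%classic r -> N (f r).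
  move=> tb; have : \forall r \near within `[a, b] (nbhs t), N (f r) by exact: fab tb N lN.
  by rewrite near_withinE.
have near_bd : b <= t -> \forall r \near t, `[b, d]%classic r -> N (f r).
  move=> tb; have : \forall r \near within `[b, d] (nbhs t), N (f r) by exact: fbd tb N lN.
  by rewrite near_withinE.
have [tb|bt|tb] := ltgtP t b.
- apply: filterS2 (near_ab (ltW tb)) (lt_nbhsl tb) => r Nr rb.
  rewrite /= in_itv/= => /andP[ar _]; apply: Nr.
  by rewrite /= in_itv/= ar ltW.
- apply: filterS2 (near_bd (ltW bt)) (lt_nbhsr bt) => r Nr rb.
  rewrite /= in_itv/= => /andP[_ rd]; apply: Nr.
  by rewrite /= in_itv/= rd ltW.
- have := near_ab; have := near_bd; rewrite tb => /(_ (lexx _)) N2 /(_ (lexx _)) N1.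
  apply: filterS2 N1 N2 => r Nr1 Nr2.
  rewrite /= in_itv/= => /andP[ar rd]; have [rb|br] := leP r b.
    by apply: Nr1; rewrite /= in_itv/= ar.
  by apply: Nr2; rewrite /= in_itv/= rd ltW.
Qed.

Lemma ccvg_within_cat (f : R -> R[i]) (a b d t : R) l :
  a < b -> b < d ->
  (t <= b -> ccvg (within `[a, b] (nbhs t)) f l) ->
  (b <= t -> ccvg (within `[b, d] (nbhs t)) f l) ->
  ccvg (within `[a, d] (nbhs t)) f l.
Proof.
move=> ab bd f1 f2.
by split; apply: (cvg_within_cat ab bd) => tb;
  [have [] := f1 tb|have [] := f2 tb|have [] := f1 tb|have [] := f2 tb].
Qed.

End WithinCat.

Section Prequantum.
Context {R : realType} {m n : nat} {X : topologicalType} {O : orbifold R m X}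
  {w : symplectic O} {hbar : R}.
Variables (L : prequantum w hbar) (P : polarization n w).

Section Leaf.
Variables (Lf : set X) (Lf_leaf : is_leaf P Lf).

Lemma ex_plaque_frame i W phi a : plaque P i W phi -> W a ->
  exists U (e : forall x, L i x), [/\ local_frame U e, open (W `&` phi @^-1` U) &
    (W `&` phi @^-1` U) a].
Proof.
move=> p Wa; have [U [e [fe Ua]]] := ex_local_frame (E := L i) (plaque_dom p Wa).
have [[oW _ sphi] _ _ _ _] := p.
by exists U, e; split=> //; exact: open_frame_preimage oW sphi _ _ fe.
Qed.

Lemma good_near i W phi U (e : forall x, L i x) a b :
  plaque P i W phi -> phi @` W `<=` leaf_points Lf i -> local_frame U e ->
  (forall t : R, `|t| <= 2 -> (W `&` phi @^-1` U) (a + t *: (b - a))) ->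
  exists c : orb_path i i, good_path L P Lf (phi a) (phi b) c.
Proof.
move=> p sub fe seg; have [[oW _ sphi] _ _ _ _] := p.
have [P' [Q' [P0 Q0 dPQ]]] := segment_solution (pq_conn L i) oW sphi fe seg.
have c1 : `|1 : R| <= 1 by rewrite normr1.
have [g _] := good_segment p sub fe c1 seg P0 Q0 dPQ.
by move: g; rewrite scale1r subrKC => g; eexists; exact: g.
Qed.

(** Good paths compose, and each elementary move has one: embeddings are reversed by [join_back],
    short segments by running them backwards. *)
Lemma good_connected i x j y : leaf_points Lf i x -> leaf_points Lf j y ->
  exists c : orb_path i j, good_path L P Lf x y c.
Proof.
apply: (leaf_connected Lf_leaf
  (C := fun i x j y => exists c : orb_path i j, good_path L P Lf x y c)).
- move=> {}i {}x {}j {}y k z [c gc] [d gd].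
  by exists (orb_cat c d); apply: good_path_cat gc gd.
- by move=> {}i g {}x Lx; eexists; exact: good_act.
- move=> {}i {}j l {}x Lx; split; eexists; [exact: good_emb|exact: good_back].
move=> {}i W phi a p sub Wa.
have [U [e [fe oD Da]]] := ex_plaque_frame p Wa.
have ND : \forall b \near a, (W `&` phi @^-1` U) b by apply: open_nbhs_nbhs.
apply: filterS2 (near_segment oD Da) ND => b [ab ba] [Wb _].
by split=> //; [exact: good_near p sub fe ab|exact: good_near p sub fe ba].
Qed.

Section FlatSection.
Variable s : forall i x, L i x.
Hypothesis s_plaque : forall i W phi, plaque P i W phi ->
  phi @` W `<=` leaf_points Lf i -> parallel_on_plaque W phi (s i).
Hypothesis s_act : forall i (g : cgrp (O i)) x, leaf_points Lf i x ->
  pq_act g (s i x) = s i (cact g x).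
Hypothesis s_emb : forall i j (l : embedding (O i) (O j)) x, leaf_points Lf i x ->
  pq_emb l (s i x) = s j (l x).

(** The condition of [parallel_along] on an arbitrary interval, as required by the induction over
    the pieces of a [leaf_curve]. *)
Definition parallel_piece i (gamma : R -> 'rV[R]_m) (a b : R) := exists2 B : set R,
  finite_set B &
  forall U (e : forall x, L i x), local_frame U e ->
    let f := curve_coef (gamma := gamma) e (fun t => s i (gamma t)) in
    (forall t : R, a <= t <= b -> U (gamma t) ->
       ccvg (within `[a, b] (nbhs t)) f (f t)) /\
    (forall t : R, a < t < b -> ~ B t -> U (gamma t) ->
       derivable gamma t (1 : R) /\
       is_CD t (1 : R) f (- (conn_form (pq_conn L i) e ('D_(1 : R) gamma t) (gamma t) * f t))).

Lemma leaf_curve_lt i gamma a b : leaf_curve P i gamma a b -> a < b.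
Proof. by elim=> // {}a {}b d _ ab _ bd; exact: lt_trans bd. Qed.

(** On a plaque piece [gamma] is [phi] after [c], and the chain rule turns flatness of [s] on the
    plaque into the transport equation. Continuity of [gamma] comes from the same induction and is
    used whenever coefficients are compared near a time. *)
Lemma leaf_curve_parallel i gamma a b : leaf_curve P i gamma a b ->
  (forall t : R, a <= t <= b -> leaf_points Lf i (gamma t)) ->
  (forall t : R, a <= t <= b ->
    gamma r @[r --> within `[a, b] (nbhs t)] --> gamma t) /\ parallel_piece i gamma a b.
Proof.
elim=> {a b} [a b ab gE Lg|a b I W phi c ab p oI sc gE Lg|a b d lab IH1 lbd IH2 Lg].
- have near_cst (t : R) : \forall r \near within `[a, b] (nbhs t), gamma r = gamma a.
    rewrite near_withinE; apply: nearW => r; rewrite /= in_itv/= => rI.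
    exact: gE.
  have near_cst' (t : R) : a < t < b -> \forall r \near t, gamma r = gamma a.
    move=> tI.
    have N : \forall r \near t, `]a, b[%classic r.
      by apply: open_nbhs_nbhs; split; [exact: interval_open|rewrite /= in_itv].
    apply: filterS N => r /subset_itv_oo_cc; rewrite /= in_itv/= => rI; exact: gE.
  split.
    move=> t tI; rewrite (gE t tI).
    have C : gamma a @[r --> within `[a, b] (nbhs t)] --> gamma a by exact: cvg_cst.
    apply: cvg_trans C.
    by apply: near_eq_cvg; apply: filterS (near_cst t) => r ->.
  exists (@set0 R); first exact: finite_set0.
  move=> U e fe f.
  have fE (r : R) : gamma r = gamma a -> f r = f a.
    by rewrite /f /curve_coef => ->.
  split=> [t tI Ut|t tI _ Ut].
    rewrite (fE t) ?(gE t tI) //; apply: ccvg_near (ccvg_cst (f a) _).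
    by apply: filterS (near_cst t) => r /fE ->.
  have N := near_cst' t tI.
  have gt : gamma t = gamma a by exact: nbhs_singleton N.
  have N' : \forall r \near t, cst (gamma a) r = gamma r by apply: filterS N => r ->.
  split; first exact: near_eq_derivable N' (derivable_cst _ _ _).
  have -> : 'D_(1 : R) gamma t = 0.
    by rewrite -(near_eq_derive _ N') derive_cst.
  rewrite (conn_form0 _ fe Ut) mul0r oppr0.
  apply: is_CD_near (is_CD_cst t (1 : R) (f a)).
  by apply: filterS N => r /fE ->.
- have [[oW _ sphi] _ _ _ _] := p.
  have aI : a <= a <= b by rewrite lexx ltW.
  have sub : phi @` W `<=` leaf_points Lf i.
    move=> _ [x Wx <-]; have [_ Wca gca] := gE a aI.
    by apply: (leaf_points_plaque Lf_leaf p Wca Wx); rewrite -gca; exact: Lg.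
  have cc (t : R) : I t -> {for t, continuous c} by move=> It; exact: Ck_continuous (sc 0) It.
  have dc (t : R) : I t -> derivable c t (1 : R).
    by move=> It; apply: Ck_derivable (sc 1) It.
  have near_g (t : R) : \forall r \near within `[a, b] (nbhs t), phi (c r) = gamma r.
    rewrite near_withinE; apply: nearW => r; rewrite /= in_itv/= => rI.
    by have [_ _ ->] := gE r rI.
  have near_g' (t : R) : a < t < b -> \forall r \near t, phi (c r) = gamma r.
    move=> tI.
    have N : \forall r \near t, `]a, b[%classic r.
      by apply: open_nbhs_nbhs; split; [exact: interval_open|rewrite /= in_itv].
    apply: filterS N => r /subset_itv_oo_cc; rewrite /= in_itv/= => rI.
    by have [_ _ ->] := gE r rI.
  split.
    move=> t tI; have [It Wt gt] := gE t tI.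
    have C : phi (c r) @[r --> t] --> phi (c t).
      exact: (continuous_comp (cc t It) (Ck_continuous (sphi 0) Wt)).
    rewrite gt; apply: cvg_trans (cvg_trans (cvg_app _ (cvg_within _)) C).
    exact: near_eq_cvg (near_g t).
  exists (@set0 R); first exact: finite_set0.
  move=> U e fe f.
  pose fW x := fib_coef (e (phi x)) (s i (phi x)).
  have fWE x : W x -> U (phi x) -> s i (phi x) = fW x *: e (phi x).
    move=> Wx Ux; apply: fib_coefP; first exact: plaque_dom p Wx.
    by have [_ _ _ e0] := fe; apply: e0.
  have [CfW ode] := s_plaque p sub fe fWE.
  have C1 : CCk 1 (W `&` phi @^-1` U) fW by exact: (iffLR (Csmooth_onP _ _) CfW 1).
  have oD : open (W `&` phi @^-1` U) by exact: open_frame_preimage oW sphi _ _ fe.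
  have fE (r : R) : phi (c r) = gamma r -> fW (c r) = f r.
    by rewrite /f /curve_coef /fW => ->.
  have Dt (t : R) : a <= t <= b -> U (gamma t) ->
      (W `&` phi @^-1` U) (c t).
    by move=> tI; have [_ Wt ->] := gE t tI.
  have D (t : R) : a <= t <= b -> U (gamma t) -> is_CD t (1 : R) (fun r => fW (c r))
      (CD ('D_(1 : R) c t) fW (c t)).
    by move=> tI Ut; have [It _ _] := gE t tI; exact: is_CD_comp oD C1 (Dt t tI Ut) (dc t It).
  split=> [t tI Ut|t tI _ Ut].
    have [_ _ gt] := gE t tI.
    rewrite -fE //; apply: ccvg_near; last first.
      exact: (ccvg_within `[a, b] (nbhs_filter t) (is_CD_ccvg (D t tI Ut))).
    by apply: filterS (near_g t) => r /fE ->.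
  have tI' : a <= t <= b by case/andP: tI => *; rewrite !ltW.
  have [It Wt gt] := gE t tI'; have N := near_g' t tI.
  have [dpc dpcE] := is_derive_comp_rV oW (sphi 1) Wt (dc t It).
  have gD : 'D_(1 : R) gamma t = 'D_('D_(1 : R) c t) phi (c t).
    by rewrite -(near_eq_derive _ N).
  split; first exact: near_eq_derivable N dpc.
  rewrite gD gt -(fE t (esym gt)).
  have Upt : U (phi (c t)) by rewrite -gt.
  have -> : - (conn_form (pq_conn L i) e ('D_('D_(1 : R) c t) phi (c t)) (phi (c t)) *
      fW (c t)) = CD ('D_(1 : R) c t) fW (c t).
    have [_ _ _ e0] := fe.
    have := ode (c t) Wt Upt ('D_(1 : R) c t).
    rewrite (conn_formP (pq_conn L i) _ fe Upt) scalerA -scalerDl -(scale0r (e (phi (c t)))).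
    move=> /(scale_frame_inj (e0 _ Upt)) /eqP; rewrite addr_eq0 mulrC => /eqP ->.
    by [].
  apply: is_CD_near (D t tI' Ut).
  by apply: filterS N => r /fE ->.
have ab := leaf_curve_lt lab; have bd := leaf_curve_lt lbd.
have [|c1 [B1 fB1 K1]] := IH1.
  by move=> t /andP[at_ tb]; apply: Lg; rewrite at_ (le_trans tb (ltW bd)).
have [|c2 [B2 fB2 K2]] := IH2.
  by move=> t /andP[bt td]; apply: Lg; rewrite td (le_trans (ltW ab) bt).
split=> [t /andP[at_ td]|].
  by apply: (cvg_within_cat ab bd) => tb; [apply: c1; rewrite at_|apply: c2; rewrite tb].
(* The junction [b] becomes exceptional, since the one-sided derivatives may differ there. *)
exists (B1 `|` B2 `|` [set b]); first by rewrite !finite_setU; split=> //; exact: finite_set1.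
move=> U e fe f; have [cf1 df1] := K1 U e fe; have [cf2 df2] := K2 U e fe.
split=> [t /andP[at_ td] Ut|t /andP[at_ td] nB Ut].
  by apply: (ccvg_within_cat ab bd) => tb; [apply: cf1; rewrite ?at_|apply: cf2; rewrite ?tb].
have [tb|bt|tb] := ltgtP t b.
- by apply: df1 => //; [rewrite at_|move=> Bt; apply: nB; left; left].
- by apply: df2 => //; [rewrite bt|move=> Bt; apply: nB; left; right].
- by exfalso; apply: nB; right.
Qed.

End FlatSection.
End Leaf.
End Prequantum.

Section Prequantum.
Context {R : realType} {m n : nat} {X : topologicalType} {O : orbifold R m X}
  {w : symplectic O} {hbar : R}.
Variables (L : prequantum w hbar) (P : polarization n w).
Variables (Lf : set X) (Lf_leaf : is_leaf P Lf).

Section FlatSection.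
Variable s : forall i x, L i x.
Hypothesis s_plaque : forall i W phi, plaque P i W phi ->
  phi @` W `<=` leaf_points Lf i -> parallel_on_plaque W phi (s i).
Hypothesis s_act : forall i (g : cgrp (O i)) x, leaf_points Lf i x ->
  pq_act g (s i x) = s i (cact g x).
Hypothesis s_emb : forall i j (l : embedding (O i) (O j)) x, leaf_points Lf i x ->
  pq_emb l (s i x) = s j (l x).

Lemma flat_continuous i gamma : leaf_curve P i gamma 0 1 ->
  (forall t : R, 0 <= t <= 1 -> leaf_points Lf i (gamma t)) ->
  forall t : R, 0 <= t <= 1 -> gamma r @[r --> within `[0, 1] (nbhs t)] --> gamma t.
Proof. by move=> lc Lg; have [] := leaf_curve_parallel Lf_leaf s_plaque lc Lg. Qed.

Lemma flat_parallel_along i gamma : leaf_curve P i gamma 0 1 ->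
  (forall t : R, 0 <= t <= 1 -> leaf_points Lf i (gamma t)) ->
  parallel_along (pq_conn L i) (fun t => s i (gamma t)).
Proof.
move=> lc Lg; have [gC [B fB K]] := leaf_curve_parallel Lf_leaf s_plaque lc Lg.
by apply: (parallel_intro (fun t tI => (Lg t tI).1) gC fB) => U e fe; exact: K.
Qed.

(** Along the segment [s] is parallel, so by uniqueness its end value is that of the explicit
    solution with the same start, whose exponential factor never vanishes. *)
Lemma flat_segment_neq0 i W phi U (e : forall x, L i x) a h :
  plaque P i W phi -> phi @` W `<=` leaf_points Lf i -> local_frame U e ->
  (forall t : R, `|t| <= 2 -> (W `&` phi @^-1` U) (a + t *: h)) ->
  s i (phi a) != 0 -> s i (phi (a + h)) != 0.
Proof.
move=> p sub fe seg sa0; have [[oW _ sphi] _ _ _ _] := p.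
have [P' [Q' [P0 Q0 dPQ]]] := segment_solution (pq_conn L i) oW sphi fe seg.
have c1 : `|1 : R| <= 1 by rewrite normr1.
have K := exp_equation oW sphi fe c1 seg dPQ.
have seg1 (t : R) : 0 <= t <= 1 -> W (a + t *: (1 *: h)) by move=> /K[[]].
have Wa : W a by have := seg1 0; rewrite scale0r addr0 lexx ler01; apply.
have Ua : U (phi a) by have [] := seg 0; rewrite ?normr0 // scale0r addr0.
have La : leaf_points Lf i (phi a) by apply: sub; exists a.
have [lc _] := segment_leaf_path p seg1 La.
have par := flat_parallel_along lc (fun t tI => sub _ (imageP phi (seg1 t tI))).
have := frame_Par_parallel fe (segment_equation sphi K) par.
have [_ _ _ e0] := fe.
have sE := fib_coefP (s i (phi a)) La.1 (e0 _ Ua); set z := fib_coef _ _ in sE.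
have := segment_Par_exp oW sphi fe z c1 seg P0 Q0 dPQ.
rewrite /= !scale0r addr0 -sE => ->; rewrite !scale1r => /pt_inj <-.
have z0 : z != 0 by apply: contraNneq sa0 => z0; rewrite sE z0 scale0r.
rewrite !scaler_eq0 !negb_or z0 cexp_neq0 /=; apply: e0.
by have [] := seg 1; rewrite ?normr1 ?ler1n // scale1r.
Qed.

(** [bohr_sommerfeld] provides a non-zero value at one point only; each elementary move preserves
    non-vanishing, which thus spreads over the leaf. *)
Lemma flat_neq0 i x j y : leaf_points Lf i x -> leaf_points Lf j y ->
  s i x != 0 -> s j y != 0.
Proof.
apply: (leaf_connected Lf_leaf (C := fun i x j y => s i x != 0 -> s j y != 0)).
- by move=> {}i {}x {}j {}y k z xy yz /xy.
- move=> {}i g {}x Lx sx; rewrite -s_act //; have [Vx _] := Lx.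
  by have [li inj] := pq_act_linear L g Vx; exact: fibre_neq0.
- move=> {}i {}j l {}x Lx; have [Vx _] := Lx.
  have [li inj] := pq_emb_linear L l Vx; rewrite -s_emb //.
  split; first exact: fibre_neq0.
  by apply: contraNneq => ->; rewrite fibre_linear0.
move=> {}i W phi a p sub Wa.
have [U [e [fe oD Da]]] := ex_plaque_frame L p Wa.
have ND : \forall b \near a, (W `&` phi @^-1` U) b by apply: open_nbhs_nbhs.
apply: filterS2 (near_segment oD Da) ND => b [ab ba] [Wb _].
have := flat_segment_neq0 p sub fe ab; have := flat_segment_neq0 p sub fe ba.
by rewrite !subrKC.
Qed.

Hypothesis s_neq0 : forall i x, leaf_points Lf i x -> s i x != 0.

(** Along an arbitrary path in the leaf, [s] is itself the nowhere zero parallel section that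
    [Par_parallel] requires, so no equation has to be solved. *)
Lemma flat_Par i gamma z : leaf_points Lf i (gamma 0) ->
  leaf_path P i (lifted_leaf P i (gamma 0)) gamma ->
  leaf_points Lf i (gamma 1) /\
  Par (pq_conn L i) gamma (pt (z *: s i (gamma 0))) = pt (z *: s i (gamma 1)).
Proof.
move=> L0 [lc ll].
have Lg (t : R) : 0 <= t <= 1 -> leaf_points Lf i (gamma t).
  by move=> /ll; apply: leaf_points_lifted.
split; first by apply: Lg; rewrite ler01 lexx.
have gV (t : R) : 0 <= t <= 1 -> cdom (O i) (gamma t) by move=> /Lg[].
have gC := flat_continuous lc Lg; have par := flat_parallel_along lc Lg.
exact: (Par_parallel gV gC (fun t tI => s_neq0 (Lg t tI)) par (parallel_scale gV gC z par)).
Qed.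

Lemma flat_join i j (tau : join i j) p q z : leaf_points Lf i p -> leaf_points Lf j q ->
  joins P tau p q -> join_fib tau (pt (z *: s i p)) = pt (z *: s j q).
Proof.
case: tau p q => [{}i g|{}i {}j l|{}i {}j l] p q Lp Lq [pq _]; subst.
- by rewrite /= Phi_pt -?s_act //; case: Lp.
- by rewrite /= emb_pt -?s_emb //; case: Lp.
- have [Vq _] := Lq; have [li _] := pq_emb_linear L l Vq.
  by rewrite -s_emb // -fibre_linearZ // back_pt.
Qed.

Lemma flat_holonomy i j (c : orb_path i j) q z : orb_path_to P Lf c q ->
  holonomy c (pt (z *: s i (start c))) = pt (z *: s j q).
Proof.
elim: c => [{}i {}j gamma tau|{}i {}j k gamma tau c IH] /=.
  move=> [L0 lp [Lq J]]; have [L1 ->] := flat_Par z L0 lp.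
  exact: flat_join.
move=> [L0 lp J cq]; have [L1 ->] := flat_Par z L0 lp.
rewrite (flat_join z L1 _ J); first exact: IH.
exact: orb_path_to_start cq.
Qed.

End FlatSection.

Lemma bohr_sommerfeld_trivial : bohr_sommerfeld L P Lf ->
  forall i (c : orb_path i i), orbifold_loop P Lf c -> trivial_holonomy L c.
Proof.
move=> [s [[i0 [x0 [L0 s0]]] sp sa se]] i c loop v vc.
have s_neq0 j y : leaf_points Lf j y -> s j y != 0.
  by move=> Ly; apply: (flat_neq0 sp sa se L0 Ly s0).
have [u ->] := ptP vc.
have Lc := orb_path_to_end loop.
rewrite (fib_coefP u Lc.1 (s_neq0 _ _ Lc)).
exact: (flat_holonomy sp sa se s_neq0 _ loop).
Qed.

(** * The section obtained by transporting one vector *)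

Section TrivialHolonomy.
Hypothesis triv : forall i (c : orb_path i i), orbifold_loop P Lf c -> trivial_holonomy L c.
Variables (i0 : oidx O) (x0 : 'rV[R]_m) (L0 : leaf_points Lf i0 x0).
Variables (v0 : L i0 x0) (v00 : v0 != 0).

Definition hol_section i x : L i x :=
  xget 0 [set y | exists2 c : orb_path i0 i, good_path L P Lf x0 x c &
    holonomy c (pt v0) = pt y].

Lemma hol_sectionP i x (c : orb_path i0 i) : good_path L P Lf x0 x c ->
  holonomy c (pt v0) = pt (hol_section i x).
Proof.
move=> gc; have [sc cx [u [u' [u0 u'0 cu]]]] := gc.
have [Vx0 _] := L0; have Lx := orb_path_to_end cx; have [Vx _] := Lx.
have hol : holonomy c (pt v0) = pt (fib_coef u v0 *: u').
  by rewrite {1}(fib_coefP v0 Vx0 u0).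
rewrite hol; congr pt; rewrite /hol_section; set S := [set y | _].
have Su : S (fib_coef u v0 *: u') by exists c.
have [c' gc' hol'] : S (xget 0 S) by apply: xgetI Su.
(* Two paths to [x] closed up by the same return path [d] give two loops, and the
   holonomy of [d] is injective. *)
have [d gd] := good_connected L Lf_leaf Lx L0.
have loop (c1 : orb_path i0 i) (y : L i x) : good_path L P Lf x0 x c1 ->
    holonomy c1 (pt v0) = pt y -> holonomy d (pt y) = pt v0.
  move=> g1 <-; rewrite -holonomy_cat.
  have [s1 p1 _] := good_path_cat g1 gd.
  by apply: triv; rewrite /orbifold_loop s1.
have [_ _ [t [t' [t0 t'0 dt]]]] := gd.
have := loop _ _ gc' hol'; rewrite -(loop _ _ gc hol).
set y1 := xget 0 S; set y2 := _ *: u'.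
rewrite {1}(fib_coefP y1 Vx t0) {1}(fib_coefP y2 Vx t0) !dt => /pt_inj.
by move=> /(scale_frame_inj t'0) E; rewrite (fib_coefP y1 Vx t0) E -fib_coefP.
Qed.

(** Equivariance, compatibility with embeddings and flatness are all instances, with [d] a constant
    path followed by an identification or a short segment. *)
Lemma hol_section_step i x j y (d : orb_path i j) : leaf_points Lf i x ->
  good_path L P Lf x y d ->
  holonomy d (pt (hol_section i x)) = pt (hol_section j y).
Proof.
move=> Lx gd; have [c gc] := good_connected L Lf_leaf L0 Lx.
by rewrite -(hol_sectionP gc) -holonomy_cat (hol_sectionP (good_path_cat gc gd)).
Qed.

Lemma hol_section_act i (g : cgrp (O i)) x : leaf_points Lf i x ->
  pq_act g (hol_section i x) = hol_section i (cact g x).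
Proof.
move=> Lx; have [Vx _] := Lx; apply: pt_inj.
rewrite -(hol_section_step Lx (good_act L P g Lx)) /= Par_cst //.
Qed.

Lemma hol_section_emb i j (l : embedding (O i) (O j)) x : leaf_points Lf i x ->
  pq_emb l (hol_section i x) = hol_section j (l x).
Proof.
move=> Lx; have [Vx _] := Lx; apply: pt_inj.
rewrite -(hol_section_step Lx (good_emb L P l Lx)) /= Par_cst //.
Qed.

Lemma hol_section_base : hol_section i0 x0 != 0.
Proof.
(* A good path from [x0] to itself is a loop, so its holonomy returns [v0]. *)
have [c gc] := good_connected L Lf_leaf L0 L0.
have := hol_sectionP gc; have [sc cx _] := gc.
rewrite (triv (c := c)) ?sc // => [/pt_inj <-//|].
by rewrite /orbifold_loop sc.
Qed.

Lemma hol_section_plaque i W phi : plaque P i W phi ->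
  phi @` W `<=` leaf_points Lf i -> parallel_on_plaque W phi (hol_section i).
Proof.
move=> p sub U e f fe ef; have [[oW _ sphi] _ _ _ _] := p.
have [_ _ _ e0] := fe.
(* This is [f_transport] for the coefficient of the section: a short segment is a good path, so
   [hol_section_step] applies with its explicit holonomy. *)
have tr a h (P' Q' : R -> R) (c : R) : `|c| <= 1 ->
    (forall t : R, `|t| <= 2 -> (W `&` phi @^-1` U) (a + t *: h)) -> P' 0 = 0 -> Q' 0 = 0 ->
    (forall t : R, `|t| < 2 ->
      is_derive t (1 : R) P' (complex.Re (- pull_form (pq_conn L i) phi e h (a + t *: h))) /\
      is_derive t (1 : R) Q' (complex.Im (- pull_form (pq_conn L i) phi e h (a + t *: h)))) ->
    f (a + c *: h) = f a * cexp (P' c) (Q' c).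
  move=> c1 seg P0 Q0 dPQ.
  have [Wa Ua] : (W `&` phi @^-1` U) a by have := seg 0; rewrite normr0 scale0r addr0; apply.
  have [Wb Ub] : (W `&` phi @^-1` U) (a + c *: h) by apply: seg; rewrite (le_trans c1) // ler1n.
  have La : leaf_points Lf i (phi a) by apply: sub; exists a.
  have [gd hd] := good_segment p sub fe c1 seg P0 Q0 dPQ.
  have := hol_section_step La gd.
  rewrite (ef a Wa Ua) hd (ef _ Wb Ub) scalerA => /pt_inj E.
  by rewrite (scale_frame_inj (e0 _ Ub) E).
split; first by apply/Csmooth_onP => k; exact: (transport_smooth oW sphi fe tr).
move=> a Wa Ua h.
have D := transport_is_CD oW sphi fe tr h (conj Wa Ua).
rewrite (is_CD_val D) (conn_formP _ _ fe Ua) scalerA -scalerDl.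
by rewrite [f a * _]mulrC addNr scale0r.
Qed.

Lemma trivial_bohr_sommerfeld : bohr_sommerfeld L P Lf.
Proof.
exists hol_section; split.
- by exists i0, x0; split=> //; exact: hol_section_base.
- exact: hol_section_plaque.
- exact: hol_section_act.
- exact: hol_section_emb.
Qed.

End TrivialHolonomy.

(** The closing identification leads from [gamma 1] back to [gamma 0], hence the inverse of [g].
    Loops refer to the lifted leaf through [gamma 0], so [Lt] is re-based there by symmetry and
    transitivity. *)
Lemma single_chart_loop i Lt (gamma : R -> 'rV[R]_m) (g : cgrp (O i)) :
  is_lifted_leaf P Lf i Lt -> leaf_path P i Lt gamma -> gamma 1 = cact g (gamma 0) ->
  orbifold_loop P Lf (orb_last gamma (join_grp g^-1%g)).
Proof.
move=> [x [Lx ->]] [lc ll] g1.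
have x0 : lifted_leaf P i x (gamma 0) by apply: ll; rewrite lexx ler01.
have Lg0 := leaf_points_lifted Lf_leaf Lx x0; have [V0 _] := Lg0.
have gK : cact g^-1%g (gamma 1) = gamma 0 by rewrite g1 -cactM // mulVg cact1.
split=> //.
  split=> // t tI; apply: lifted_leaf_trans (ll t tI).
  exact: lifted_leaf_sym.
split=> //; split=> // _ [y xy <-].
by have := lifted_leaf_act g^-1%g xy; rewrite gK.
Qed.

End Prequantum.

Theorem proposition5p13 (R : realType) (n : nat) (X : topologicalType)
    (O : orbifold R (2 * n)%N X) (w : symplectic O)
    (P : polarization n w) (Preal : real_polarization P)
    (hbar : R) (hbar_gt0 : 0 < hbar) (L : prequantum w hbar)
    (Lf : set X) (Lf_leaf : is_leaf P Lf) :
  (bohr_sommerfeld L P Lf <->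
   forall (i : oidx O) (c : orb_path i i),
     orbifold_loop P Lf c -> trivial_holonomy L c) /\
  (forall (i : oidx O) (Lt : set 'rV[R]_(2 * n)) (gamma : R -> 'rV[R]_(2 * n))
      (g : cgrp (O i)),
     is_lifted_leaf P Lf i Lt -> leaf_path P i Lt gamma ->
     cact g @` Lt = Lt -> gamma 1 = cact g (gamma 0) ->
     let c := orb_last gamma (join_grp g^-1%g) in
     orbifold_loop P Lf c /\
     (trivial_holonomy L c <->
      forall v : total_space (L i), projT1 v = gamma 0 ->
        Phi L g^-1%g (Par (pq_conn L i) gamma v) = v)).
Proof.
split; last first.
  (* For a one-piece loop [holonomy] unfolds to [Phi] after [Par] and [start] to [gamma 0], so the
     equivalence is definitional. *)
  move=> i Lt gamma g lt lp _ g1 c; split=> //.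
  exact: (single_chart_loop Lf_leaf lt lp g1).
split; first exact: bohr_sommerfeld_trivial.
move=> triv; have [p0 LfE] := Lf_leaf.
(* A leaf is an equivalence class, hence non-empty: its base point has a lift, and a local frame
   there gives the non-zero vector to transport. *)
have [i0 [x0 [V0 x0o]]] := o_cover O p0.
have L0 : leaf_points Lf i0 x0.
  by split=> //; rewrite /preimage /= x0o LfE; exact: Relation_Operators.rst_refl.
have [U [e [[_ _ _ e0] U0]]] := ex_local_frame (E := L i0) V0.
exact: (trivial_bohr_sommerfeld Lf_leaf triv L0 (e0 _ U0)).
Qed.
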